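(* Let $N\ge1$, $\mathcal N=\{1,\dots,N\}$, $T>0$, $Q_T=(0,T)\times\mathbb R$, let $\boldsymbol U_0\in((L^1\cap\mathrm{BV})(\mathbb R;[0,1]))^N$, and assume the standing hypotheses of the context on $f^k,\nu^k,\mu^{j,k},\Gamma^{j,k}$; in particular each $\Gamma^{j,k}$ is supported in $[0,1]$ with $\int_{\mathbb R^+}\Gamma^{j,k}(\tau)\,d\tau=1$. For $\delta>0$ put $\Gamma^{j,k}_\delta(t)=\frac1\delta\Gamma^{j,k}(t/\delta)$ and $\Theta^{j,k}_\delta(t,x)=\mu^{j,k}(x)\Gamma_\delta^{j,k}(t)$. Let $\boldsymbol U$ be the entropy solution of the memoryless system $$\partial_t U^{k}+\partial_x\big(f^k(U^k)\,\nu^k((\boldsymbol\mu\circledast\boldsymbol U)^k)\big)=0\ \text{ in }Q_T,\qquad U^k(0,\cdot)=U_0^k,\qquad k\in\mathcal N,$$ and let $\boldsymbol U_\delta$ be the entropy solution of the system with memory $$\partial_t U_\delta^{k}+\partial_x\big(f^k(U_\delta^k)\,\nu^k((\boldsymbol\Theta_\delta\circledast\boldsymbol U_\delta)^k)\big)=0\ \text{ in }Q_T,\qquad U_\delta^k(0,\cdot)=U_0^k,\qquad k\in\mathcal N$$ (entropy solutions being understood in the sense given in the context). Then, as $\delta\to0$, $\boldsymbol U_\delta$ converges to $\boldsymbol U$ in $L^1$ norm, and $$\|\boldsymbol U_\delta(T)-\boldsymbol U(T)\|_{(L^1(\mathbb R))^N}=\mathcal O(\sqrt\delta)\qquad(\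delta\to0).$$
   Context: **Standing hypotheses** (for all $j,k\in\mathcal N$): (H1) $f^k:\mathbb R\to\mathbb R$ is Lipschitz with $f^k(0)=f^k(1)=0$. (H2) $\nu^k\in (C^2\cap \mathrm{BV}\cap W^{2,\infty})(\mathbb R^N;\mathbb R)$. (H3) $\mu^{j,k}\in C^2(\mathbb R)\cap W^{2,\infty}(\mathbb R)$ and $\Gamma^{j,k}\in C^2([0,\infty);\mathbb R^+)\cap W^{2,\infty}([0,\infty);\mathbb R^+)$ (nonnegative values). Moreover $\operatorname{supp}\Gamma^{j,k}\subseteq[0,1]$ and $\int_0^\infty\Gamma^{j,k}(\tau)\,d\tau=1$. **Nonlocal operators.** $(\boldsymbol\Theta_\delta\circledast\boldsymbol U)^k=(\Theta_\delta^{j,k}*U^j)_{j\in\mathcal N}$ and $(\boldsymbol\mu\circledast\boldsymbol U)^k=(\mu^{j,k}*U^j)_{j\in\mathcal N}$, where $$(\Theta_\delta^{j,k}*U^j)(t,x)=\int_0^t\int_{\mathbb R}U^j(\tau,\xi)\,\mu^{j,k}(x-\xi)\,\Gamma_\delta^{j,k}(t-\tau)\,d\xi\,d\tau,\qquad (\mu^{j,k}*U^j)(t,x)=\int_{\mathbb R}U^j(t,\xi)\,\mu^{j,k}(x-\xi)\,d\xi .$$ **Entropy solution.** Write $W^k[\boldsymbol U]$ for $(\boldsymbol\Theta_\delta\circledast\boldsymbol U)^k$ (system with memory) or $(\boldsymbol\mu\circledast\boldsymbol U)^k$ (memoryless system). $\boldsymbol U\in (C([0,T];L^1(\mathbb R;[0,1]))\cap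 L^\infty([0,T];\mathrm{BV}(\mathbb R)))^N$ is an entropy solution of $\partial_tU^k+\partial_x(f^k(U^k)\nu^k(W^k[\boldsymbol U]))=0$, $k\in\mathcal N$, with initial data $\boldsymbol U_0$ if for each $k\in\mathcal N$, $\alpha\in\mathbb R$ and each nonnegative $\phi\in C_c^\infty([0,T)\times\mathbb R)$, $$\begin{aligned}&\int_{Q_T}|U^k-\alpha|\,\phi_t\,dx\,dt+\int_{\mathbb R}|U_0^k(x)-\alpha|\,\phi(0,x)\,dx\\&+\int_{Q_T}\mathrm{sgn}(U^k-\alpha)\,\nu^k(W^k[\boldsymbol U])\,(f^k(U^k)-f^k(\alpha))\,\phi_x\,dx\,dt\\&-\int_{Q_T}f^k(\alpha)\,\mathrm{sgn}(U^k-\alpha)\,\partial_x\big[\nu^k(W^k[\boldsymbol U])\big]\,\phi\,dx\,dt\ \ge 0.\end{aligned}$$ **Norm.** $\|\boldsymbol Z\|_{(L^1(\mathbb R))^N}=\sum_{k\in\mathcal N}\|Z^k\|_{L^1(\mathbb R)}$. The constant implied by $\mathcal O$ is independent of $\delta$. *)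

(* Defs.v *)
From HB Require Import structures.
From mathcomp Require Import all_boot all_order all_algebra.
From mathcomp Require Import all_classical all_reals all_analysis.
Set Implicit Arguments.
Unset Strict Implicit.
Unset Printing Implicit Defensive.
Import Order.TTheory GRing.Theory Num.Theory.
Import numFieldNormedType.Exports.
Local Open Scope classical_set_scope.
Local Open Scope ring_scope.

Section regularity.
Context {R : realType}.

(* V is finite-dimensional in every use: then C^n.+1 means differentiable with
   all directional derivatives of class C^n. *)
Fixpoint Ck (V W : normedModType R) (n : nat) (f : V -> W) : Prop :=
  match n with
  | 0 => continuous f
  | m.+1 => (forall x, differentiable f x) /\ forall v, Ck m ('D_v f)
  end.

(* C^2 functions on the closed half-line are the restrictions to [0, +oo[ of
   C^2 functions on R; the values of g at negative points are irrelevant. *)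
Definition C2_halfline (g : R -> R) : Prop :=
  exists2 G : R -> R, Ck 2 G & forall t, 0 <= t -> g t = G t.

(* Membership in W^{2,oo}(D), D open, for functions that are C^2 on D: their
   weak derivatives are the classical ones, and for these continuous functions
   essential boundedness on D is boundedness on D. *)
Definition W2oo (V : normedModType R) (D : set V) (f : V -> R) : Prop :=
  [/\ [bounded f x | x in D],
      forall v, [bounded 'D_v f x | x in D] &
      forall v w, [bounded 'D_w ('D_v f) x | x in D]].

Definition compactly_supported_in (V W : normedModType R) (D : set V)
    (f : V -> W) : Prop :=
  exists K : set V, [/\ compact K, K `<=` D & forall x, ~ K x -> f x = 0].

End regularity.

Section bounded_variation.
Context {R : realType}.
Local Notation leb := (@lebesgue_measure R).

(* Total mass of the distributional derivative; it depends only on the a.e.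
   class of u. *)
Definition TV (u : R -> R) : \bar R :=
  ereal_sup [set (\int[leb]_x (u x * (phi^`())%classic x))%:E | phi in
    [set phi : R -> R | [/\ Ck 1 phi, compactly_supported_in setT phi &
                            forall x, `|phi x| <= 1]]].

(* The integral over R^n as an iterated integral. It is only used on continuous
   compactly supported functions, where Fubini's theorem identifies it with the
   integral against the n-dimensional Lebesgue measure. *)
Fixpoint integral_rV (n : nat) : ('rV[R]_n -> R) -> R :=
  match n with
  | 0 => fun f => f 0
  | m.+1 => fun f =>
      \int[leb]_x integral_rV (fun v : 'rV[R]_m =>
        f (row_mx (const_mx x : 'rV[R]_1) v))
  end.

Definition divergence (n : nat) (phi : 'rV[R]_n -> 'rV[R]_n) (x : 'rV[R]_n) : R :=
  \sum_(i < n) ('D_(delta_mx 0 i) phi x) 0 i.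

(* Total mass of the distributional gradient of a continuous u. The norm of
   'rV[R]_n is the sup norm, hence the explicit Euclidean constraint on phi. *)
Definition TV_rV (n : nat) (u : 'rV[R]_n -> R) : \bar R :=
  ereal_sup [set (integral_rV (fun x => u x * divergence phi x))%:E | phi in
    [set phi : 'rV[R]_n -> 'rV[R]_n |
      [/\ Ck 1 phi, compactly_supported_in setT phi &
          forall x, \sum_(i < n) (phi x 0 i) ^+ 2 <= 1]]].

End bounded_variation.

Section nonlocal_conservation_laws.
Context {R : realType} {N : nat}.
Local Notation leb := (@lebesgue_measure R).
Local Notation field := ('I_N -> R -> R -> R). (* U k t x *)

Definition normL1N (Z : 'I_N -> R -> R) : \bar R :=
  (\sum_(k < N) 'N[leb]_1[EFin \o Z k])%E.

Definition L1_01 (u : R -> R) : Prop :=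
  leb.-integrable setT (EFin \o u) /\ {ae leb, forall x, 0 <= u x <= 1}.

Definition scaled_kernel (delta : R) (Gamma : R -> R) (t : R) : R :=
  delta^-1 * Gamma (t / delta).

Definition Theta (mu Gamma : 'I_N -> 'I_N -> R -> R) (delta : R)
    (j k : 'I_N) (t x : R) : R :=
  mu j k x * scaled_kernel delta (Gamma j k) t.

Definition conv_space (mu : 'I_N -> 'I_N -> R -> R)
    (U : field) (k : 'I_N) (t x : R) : 'rV[R]_N :=
  \row_(j < N) \int[leb]_xi (U j t xi * mu j k (x - xi)).

Definition conv_memory (Th : 'I_N -> 'I_N -> R -> R -> R)
    (U : field) (k : 'I_N) (t x : R) : 'rV[R]_N :=
  \row_(j < N) \int[leb]_(tau in `[0, t])
    \int[leb]_xi (U j tau xi * Th j k (t - tau) (x - xi)).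

(* u represents an element of C([0,T]; L^1(R;[0,1])) `&` L^oo([0,T]; BV(R)).
   Joint measurability only selects the representative: every element of this
   space has a Borel representative on [0,T] x R. *)
Definition solution_space (T : R) (u : R -> R -> R) : Prop :=
  [/\ measurable_fun (`[0, T] `*` setT) (fun p : R * R => u p.1 p.2),
      forall t : R, t \in `[0, T] -> L1_01 (u t),
      forall t : R, t \in `[0, T] ->
        'N[leb]_1[EFin \o (u s \- u t)%R]%E @[s --> within `[0, T] (nbhs t)]
          --> 0%E &
      exists M : R, {ae leb, forall t : R, t \in `[0, T] -> (TV (u t) <= M%:E)%E}].

(* C_c^oo([0,T) x R), as restrictions of functions that are smooth and compactly
   supported in ]-oo, T[ x R; only t >= 0 matters for the sign. *)
Definition nonneg_test_function (T : R) (phi : R * R -> R) : Prop :=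
  [/\ forall n, Ck n phi,
      compactly_supported_in [set p : R * R | p.1 < T] phi &
      forall p : R * R, 0 <= p.1 -> 0 <= phi p].

Definition entropy_solution (T : R) (f : 'I_N -> R -> R)
    (nu : 'I_N -> 'rV[R]_N -> R) (W : field -> 'I_N -> R -> R -> 'rV[R]_N)
    (U0 : 'I_N -> R -> R) (U : field) : Prop :=
  let leb2 := (leb \x leb)%E in
  let QT := (`]0, T[ `*` setT : set (R * R)) in
  let V k (t x : R) := nu k (W U k t x) in
  (forall k, solution_space T (U k)) /\
  forall k (alpha : R) (phi : R * R -> R), nonneg_test_function T phi ->
    0 <= \int[leb2]_(p in QT) (`|U k p.1 p.2 - alpha| * 'D_(1, 0) phi p)
       + \int[leb]_x (`|U0 k x - alpha| * phi (0, x))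
       + \int[leb2]_(p in QT)
           (Num.sg (U k p.1 p.2 - alpha) * V k p.1 p.2
            * (f k (U k p.1 p.2) - f k alpha) * 'D_(0, 1) phi p)
       - \int[leb2]_(p in QT)
           (f k alpha * Num.sg (U k p.1 p.2 - alpha)
            * ((V k p.1)^`())%classic p.2 * phi p).

End nonlocal_conservation_laws.

(* Main.v *)
(* The proof is Kruzhkov's doubling of variables, organised around the L^1
   distance of the two solutions. Doubling in space and time turns the two entropy
   inequalities into
     d/dt |U^k - U_delta^k|_1 <= L (TV(U^k) + |U^k|_1) c(t),
   where c(t) bounds the difference of the two velocities and of their space
   derivatives at time t. Only translates of U^k enter, through the bound
   |U^k(. + r) - U^k|_1 <= TV(U^k) |r|, so that no derivative of a BV function is
   needed, and the constants involve U but not U_delta.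
   The velocities differ through averages over times in [t - delta, t], which
   carry full mass only for t >= delta. As U is 1/2-Hoelder in time with values in
   L^1 (mollify at scale sqrt |t - s|), one can take
     c(t) = C (1_{t < delta} + sqrt delta + sup_{s <= t} |U(s) - U_delta(s)|_1),
   and Gronwall's argument concludes, the initial layer contributing O(delta). *)

Require Import Defs.
From HB Require Import structures.
From mathcomp Require Import all_boot all_order all_algebra.
From mathcomp Require Import all_classical all_reals all_analysis.
From mathcomp Require Import measurable_realfun ring lra.
Set Implicit Arguments.
Unset Strict Implicit.
Unset Printing Implicit Defensive.
Import Order.TTheory GRing.Theory Num.Theory.
Import numFieldNormedType.Exports.
Local Open Scope classical_set_scope.
Local Open Scope ring_scope.

(** * Real-valued Lebesgue integrals and Fubini's theorem *)

(** The estimates treat the two solutions asymmetrically. In space, the sum of the two doubled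
    fluxes is written as the Kruzhkov entropy flux times an x-derivative, x being the variable of
    [U]; a difference quotient moves that derivative onto [U], and the mass of the other solution
    enters only remainders that vanish with the step. In time, only the velocity of the memoryless
    system is moved, so the other one need not be continuous in time. The velocity error at time t
    involves the past, so Gronwall's argument is not differential. The maximum S of exp(- lambda t)
    times the distance of the solutions is inserted into c: the supremum over the past becomes S
    exp(lambda t), the indicator of t < delta is replaced by exp(1 - t / delta), and c acquires an
    explicit primitive. Entropy solutions are determined only almost everywhere and only on [0, T].
    They are replaced by jointly measurable representatives with values in [0, 1], frozen outside
    [0, T], so that Fubini's theorem and uniform moduli meet no exceptional set. The initial datum
    appears only inside the entropy inequality, so that equality at time 0 has to be derived as
    well. *)

Notation integrable_real mu f := (mu.-integrable setT (EFin \o f)).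

Section real_integral.
Context {d} {T : measurableType d} {R : realType}.
Variable mu : {measure set T -> \bar R}.
Local Notation ig f := (integrable_real mu f).
Implicit Types f g : T -> R.

Lemma ig_meas f : ig f -> measurable_fun setT f.
Proof. by move=> /(measurable_int mu) /measurable_EFinP. Qed.

Lemma ig_le f g : measurable_fun setT f -> (forall x, `|f x| <= g x) ->
  ig g -> ig f.
Proof.
move=> mf fg ig_g; apply: (le_integrable measurableT _ _ ig_g).
  exact/measurable_EFinP.
by move=> x _ /=; rewrite lee_fin (le_trans (fg x))// ler_norm.
Qed.

Lemma igD f g : ig f -> ig g -> ig (fun x => f x + g x).
Proof. by move=> hf hg; have := integrableD measurableT hf hg. Qed.

Lemma igB f g : ig f -> ig g -> ig (fun x => f x - g x).
Proof. by move=> hf hg; have := integrableB measurableT hf hg. Qed.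

Lemma igZ (c : R) f : ig f -> ig (fun x => c * f x).
Proof. by move=> hf; have := integrableZl measurableT c hf. Qed.

Lemma igN f : ig f -> ig (fun x => - f x).
Proof. by move=> hf; have := integrableN hf. Qed.

Lemma ig_abs f : ig f -> ig (fun x => `|f x|).
Proof.
move=> h; have := ig_meas h => mf; apply: (le_integrable measurableT _ _ h).
  by apply/measurable_EFinP; exact: measurableT_comp.
by move=> x _ /=; rewrite lee_fin normr_id.
Qed.

Lemma ig0 : ig (fun _ : T => 0 : R).
Proof. exact: (integrable0 mu). Qed.

Lemma le_int f g : ig f -> ig g -> (forall x, f x <= g x) ->
  \int[mu]_x f x <= \int[mu]_x g x.
Proof. by move=> ? ? ?; exact: le_Rintegral. Qed.

Lemma intD f g : ig f -> ig g ->
  \int[mu]_x (f x + g x) = \int[mu]_x f x + \int[mu]_x g x.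
Proof. by move=> ? ?; exact: RintegralD. Qed.

Lemma intB f g : ig f -> ig g ->
  \int[mu]_x (f x - g x) = \int[mu]_x f x - \int[mu]_x g x.
Proof. by move=> ? ?; exact: RintegralB. Qed.

Lemma intZ (c : R) f : ig f -> \int[mu]_x (c * f x) = c * \int[mu]_x f x.
Proof. by move=> ?; exact: RintegralZl. Qed.

Lemma intN f : ig f -> \int[mu]_x (- f x) = - \int[mu]_x f x.
Proof.
move=> h; rewrite -mulN1r -intZ//; apply: eq_Rintegral => x _.
by rewrite mulN1r.
Qed.

Lemma eq_int f g : f =1 g -> \int[mu]_x f x = \int[mu]_x g x.
Proof. by move=> fg; apply: eq_Rintegral => x _. Qed.

Lemma int0 : \int[mu]_(x in setT) (0 : R) = 0.
Proof. by rewrite /Rintegral integral0. Qed.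

Lemma int_ge0 f : (forall x, 0 <= f x) -> 0 <= \int[mu]_x f x.
Proof. by move=> f0; exact: Rintegral_ge0. Qed.

Lemma abs_int_le f g : measurable_fun setT f -> (forall x, `|f x| <= g x) ->
  ig g -> `|\int[mu]_x f x| <= \int[mu]_x g x.
Proof.
move=> mf fg ig_g; have igf := ig_le mf fg ig_g.
apply: (le_trans (le_normr_Rintegral measurableT igf)).
by apply: le_int => //; exact: ig_abs.
Qed.

Lemma abs_intB_le f g : ig f -> ig g ->
  `|\int[mu]_x f x - \int[mu]_x g x| <= \int[mu]_x `|f x - g x|.
Proof.
move=> igf igg; rewrite -intB//; apply: abs_int_le => //.
  by apply: ig_meas; exact: igB.
by apply: ig_abs; exact: igB.
Qed.

Lemma int_EFin f : ig f -> (\int[mu]_x (f x)%:E)%E = (\int[mu]_x f x)%:E.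
Proof. by move=> h; rewrite fineK//; exact: integrable_fin_num. Qed.

Lemma ig_le_ltey f : measurable_fun setT f -> 
  (\int[mu]_x `|f x|%:E < +oo)%E -> ig f.
Proof. by move=> mf h; apply/integrableP; split=> //; exact/measurable_EFinP. Qed.

Lemma ae_eq_int f g : measurable_fun setT f -> measurable_fun setT g ->
  {ae mu, forall x, f x = g x} -> \int[mu]_x f x = \int[mu]_x g x.
Proof.
move=> mf mg fg; rewrite /Rintegral; congr fine.
apply: ae_eq_integral => //; [exact/measurable_EFinP..|].
by apply: filterS fg => x /= -> _.
Qed.

Lemma int_indic (D : set T) f : \int[mu]_(x in D) f x = \int[mu]_x (\1_D x * f x).
Proof.
rewrite /Rintegral integral_mkcond; congr fine; apply: eq_integral => x _ /=.
by rewrite patchE indicE; case: (x \in D); rewrite ?mul1r ?mul0r.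
Qed.

End real_integral.

Section real_fubini.
Context {d1 d2} {T1 : measurableType d1} {T2 : measurableType d2} {R : realType}.
Variables (m1 : {sigma_finite_measure set T1 -> \bar R})
          (m2 : {sigma_finite_measure set T2 -> \bar R}).
Implicit Type f : T1 * T2 -> R.

(** Tonelli measurability applies to the positive and negative parts separately; extended
    subtraction and [fine] stay measurable even where both parts are infinite, so bare measurability
    of [f] suffices. *)
Lemma meas_param1 f : measurable_fun setT f ->
  measurable_fun setT (fun x => \int[m2]_y f (x, y)).
Proof.
move=> mf; have mfE : measurable_fun setT (fun z => (f z)%:E) by exact/measurable_EFinP.
apply: (measurableT_comp (fine_measurable measurableT)) => //.
rewrite (_ : (fun x => _) = (fun x => \int[m2]_y (fun z => (f z)%:E)^\+ (x, y))
   \- (fun x => \int[m2]_y (fun z => (f z)%:E)^\- (x, y)))%E; last first.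
  apply/funext => x; rewrite integralE/=.
  by congr (_ - _)%E; apply: eq_integral => y _; rewrite ?funeposE ?funenegE.
apply: emeasurable_funB.
- by apply: measurable_fun_fubini_tonelli_F => //; exact: measurable_funepos.
- by apply: measurable_fun_fubini_tonelli_F => //; exact: measurable_funeneg.
Qed.

Lemma meas_param2 f : measurable_fun setT f ->
  measurable_fun setT (fun y => \int[m1]_x f (x, y)).
Proof.
move=> mf; have mfE : measurable_fun setT (fun z => (f z)%:E) by exact/measurable_EFinP.
apply: (measurableT_comp (fine_measurable measurableT)) => //.
rewrite (_ : (fun x => _) = (fun y => \int[m1]_x (fun z => (f z)%:E)^\+ (x, y))
   \- (fun y => \int[m1]_x (fun z => (f z)%:E)^\- (x, y)))%E; last first.
  apply/funext => x; rewrite integralE/=.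
  by congr (_ - _)%E; apply: eq_integral => y _; rewrite ?funeposE ?funenegE.
apply: emeasurable_funB.
- by apply: measurable_fun_fubini_tonelli_G => //; exact: measurable_funepos.
- by apply: measurable_fun_fubini_tonelli_G => //; exact: measurable_funeneg.
Qed.

(** Almost every section is integrable, and there the real inner integral agrees with the extended
    one; the outer integral does not see the other sections. *)
Lemma Rfubini1 f : integrable_real (m1 \x m2)%E f ->
  \int[(m1 \x m2)%E]_z f z = \int[m1]_x \int[m2]_y f (x, y).
Proof.
move=> igf; rewrite {1}/Rintegral -integral12_prod_meas1//.
congr fine; apply: ae_eq_integral => //=.
- exact: (measurable_fubini_F igf).
- by apply/measurable_EFinP; apply: meas_param1; exact: ig_meas igf.
- have := ae_integrable1 igf; apply: filterS => x /= igx _.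
  by rewrite /fubini_F/= (int_EFin igx).
Qed.

Lemma Rfubini2 f : integrable_real (m1 \x m2)%E f ->
  \int[(m1 \x m2)%E]_z f z = \int[m2]_y \int[m1]_x f (x, y).
Proof.
move=> igf; rewrite {1}/Rintegral -integral21_prod_meas1//.
congr fine; apply: ae_eq_integral => //=.
- exact: (measurable_fubini_G igf).
- by apply/measurable_EFinP; apply: meas_param2; exact: ig_meas igf.
- have := ae_integrable2 igf; apply: filterS => x /= igx _.
  by rewrite /fubini_G/= (int_EFin igx).
Qed.

Lemma ig_param1 f : integrable_real (m1 \x m2)%E f ->
  integrable_real m1 (fun x => \int[m2]_y f (x, y)).
Proof.
move=> igf; apply/integrableP; split.
  by apply/measurable_EFinP; apply: meas_param1; exact: ig_meas igf.
have /integrableP[_] := integrable_fubini_F igf.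
congr (_ < _)%E; apply: ae_eq_integral => //.
- by apply: measurableT_comp => //; exact: (measurable_fubini_F igf).
- apply: measurableT_comp => //; apply/measurable_EFinP.
  by apply: meas_param1; exact: ig_meas igf.
- have := ae_integrable1 igf; apply: filterS => x /= igx _.
  by rewrite /fubini_F/= (int_EFin igx).
Qed.

Lemma le_abs_param2 f : integrable_real (m1 \x m2)%E f ->
  (\int[m2]_y `|\int[m1]_x f (x, y)|%:E <= \int[m2]_y \int[m1]_x `|(f (x, y))%:E|)%E.
Proof.
move=> igf; have mf := ig_meas igf; have igaf := ig_abs igf.
apply: ge0_le_integral => //.
- apply/measurable_EFinP; apply: measurableT_comp => //; exact: meas_param2.
- apply: (measurable_fun_fubini_tonelli_G (fun z => `|(f z)%:E|%E)) => //=.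
  by apply/measurable_EFinP; exact: (ig_meas igaf).
have mfy y : measurable_fun setT (fun x => f (x, y)).
  exact: (measurableT_comp mf).
move=> y _ /=; rewrite /Rintegral.
have [|] := boolP (\int[m1]_x (f (x, y))%:E \is a fin_num)%E.
  move=> /fineK E; rewrite -[leLHS]/(`|_%:E|)%E E.
  by apply: le_abse_integral => //; exact/measurable_EFinP.
(* An infinite section integral has [fine] value 0, so the bound is trivial there. *)
by rewrite fin_numE negb_and !negbK => /orP[]/eqP->; 
  rewrite /= normr0; exact: integral_ge0.
Qed.

Lemma ig_param2 f : integrable_real (m1 \x m2)%E f ->
  integrable_real m2 (fun y => \int[m1]_x f (x, y)).
Proof.
move=> igf; apply: ig_le_ltey; first by apply: meas_param2; exact: (ig_meas igf).
apply: le_lt_trans (le_abs_param2 igf) _.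
exact: (integrable21ltyP m1 m2 (measurable_int _ igf)).1 igf.
Qed.

Lemma int_abs_param2 f : integrable_real (m1 \x m2)%E f ->
  \int[m2]_y `|\int[m1]_x f (x, y)| <= \int[(m1 \x m2)%E]_z `|f z|.
Proof.
move=> igf; have igaf := ig_abs igf; have := le_abs_param2 igf.
rewrite -(fubini_tonelli2 (fun z => `|(f z)%:E|%E))//; last first.
  by apply/measurable_EFinP; exact: (ig_meas igaf).
by rewrite (int_EFin (ig_abs (ig_param2 igf))) (int_EFin igaf) lee_fin.
Qed.

(** Tonelli's criterion. Integrability on the plane is always obtained from it below, through a
    bound on the inner L^1 norms. *)
Lemma ig_prod1 f (g : T1 -> R) : measurable_fun setT f -> integrable_real m1 g ->
  (forall x, integrable_real m2 (fun y => f (x, y))) ->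
  (forall x, \int[m2]_y `|f (x, y)| <= g x) -> integrable_real (m1 \x m2)%E f.
Proof.
move=> mf igg igf fg; apply/(integrable12ltyP _ _ _).2; first exact/measurable_EFinP.
have : (\int[m1]_x (g x)%:E < +oo)%E by rewrite int_EFin// ltry.
apply: le_lt_trans; apply: ge0_le_integral => //.
- by move=> x _; apply: integral_ge0.
- apply: (measurable_fun_fubini_tonelli_F (abse \o (EFin \o f))) => //=.
  by apply: measurableT_comp => //; exact/measurable_EFinP.
- by apply/measurable_EFinP; exact: ig_meas igg.
- by move=> x _ /=; rewrite (int_EFin (ig_abs (igf x))) lee_fin fg.
Qed.

Lemma int_swap f : integrable_real (m1 \x m2)%E f ->
  \int[m1]_x \int[m2]_y f (x, y) = \int[m2]_y \int[m1]_x f (x, y).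
Proof. by move=> h; rewrite -Rfubini1// Rfubini2. Qed.

End real_fubini.

(** * Affine changes of variable *)

Section lebesgue_affine.
Context {R : realType}.
Local Notation leb := (@lebesgue_measure R).
Local Notation ig f := (integrable_real leb f).

Lemma measurable_affine (c a : R) : measurable_fun setT (fun x : R => c * x + a).
Proof. by apply: measurable_funD => //; exact: measurable_funM. Qed.

(** The pushforward of [leb] under the affine map, scaled by [c], agrees with [leb] on half-open
    intervals, hence everywhere by uniqueness of Lebesgue measure. *)
Lemma ge0_integral_affine (c a : R) (g : R -> \bar R) : 0 < c ->
  measurable_fun setT g -> (forall x, 0 <= g x)%E ->
  (\int[leb]_x g x = c%:E * \int[leb]_x g (c * x + a)%R)%E.
Proof.
move=> c0 mg g0.
have mf : measurable_fun setT (fun x : R => c * x + a : measurableTypeR R).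
  exact: measurable_affine.
pose p := measure_function_pushforward__canonical__measure_function_Measure leb mf.
rewrite (@eq_measure_integral _ _ _ setT (mscale (NngNum (ltW c0)) p)).
  rewrite ge0_integral_mscale//=; congr (_ * _)%E.
  by rewrite ge0_integral_pushforward//; move=> *; exact: g0.
move=> A mA _.
apply: (@lebesgue_measure_unique R (mscale (NngNum (ltW c0)) p)) => // X [[x y] _ <-].
rewrite /= /mscale /p /pushforward/=.
have E : (fun z : R => c * z + a) @^-1` `]x, y]%classic = `]((x - a) / c), ((y - a) / c)]%classic.
  apply/seteqP; split => z /=; rewrite !in_itv/= ltr_pdivrMr// ler_pdivlMr//;
  by rewrite ltrBlDr lerBrDr (mulrC z).
rewrite -[pushforward _ _ _]/(leb ((fun z : R => c * z + a) @^-1` `]x, y]%classic)) E.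
rewrite !lebesgue_measure_itv/= !lte_fin ltr_pM2r ?invr_gt0// ltrD2r.
case: ifP => _; last by rewrite mule0.
by rewrite -!EFinD -EFinM; congr EFin; field; rewrite gt_eqF.
Qed.

(** Integrability comes from the rule [key] applied to [|h|], the value from the positive and
    negative parts [p] and [n]. Shared by the affine maps and the reflection. *)
Lemma ig_int_transfer (c : R) (phi f : R -> R) : 0 < c ->
  measurable_fun setT phi ->
  (forall g : R -> \bar R, measurable_fun setT g -> (forall x, 0 <= g x)%E ->
    (\int[leb]_x g x = c%:E * \int[leb]_x g (phi x))%E) ->
  ig f -> ig (f \o phi) /\ c * \int[leb]_x f (phi x) = \int[leb]_x f x.
Proof.
move=> c0 mphi key igf; have mf := ig_meas igf.
have ig_phi (h : R -> R) : ig h -> ig (h \o phi).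
  move=> igh; apply: ig_le_ltey; first exact: (measurableT_comp (ig_meas igh)).
  have /integrableP[_] := igh.
  rewrite (key (fun x => `|(h x)%:E|%E))//=; last first.
    by apply/measurable_EFinP; exact: (ig_meas (ig_abs igh)).
  have : (0 <= \int[leb]_x `|(h (phi x))%:E|)%E by exact: integral_ge0.
  case: (\int[leb]_x _)%E => [r||]//; rewrite ?ltry// mulry gtr0_sg// mul1e => _.
  by rewrite ltxx.
have ge0_phi (h : R -> R) : ig h -> (forall x, 0 <= h x) ->
    c * \int[leb]_x h (phi x) = \int[leb]_x h x.
  move=> igh h0; apply: EFin_inj; rewrite EFinM -(int_EFin (ig_phi _ igh)) -int_EFin//.
  have mh : measurable_fun setT (EFin \o h) by apply/measurable_EFinP; exact: (ig_meas igh).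
  exact/esym/(key _ mh).
split; first exact: ig_phi.
pose p x := Num.max (f x) 0; pose n x := Num.max (- f x) 0.
have pn x : f x = p x - n x.
  by rewrite /p /n; case: (leP (f x) 0) => h; [rewrite max_l|rewrite max_r]; lra.
have [igp ign] : ig p /\ ig n.
  split; apply: (ig_le _ _ (ig_abs igf)).
  - exact: measurable_maxr.
  - by move=> x; rewrite /p; case: (leP (f x) 0) => h; rewrite ?normr0.
  - by apply: measurable_maxr => //; exact: measurable_funN.
  - by move=> x; rewrite /n; case: (leP (- f x) 0) => h; rewrite ?normr0// normrN.
have -> : \int[leb]_x f x = \int[leb]_x (p x - n x) by exact: eq_int.
have -> : \int[leb]_x f (phi x) = \int[leb]_x (p (phi x) - n (phi x)).
  by apply: eq_int => x; exact: pn.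
rewrite !intB//; [|exact: (ig_phi p)|exact: (ig_phi n)].
by rewrite mulrBr !ge0_phi// => x; rewrite le_max lexx orbT.
Qed.

Lemma ig_int_affine (c a : R) (f : R -> R) : 0 < c -> ig f ->
  ig (fun x => f (c * x + a)) /\ c * \int[leb]_x f (c * x + a) = \int[leb]_x f x.
Proof.
move=> c0 igf; apply: (ig_int_transfer c0 (measurable_affine c a)) => // g mg g0.
exact: ge0_integral_affine.
Qed.

Lemma ig_int_opp (f : R -> R) : ig f ->
  ig (fun x => f (- x)) /\ \int[leb]_x f (- x) = \int[leb]_x f x.
Proof.
have mo : measurable_fun setT (-%R : R -> measurableTypeR R) by exact: oppr_measurable.
move=> igf; have [||] := @ig_int_transfer 1 -%R f ltr01 mo; last 2 first.
- by [].
- by move=> ?; rewrite mul1r.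
move=> g mg g0; rewrite mul1e.
pose p := measure_function_pushforward__canonical__measure_function_Measure leb mo.
rewrite (@eq_measure_integral _ _ _ setT p).
  by rewrite ge0_integral_pushforward//; move=> *; exact: g0.
by move=> A mA _; exact/esym/lebesgue_measureN.
Qed.

Lemma ig_shift (a : R) (f : R -> R) : ig f -> ig (fun x => f (x + a)).
Proof.
move=> igf; have [+ _] := @ig_int_affine 1 a f ltr01 igf.
by apply: eq_integrable => // x _ /=; rewrite mul1r.
Qed.

Lemma int_shift (a : R) (f : R -> R) : ig f ->
  \int[leb]_x f (x + a) = \int[leb]_x f x.
Proof.
move=> igf; have [_ <-] := @ig_int_affine 1 a f ltr01 igf.
by rewrite mul1r; apply: eq_int => x; rewrite mul1r.
Qed.

Lemma ig_refl (a : R) (f : R -> R) : ig f -> ig (fun x => f (a - x)).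
Proof.
move=> igf; have [+ _] := ig_int_opp (ig_shift a igf).
by apply: eq_integrable => // x _ /=; rewrite addrC.
Qed.

Lemma int_refl (a : R) (f : R -> R) : ig f ->
  \int[leb]_x f (a - x) = \int[leb]_x f x.
Proof.
move=> igf; rewrite -(int_shift a igf) -(proj2 (ig_int_opp (ig_shift a igf))).
by apply: eq_int => x; rewrite addrC.
Qed.

End lebesgue_affine.

(** * Smooth functions and uniform C^{1,1} bounds *)

Section smooth_functions.
Context {R : realType}.
Local Notation leb := (@lebesgue_measure R).
Local Notation ig f := (integrable_real leb f).
Implicit Types f g F G df : R -> R.

(** Division by [h] leaves an error of at most [C * |h|]. Affine functions qualify with [C = 0], so
    elementary derivatives are read off from this criterion. *)
Lemma is_derive_quad f (x d C : R) :
  (forall h, `|f (x + h) - f x - h * d| <= C * h ^+ 2) -> is_derive x 1 f d.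
Proof.
move=> H; have H' : h^-1 *: ((f \o shift x) (h *: 1) - f x) @[h --> 0^'] --> d.
  apply/cvgrPdist_le => e e0; have C0 : 0 <= C.
    have := H 1; rewrite expr1n mulr1; exact: le_trans.
  near=> h; have h0 : h != 0 by near: h; exact: nbhs_dnbhs_neq.
  rewrite /= [h *: 1]mulr1 (addrC h x).
  rewrite (_ : d - _ = - (h^-1 * (f (x + h) - f x - h * d))); last first.
    by rewrite /GRing.scale/=; field.
  rewrite normrN normrM normfV ler_pdivrMl ?normr_gt0//.
  apply: (le_trans (H h)); rewrite -real_normK ?num_real// expr2 mulrA mulrC.
  rewrite ler_wpM2l//; apply: (@le_trans _ _ ((C + 1) * `|h|)).
    by rewrite ler_wpM2r// lerDl.
  rewrite -ler_pdivlMl; last by rewrite ltr_wpDl.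
  near: h; apply: dnbhs0_le; rewrite mulr_gt0// invr_gt0 ltr_wpDl//.
by apply: DeriveDef; [apply/cvg_ex; exists d|exact/cvg_lim].
Unshelve. all: by end_near. Qed.

Lemma is_derive_continuous f df : (forall x : R, is_derive x 1 f (df x)) -> continuous f.
Proof.
move=> H x; apply: differentiable_continuous; apply/derivable1_diffP.
by have := H x => -[].
Qed.

Lemma lipschitz_of_derive f df (C : R) : (forall x : R, is_derive x 1 f (df x)) ->
  (forall x, `|df x| <= C) -> forall x y, `|f x - f y| <= C * `|x - y|.
Proof.
move=> H B; suff lem : forall x y, x <= y -> `|f y - f x| <= C * `|y - x|.
  move=> x y; have [|/ltW] := leP y x; first exact: lem.
  by move=> /lem; rewrite distrC (distrC y).
move=> x y xy; have [|c _ ->] := @MVT_segment _ f df x y xy (fun z _ => H z).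
- exact/continuous_subspaceT/is_derive_continuous.
- by rewrite normrM ler_wpM2r.
Qed.

(* Bounded functions with bounded derivative [F'] and a quadratic Taylor
   remainder. Unlike differentiability, these uniform bounds pass to averages,
   so that no differentiation under the integral sign is needed. *)
Definition C11 (C : R) (F F' : R -> R) := forall x,
  [/\ `|F x| <= C, `|F' x| <= C & forall h,
    [/\ `|F (x + h) - F x| <= C * `|h|, `|F' (x + h) - F' x| <= C * `|h| &
        `|F (x + h) - F x - h * F' x| <= C * h ^+ 2]].

Lemma C11_ge0 C F F' : C11 C F F' -> 0 <= C.
Proof. by move=> /(_ 0)[+ _ _]; exact: le_trans. Qed.

Lemma C11_le C D F F' : C <= D -> C11 C F F' -> C11 D F F'.
Proof.
move=> CD H x; have [a b c] := H x; split; [exact: le_trans CD|exact: le_trans CD|].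
move=> h; have [p q r] := c h.
by split; [apply: le_trans p _|apply: le_trans q _|apply: le_trans r _];
  rewrite ler_wpM2r// sqr_ge0.
Qed.

Lemma C11_is_derive C F F' : C11 C F F' -> forall x : R, is_derive x 1 F (F' x).
Proof. by move=> H x; apply: (@is_derive_quad _ _ _ C) => h; have [_ _ /(_ h)[]] := H x. Qed.

Lemma C11_lip C F F' : C11 C F F' -> forall x y, `|F x - F y| <= C * `|x - y|.
Proof.
by move=> H x y; have [_ _ /(_ (x - y))[+ _ _]] := H y; rewrite subrKC.
Qed.

Lemma C11_lip' C F F' : C11 C F F' -> forall x y, `|F' x - F' y| <= C * `|x - y|.
Proof.
by move=> H x y; have [_ _ /(_ (x - y))[_ + _]] := H y; rewrite subrKC.
Qed.

Lemma C11_of_derive (C : R) F (F' F'' : R -> R) :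
  (forall x : R, is_derive x 1 F (F' x)) -> (forall x : R, is_derive x 1 F' (F'' x)) ->
  (forall x, `|F x| <= C) -> (forall x, `|F' x| <= C) ->
  (forall x, `|F'' x| <= C) -> C11 C F F'.
Proof.
move=> d1 d2 b0 b1 b2 x; split => // h.
have e : h = (x + h) - x by rewrite addrAC subrr add0r.
split.
- by rewrite [in leRHS]e; exact: (lipschitz_of_derive d1).
- by rewrite [in leRHS]e; exact: (lipschitz_of_derive d2).
have C0 : 0 <= C by exact: le_trans (b0 0).
(* Removing the slope at [x] turns the Taylor remainder into an increment of [g], whose derivative
   is a difference of values of [F']. The mean value theorem is then applied on the segment oriented
   by the sign of [h]. *)
pose g y := F y - y * F' x.
have dg (y : R) : is_derive y 1 g (F' y - F' x).
  rewrite /g; have d1y := d1 y; apply: is_deriveB.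
  by apply: (@is_derive_quad _ _ _ 0) => z; rewrite mul0r (_ : _ - _ - _ = 0) ?normr0//; ring.
have cg : continuous g by exact: is_derive_continuous dg.
suff [c [ch ->]] : exists c, `|c - x| <= `|h| /\ F (x + h) - F x - h * F' x = (F' c - F' x) * h.
  rewrite normrM -[h ^+ 2]real_normK ?num_real// expr2 mulrA ler_wpM2r//.
  apply: (le_trans (lipschitz_of_derive d2 b2 _ _)).
  by rewrite ler_wpM2l.
have gE : F (x + h) - F x - h * F' x = g (x + h) - g x by rewrite /g; ring.
have [h0|h0] := leP 0 h.
  have xh : x <= x + h by rewrite lerDl.
  have [|c] := @MVT_segment _ g (fun y => F' y - F' x) x (x + h) xh (fun z _ => dg z).
  - exact: continuous_subspaceT.
  rewrite in_itv/= => /andP[c1 c2] E; exists c; split.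
    by rewrite ger0_norm ?subr_ge0// ger0_norm// lerBlDl.
  by rewrite gE E; congr (_ * _); ring.
have xh : x + h <= x by rewrite gerDl ltW.
have [|c] := @MVT_segment _ g (fun y => F' y - F' x) (x + h) x xh (fun z _ => dg z).
- exact: continuous_subspaceT.
rewrite in_itv/= => /andP[c1 c2] E; exists c; split.
  by rewrite distrC ger0_norm ?subr_ge0// ltr0_norm//; lra.
by rewrite gE -opprB E; ring.
Qed.

(** The factor 4 is dictated by the increment of the derivative, which splits into four products,
    each at most [C * D * |h|]; the other bounds need fewer. *)
Lemma C11M C F F' D G G' : C11 C F F' -> C11 D G G' ->
  C11 (4 * C * D) (fun x => F x * G x) (fun x => F' x * G x + F x * G' x).
Proof.
move=> HF HG x; have [F0 F1 F2] := HF x; have [G0 G1 G2] := HG x.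
have C0 := C11_ge0 HF; have D0 := C11_ge0 HG.
have CD0 : 0 <= C * D by exact: mulr_ge0.
have pr (a b c d : R) : `|a| <= c -> `|b| <= d -> `|a * b| <= c * d.
  by move=> ? ?; rewrite normrM ler_pM.
split.
- by apply: le_trans (pr _ _ _ _ F0 G0) _; lra.
- apply: le_trans (ler_normD _ _) _.
  by apply: le_trans (lerD (pr _ _ _ _ F1 G0) (pr _ _ _ _ F0 G1)) _; lra.
move=> h; have [f0 f1 f2] := F2 h; have [g0 g1 g2] := G2 h.
have [Fh0 Fh1 _] := HF (x + h); have [Gh0 Gh1 _] := HG (x + h).
have CDh : 0 <= C * D * `|h| by exact: mulr_ge0.
split.
- rewrite (_ : _ - _ = (F (x + h) - F x) * G (x + h) + F x * (G (x + h) - G x)); last by ring.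
  apply: le_trans (ler_normD _ _) _.
  by apply: le_trans (lerD (pr _ _ _ _ f0 Gh0) (pr _ _ _ _ F0 g0)) _; lra.
- rewrite (_ : _ - _ = ((F' (x + h) - F' x) * G (x + h) + F' x * (G (x + h) - G x)) + 
    ((F (x + h) - F x) * G' (x + h) + F x * (G' (x + h) - G' x))); last by ring.
  apply: le_trans (ler_normD _ _) _; apply: le_trans (lerD (ler_normD _ _) (ler_normD _ _)) _.
  by apply: le_trans (lerD (lerD (pr _ _ _ _ f1 Gh0) (pr _ _ _ _ F1 g0))
    (lerD (pr _ _ _ _ f0 Gh1) (pr _ _ _ _ F0 g1))) _; lra.
- have h20 : 0 <= C * D * h ^+ 2 by rewrite mulr_ge0// sqr_ge0.
  rewrite (_ : _ - _ - _ = (F (x + h) - F x - h * F' x) * G (x + h) + 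
    (F x * (G (x + h) - G x - h * G' x) + (h * F' x) * (G (x + h) - G x))); last by ring.
  have hF : `|h * F' x| <= `|h| * C by rewrite normrM ler_wpM2l.
  apply: le_trans (ler_normD _ _) _; apply: le_trans (lerD (lexx _) (ler_normD _ _)) _.
  apply: le_trans (lerD (pr _ _ _ _ f2 Gh0) (lerD (pr _ _ _ _ F0 g2) (pr _ _ _ _ hF g0))) _.
  have -> : `|h| * C * (D * `|h|) = C * D * h ^+ 2.
    by rewrite -[h ^+ 2]real_normK ?num_real//; ring.
  lra.
Qed.

(** One-variable counterpart of [Ck] through [derive1], convenient for explicit functions;
    [Ck_tensor] carries it to the plane. *)
Fixpoint Sm (n : nat) f : Prop :=
  if n is m.+1 then (forall x : R, derivable f x 1) /\ Sm m (f^`())%classic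
  else continuous f.

Definition smooth f := forall n, Sm n f.

Lemma derivable_continuous f : (forall x : R, derivable f x 1) -> continuous f.
Proof. by move=> H x; apply: differentiable_continuous; apply/derivable1_diffP. Qed.

Lemma Sm_continuous n f : Sm n f -> continuous f.
Proof. by case: n => // n [/derivable_continuous]. Qed.

Lemma SmW n f : Sm n.+1 f -> Sm n f.
Proof.
elim: n f => [f [/derivable_continuous]//|n IH f [df H]].
by split => //; exact: IH.
Qed.

Lemma Sm_cst n (c : R) : Sm n (fun=> c).
Proof.
elim: n c => [c x|n IH c]; first exact: cvg_cst.
split; first by move=> x; exact: derivable_cst.
rewrite (_ : (fun=> c)^`()%classic = (fun=> 0)) //.
by apply/funext => x; rewrite derive1_cst.
Qed.

Lemma SmD n f g : Sm n f -> Sm n g -> Sm n (fun x => f x + g x).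
Proof.
elim: n f g => [f g cf cg x|n IH f g [df Hf] [dg Hg]]; first exact: (cvgD (cf x) (cg x)).
split; first by move=> x; exact: derivableD.
rewrite (_ : (fun x => f x + g x)^`()%classic = fun x => (f^`())%classic x + (g^`())%classic x).
  exact: IH.
by apply/funext => x; rewrite !derive1E deriveD.
Qed.

Lemma SmM n f g : Sm n f -> Sm n g -> Sm n (fun x => f x * g x).
Proof.
elim: n f g => [f g cf cg x|n IH f g Hf Hg]; first exact: (cvgM (cf x) (cg x)).
have [df Hf'] := Hf; have [dg Hg'] := Hg.
split; first by move=> x; exact: derivableM.
rewrite (_ : (fun x => f x * g x)^`()%classic =
   fun x => f x * (g^`())%classic x + g x * (f^`())%classic x).
  by apply: SmD; apply: IH => //; exact: SmW.
by apply/funext => x; rewrite !derive1E deriveM.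
Qed.

Lemma Sm_derive1 n f df : (forall x : R, is_derive x 1 f (df x)) -> Sm n df -> Sm n.+1 f.
Proof.
move=> H Hdf; split; first by move=> x; have := H x => -[].
rewrite (_ : f^`()%classic = df)//; apply/funext => x.
by rewrite derive1E; have := H x => -[].
Qed.

Lemma Sm_affine n (a b : R) : Sm n (fun x => a * x + b).
Proof.
case: n => [|n].
  by move=> x; apply: cvgD; [apply: cvgMr; exact: cvg_id|exact: cvg_cst].
apply: (@Sm_derive1 _ _ (cst a)); last exact: Sm_cst.
move=> x; apply: (@is_derive_quad _ _ _ 0) => h.
by rewrite mul0r (_ : _ - _ - _ = 0) ?normr0//=; ring.
Qed.

Lemma is_derive_comp_affine f (a b x d : R) :
  is_derive (a * x + b) 1 f d -> is_derive x 1 (fun x => f (a * x + b)) (a * d).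
Proof.
move=> H; have da : is_derive x 1 (fun x => a * x + b) a.
  apply: (@is_derive_quad _ _ _ 0) => h.
  by rewrite mul0r (_ : _ - _ - _ = 0) ?normr0//=; ring.
by rewrite mulrC; apply: (@is_derive1_comp _ f (fun x => a * x + b)).
Qed.

Lemma Sm_comp_affine n f (a b : R) : Sm n f -> Sm n (fun x => f (a * x + b)).
Proof.
elim: n f => [f cf x|n IH f [df Hf]].
  have c1 := @Sm_affine 0 a b x.
  exact: (continuous_comp c1 (cf _)).
apply: (@Sm_derive1 _ _ (fun x => a * (f^`())%classic (a * x + b))).
  move=> x; apply: is_derive_comp_affine; rewrite derive1E.
  exact/derivableP.
by apply: SmM; [exact: Sm_cst|exact: IH].
Qed.

Lemma smooth_is_derive f : smooth f -> forall x : R, is_derive x 1 f ((f^`())%classic x).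
Proof. by move=> /(_ 1)[df _] x; rewrite derive1E; exact/derivableP. Qed.

Lemma smooth_derive1 f : smooth f -> smooth (f^`())%classic.
Proof. by move=> H n; have [_] := H n.+1. Qed.

Lemma derive1_is_derive f (x d : R) : is_derive x 1 f d -> (f^`())%classic x = d.
Proof. by rewrite derive1E => -[]. Qed.

End smooth_functions.

(** * A smooth bump function *)

Section bump_function.
Context {R : realType}.
Local Notation leb := (@lebesgue_measure R).
Local Notation ig f := (integrable_real leb f).
Implicit Types (f F : R -> R) (a b x : R).

Lemma is_derive_near0 f x : (\forall y \near x, f y = 0) -> is_derive x 1 f 0.
Proof.
move=> H; have d0 : is_derive x 1 (fun=> 0 : R) 0.
  by apply: (@is_derive_quad _ _ _ _ 0) => h; rewrite mulr0 !subr0 normr0 mul0r.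
by apply: near_eq_is_derive d0; apply: filterS H => y ->.
Qed.

Lemma ig_indic (D : set R) f : measurable D -> measurable_fun setT f ->
  leb.-integrable D (EFin \o f) <-> ig (fun x => \1_D x * f x).
Proof.
move=> mD mf; rewrite integrable_mkcond//.
suff -> : (EFin \o f) \_ D = EFin \o (fun x => \1_D x * f x) by [].
apply/funext => x; rewrite /= patchE indicE.
by case: ifP; rewrite ?mul1r ?mul0r.
Qed.

Lemma ig_itv (i : interval R) f a b : continuous f ->
  [set` i] `<=` `[a, b]%classic -> ig (fun x => \1_[set` i] x * f x).
Proof.
move=> cf iab; have mf := continuous_measurable_fun cf.
have mi : measurable [set` i] by exact: measurable_itv.
have K : leb.-integrable `[a, b] (EFin \o f).
  apply: continuous_compact_integrable; first exact: segment_compact.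
  exact: continuous_subspaceT.
have K2 : leb.-integrable [set` i] (EFin \o f).
  by apply: (@integrableS _ _ _ leb `[a, b]%classic [set` i] (EFin \o f)) => //; exact: measurable_itv.
have K3 := (ig_indic mi mf).1 K2.
exact: K3.
Qed.

Lemma ig_continuous_compact f a b : continuous f ->
  (forall x, ~~ (a <= x <= b) -> f x = 0) -> ig f.
Proof.
move=> cf f0; have := @ig_itv `[a, b] f a b cf (@subset_refl _ _).
apply: eq_integrable => // x _ /=; rewrite indicE mem_setE in_itv/=.
by case: (boolP (a <= x <= b)) => [_|/f0 ->]; rewrite ?mul1r ?mulr0.
Qed.

Lemma bounded_continuous_compact f a b : continuous f ->
  (forall x, ~~ (a <= x <= b) -> f x = 0) -> exists2 C : R, 0 <= C & forall x, `|f x| <= C.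
Proof.
move=> cf f0; have [ab|ab] := leP a b; last first.
  exists 0 => // x; rewrite f0 ?normr0//; apply/negP => /andP[ax xb].
  by move: ab; rewrite ltNge (le_trans ax xb).
have cnf : {within `[a, b], continuous (fun x => `|f x|)}.
  apply: continuous_subspaceT => x; apply: continuous_comp; first exact: cf.
  exact: norm_continuous.
have [c _ H] := EVT_max ab cnf.
exists `|f c| => // x; have [xab|/f0 ->] := boolP (a <= x <= b); last by rewrite normr0.
by apply: H; rewrite in_itv.
Qed.

Lemma int_FTC F f a b : a < b -> (forall x : R, is_derive x 1 F (f x)) -> continuous f ->
  \int[leb]_x (\1_`[a, b]%classic x * f x) = F b - F a.
Proof.
move=> ab dF cf; rewrite -int_indic /Rintegral (@continuous_FTC2 _ f F)//.
- exact: continuous_subspaceT.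
- have cF := is_derive_continuous dF; split.
  + by move=> x _; have := dF x => -[].
  + exact/cvg_at_right_filter/cF.
  + exact/cvg_at_left_filter/cF.
- by move=> x _; exact: derive1_is_derive.
Qed.

Lemma int_FTC_oo F f a b : a < b -> (forall x : R, is_derive x 1 F (f x)) -> continuous f ->
  \int[leb]_x (\1_`]a, b[%classic x * f x) = F b - F a.
Proof.
move=> ab dF cf; rewrite -(int_FTC ab dF cf) -!int_indic.
have mf := continuous_measurable_fun cf.
rewrite Rintegral_itv_bndo_bndc ?Rintegral_itv_obnd_cbnd//.
- apply/ig_indic => //; apply: (@ig_itv _ _ a b) => //.
  by apply: subset_itvr; rewrite bnd_simp.
- apply/ig_indic => //; apply: (@ig_itv _ _ a b) => //.
  by apply: subset_itv; rewrite bnd_simp.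
Qed.

(** [inv_exp 0] is the classical flat function exp(-1/x). The extra powers of 1/x make the family
    stable under differentiation up to linear combinations, so that smoothness is a single
    induction. *)
Definition inv_exp (n : nat) x : R := if 0 < x then x^-1 ^+ n * expR (- x^-1) else 0.

Lemma inv_exp_ge0 n x : 0 <= inv_exp n x.
Proof.
by rewrite /inv_exp; case: ifP => // x0; rewrite mulr_ge0 ?expR_ge0// exprn_ge0// invr_ge0 ltW.
Qed.

Lemma inv_exp_bound n : exists C : R, forall x, inv_exp n x <= C.
Proof.
case: n => [|n].
  exists 1 => x; rewrite /inv_exp; case: ifP => // x0.
  by rewrite expr0 mul1r -expR0 ler_expR oppr_le0 invr_ge0 ltW.
exists (n.+1%:R ^+ n.+1) => x; rewrite /inv_exp.
case: ifP => x0; last by apply: exprn_ge0.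
set y := x^-1; have y0 : 0 < y by rewrite invr_gt0.
(* exp y is the (n+1)-st power of exp(y/(n+1)), which exceeds y/(n+1) because exp z >= 1 + z; hence
   the constant (n+1)^(n+1). *)
rewrite expRN ler_pdivrMr ?expR_gt0//.
rewrite (_ : expR y = expR (n.+1%:R * (y / n.+1%:R))); last first.
  by congr expR; field; rewrite ?pnatr_eq0// nat1r pnatr_eq0.
rewrite expRM_natl -exprMn lerXn2r ?nnegrE ?ltW// ?mulr_gt0 ?expR_gt0//.
rewrite mulrC -ltr_pdivrMr ?ltr0n//; apply: lt_le_trans (expR_ge1Dx _).
by rewrite ltrDr.
Qed.

(** Supplies the quadratic remainder at the origin: [inv_exp n.+2] being bounded, [is_derive_quad]
    yields the derivative 0 there. *)
Lemma inv_exp_sq n x : inv_exp n x = x ^+ 2 * inv_exp n.+2 x.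
Proof.
rewrite /inv_exp; case: ifP => x0; last by rewrite mulr0.
by rewrite !exprS expr0; field; rewrite gt_eqF.
Qed.

Lemma is_derive_exprn n (x : R) : is_derive x 1 (fun y : R => y ^+ n) (n%:R * x ^+ n.-1).
Proof.
elim: n => [|n IH].
  apply: (@is_derive_quad _ _ _ _ 0) => h.
  by rewrite !expr0 mul0r mulr0 !subrr normr0 mul0r.
have d1 : is_derive x 1 (fun y : R => y) 1 by exact: is_derive_id.
rewrite (_ : (fun y : R => y ^+ n.+1) = (fun y : R => y) * (fun y : R => y ^+ n)); last first.
  by apply/funext => y; rewrite exprS.
have -> : n.+1%:R * x ^+ n.+1.-1 = x *: (n%:R * x ^+ n.-1) + x ^+ n *: 1.
  rewrite /GRing.scale/= mulr1 mulrCA -natr1 mulrDl mul1r; congr (_ + _).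
  by case: n {IH} => [|n]; rewrite ?mul0r// -exprS.
exact: is_deriveM.
Qed.

Lemma is_derive_inv_exp n (x : R) : is_derive x 1 (inv_exp n) (inv_exp n.+2 x - n%:R * inv_exp n.+1 x).
Proof.
have [x0|x0|->] := ltgtP x 0.
- have -> : inv_exp n.+2 x - n%:R * inv_exp n.+1 x = 0.
    by rewrite /inv_exp ltNge (ltW x0) /= mulr0 subr0.
  apply: is_derive_near0.
  near=> y; rewrite /inv_exp /= ltNge (_ : y <= 0)//.
  by apply/ltW; near: y; exact: lt_nbhsl.
- have xn0 : x != 0 by rewrite gt_eqF.
  pose g y : R := y^-1 ^+ n * expR (- y^-1).
  have di : is_derive x 1 (fun y : R => y^-1) (- x ^- 2).
    by have := @is_deriveV R id x 1 1 xn0 _; rewrite /GRing.scale/= mulr1; apply.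
  have dX : is_derive x 1 (fun y : R => y^-1 ^+ n) ((n%:R * x^-1 ^+ n.-1) * (- x ^- 2)).
    exact: (@is_derive1_comp _ (fun y : R => y ^+ n) (fun y : R => y^-1) x _ _ (is_derive_exprn _ _) di).
  have dN : is_derive x 1 (fun y : R => - y^-1) (x ^- 2).
    by have := @is_deriveN _ _ _ _ _ _ _ di; rewrite opprK.
  have dE : is_derive x 1 (fun y : R => expR (- y^-1)) (expR (- x^-1) * x ^- 2).
    exact: (@is_derive1_comp _ expR (fun y : R => - y^-1)).
  have dg := @is_deriveM _ _ _ _ _ _ _ _ dX dE.
  have -> : inv_exp n.+2 x - n%:R * inv_exp n.+1 x = 
     x^-1 ^+ n *: (expR (- x^-1) * x ^- 2) + expR (- x^-1) *: ((n%:R * x^-1 ^+ n.-1) * (- x ^- 2)).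
    rewrite /inv_exp x0 /GRing.scale/=; case: n {dX dg g} => [|n].
      by rewrite !mul0r !subr0 mulr0 addr0 !exprS expr0; field.
    by rewrite succnK !exprS expr0; field.
  apply: near_eq_is_derive dg; near=> y; rewrite /inv_exp (_ : 0 < y)//.
  by near: y; exact: lt_nbhsr.
- have -> : inv_exp n.+2 0 - n%:R * inv_exp n.+1 0 = 0 by rewrite /inv_exp ltxx mulr0 subr0.
  have [C HC] := inv_exp_bound n.+2.
  apply: (@is_derive_quad _ _ _ _ C) => h; rewrite add0r mulr0 subr0.
  by rewrite {2}/inv_exp ltxx subr0 ger0_norm ?inv_exp_ge0// inv_exp_sq mulrC ler_wpM2r ?sqr_ge0.
Unshelve. all: by end_near. Qed.

Lemma Sm_inv_exp m n : Sm m (inv_exp n).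
Proof.
elim: m n => [n|m IH n]; first exact/is_derive_continuous/is_derive_inv_exp.
apply: (Sm_derive1 (is_derive_inv_exp n)).
apply: SmD; first exact: IH.
rewrite (_ : (fun _ => _) = (fun x => (- n%:R) * inv_exp n.+1 x)).
  by apply: SmM; [exact: Sm_cst|exact: IH].
by apply/funext => x; rewrite mulNr.
Qed.

Definition bump0 x := inv_exp 0 x * inv_exp 0 (1 - x).

Lemma smooth_bump0 : smooth bump0.
Proof.
move=> n; apply: SmM; first exact: Sm_inv_exp.
rewrite (_ : (fun x => _) = (fun x => inv_exp 0 ((-1) * x + 1))); first exact/Sm_comp_affine/Sm_inv_exp.
by apply/funext => x; rewrite mulN1r addrC.
Qed.

Lemma bump0_supp x : ~~ (0 <= x <= 1) -> bump0 x = 0.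
Proof.
rewrite negb_and -!ltNge /bump0 /inv_exp => /orP[x0|x1].
  by rewrite ltNge (ltW x0) mul0r.
by rewrite subr_gt0 (ltNge x) (ltW x1) mulr0.
Qed.

Lemma ig_bump0 : ig bump0.
Proof. exact: (ig_continuous_compact (Sm_continuous (smooth_bump0 0)) bump0_supp). Qed.

Lemma int_bump0_gt0 : 0 < \int[leb]_x bump0 x.
Proof.
(* On [1/4, 3/4] both [x] and [1 - x] are at least 1/4, so each factor of [bump0] is at least
   exp(-4). *)
pose m := (expR (- 4)) ^+ 2 : R.
have m0 : 0 < m by rewrite exprn_gt0 ?expR_gt0.
have cm : continuous (cst m : R -> R) by move=> x; exact: cvg_cst.
have igm := @ig_itv `[1/4, 3/4] (cst m) (1/4) (3/4) cm (@subset_refl _ _).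
apply: (@lt_le_trans _ _ (\int[leb]_x (\1_`[1/4, 3/4]%classic x * cst m x))); last first.
  apply: le_int => //; [exact: ig_bump0|] => x; rewrite indicE mem_setE in_itv/=.
  case: (boolP (1/4 <= x <= 3/4)) => [/andP[x1 x2]|_]; last by rewrite mul0r mulr_ge0// inv_exp_ge0.
  have bd y : 1/4 <= y -> expR (- 4) <= inv_exp 0 y.
    move=> y1; rewrite /inv_exp (_ : 0 < y) ?expr0 ?mul1r; last by lra.
    by rewrite ler_expR lerN2 -[leRHS]invrK lef_pV2 ?posrE ?invr_gt0//; lra.
  rewrite mul1r /m /bump0 expr2; apply: ler_pM; rewrite ?expR_ge0//; apply: bd; lra.
have lt13 : (1/4 : R) < 3/4 by lra.
have dm (x : R) : is_derive x 1 (fun x => m * x + 0) (cst m x); last first.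
  by rewrite (int_FTC lt13 dm cm) !addr0 -mulrBr mulr_gt0//; lra.
 apply: (@is_derive_quad _ _ _ _ 0) => h.
by rewrite mul0r (_ : _ - _ - _ = 0) ?normr0//=; ring.
Qed.

Definition bump x := bump0 x / \int[leb]_x bump0 x.

Lemma smooth_bump : smooth bump.
Proof. by move=> n; apply: SmM; [exact: smooth_bump0|exact: Sm_cst]. Qed.

Lemma bump_ge0 x : 0 <= bump x.
Proof. by rewrite /bump divr_ge0 ?mulr_ge0 ?inv_exp_ge0// ltW// int_bump0_gt0. Qed.

Lemma bump_supp x : ~~ (0 <= x <= 1) -> bump x = 0.
Proof. by rewrite /bump => /bump0_supp ->; rewrite mul0r. Qed.

Lemma ig_bump : ig bump.
Proof. exact: (ig_continuous_compact (Sm_continuous (smooth_bump 0)) bump_supp). Qed.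

Lemma int_bump : \int[leb]_x bump x = 1.
Proof.
rewrite /bump; have -> : \int[leb]_x (bump0 x / \int[leb]_x bump0 x) = 
   \int[leb]_x ((\int[leb]_x bump0 x)^-1 * bump0 x) by apply: eq_int => x; rewrite mulrC.
by rewrite intZ ?mulVf// ?gt_eqF ?int_bump0_gt0//; exact: ig_bump0.
Qed.

Lemma derive1_supp f a b : smooth f -> (forall x, ~~ (a <= x <= b) -> f x = 0) ->
  forall x, ~~ (a <= x <= b) -> (f^`())%classic x = 0.
Proof.
move=> sf f0 x; rewrite negb_and -!ltNge => /orP[xa|bx]; apply: derive1_is_derive.
  apply: is_derive_near0.
  near=> y; rewrite f0// negb_and -!ltNge; apply/orP; left.
  by near: y; exact: lt_nbhsl.
apply: is_derive_near0.
near=> y; rewrite f0// negb_and -!ltNge; apply/orP; right.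
by near: y; exact: lt_nbhsr.
Unshelve. all: by end_near. Qed.

Lemma smooth_C11 f a b : smooth f -> (forall x, ~~ (a <= x <= b) -> f x = 0) ->
  exists C : R, C11 C f (f^`())%classic.
Proof.
move=> sf f0; have s1 := smooth_derive1 sf; have s2 := smooth_derive1 s1.
have f1 := derive1_supp sf f0; have f2 := derive1_supp s1 f1.
have [C0 C00 H0] := bounded_continuous_compact (Sm_continuous (sf 0)) f0.
have [C1 C10 H1] := bounded_continuous_compact (Sm_continuous (s1 0)) f1.
have [C2 C20 H2] := bounded_continuous_compact (Sm_continuous (s2 0)) f2.
exists (C0 + C1 + C2); apply: (@C11_of_derive R (C0 + C1 + C2) f (f^`())%classic ((f^`())^`())%classic).
- exact: smooth_is_derive.
- exact: smooth_is_derive.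
- by move=> x; apply: le_trans (H0 x) _; lra.
- by move=> x; apply: le_trans (H1 x) _; lra.
- by move=> x; apply: le_trans (H2 x) _; lra.
Qed.

(** The support is [0, e], on one side of the origin. A time mollifier therefore looks in one
    direction only, which makes it easy to stay inside ]0, T[; the price is that exchanging the two
    space variables requires the reflected kernel. *)
Definition moll (e x : R) := e^-1 * bump (e^-1 * x).

Lemma smooth_moll (e : R) : smooth (moll e).
Proof.
move=> n; apply: SmM; first exact: Sm_cst.
rewrite (_ : (fun _ => _) = (fun x => bump (e^-1 * x + 0))); first exact/Sm_comp_affine/smooth_bump.
by apply/funext => x; rewrite addr0.
Qed.

Lemma moll_ge0 (e : R) x : 0 < e -> 0 <= moll e x.
Proof. by move=> e0; rewrite mulr_ge0 ?bump_ge0// invr_ge0 ltW. Qed.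

Lemma moll_supp (e : R) x : 0 < e -> ~~ (0 <= x <= e) -> moll e x = 0.
Proof.
move=> e0 xe; rewrite /moll bump_supp ?mulr0// ler_pdivrMl// mulr1.
by rewrite pmulr_rge0 ?invr_gt0.
Qed.

Lemma ig_moll (e : R) : 0 < e -> ig (moll e).
Proof.
by move=> e0; apply: (ig_continuous_compact (Sm_continuous (smooth_moll e 0)) (fun x => moll_supp e0)).
Qed.

Lemma int_moll (e : R) : 0 < e -> \int[leb]_x moll e x = 1.
Proof.
move=> e0; have ei : 0 < e^-1 by rewrite invr_gt0.
have [h h2] := ig_int_affine 0 ei ig_bump.
rewrite -int_bump -h2 -(intZ _ h).
by apply: (@eq_int _ _ _ leb) => x; rewrite addr0.
Qed.

(** One factor 1/e comes from the normalisation and one from the chain rule; [B] bounds the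
    derivative of [bump]. *)
Lemma moll_derive1_bound : exists2 B : R, 0 <= B & forall e x : R, 0 < e ->
  `|((moll e)^`())%classic x| <= B / e ^+ 2.
Proof.
have s1 := smooth_derive1 smooth_bump.
have [B B0 HB] := bounded_continuous_compact (Sm_continuous (s1 0)) (derive1_supp smooth_bump bump_supp).
exists B => // e x e0; have d := smooth_is_derive smooth_bump.
have H : is_derive x 1 (moll e) (e^-1 * (e^-1 * (bump^`())%classic (e^-1 * x))).
  have d1 : is_derive x 1 (fun x => bump (e^-1 * x)) (e^-1 * (bump^`())%classic (e^-1 * x)).
    have := @is_derive_comp_affine _ bump e^-1 0 x _ (d _).
    by under [X in is_derive _ _ X _]eq_fun do rewrite addr0; rewrite addr0.
  exact: (@is_deriveZ _ _ _ _ (e^-1) _ _ _ d1).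
rewrite (derive1_is_derive H) mulrA -invfM -expr2 normrM ger0_norm; last first.
  by rewrite invr_ge0 sqr_ge0.
by rewrite mulrC ler_wpM2r// invr_ge0 sqr_ge0.
Qed.

(** A smoothed Heaviside function, equal to 0 up to the origin and to 1 from [e] on; differences of
    its translates serve as time cut-offs. *)
Definition step (e x : R) := \int[leb]_(t in `]-oo, x]) moll e t.

Lemma is_derive_step (e : R) (x : R) : 0 < e -> is_derive x 1 (step e) (moll e x).
Proof.
move=> e0; have ii := ig_moll e0.
have xx : x < x + 1 by rewrite ltrDl.
have iix : leb.-integrable `]-oo, (x + 1)] (EFin \o moll e) by apply: integrableS ii.
have [d dE] := continuous_FTC1 xx iix (ltNyr x) (Sm_continuous (smooth_moll e 0) (x := x)).
apply: (DeriveDef d); rewrite -derive1E; exact: dE.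
Qed.

Lemma smooth_step (e : R) : 0 < e -> smooth (step e).
Proof.
move=> e0 [|n]; first by apply: is_derive_continuous => x; exact: is_derive_step.
by apply: (Sm_derive1 (fun x => is_derive_step x e0)); exact: smooth_moll.
Qed.

Lemma ig_step (e x : R) : 0 < e -> ig (fun t => \1_`]-oo, x]%classic t * moll e t).
Proof.
move=> e0; have cm := Sm_continuous (smooth_moll e 0).
apply: (ig_indic _ _).1 => //; first exact: (continuous_measurable_fun cm).
by apply: integrableS (ig_moll e0).
Qed.

Lemma step_le (e : R) x y : 0 < e -> x <= y -> step e x <= step e y.
Proof.
move=> e0 xy; rewrite /step (@int_indic _ _ R leb `]-oo, x]%classic) (@int_indic _ _ R leb `]-oo, y]%classic).
have := ig_step x e0; have := ig_step y e0; have : forall t, 0 <= moll e t by move=> t; exact: moll_ge0.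
move: (moll e) => F F0 igy igx; apply: (le_int igx igy).
move=> t; rewrite ler_wpM2r ?F0// !indicE !mem_setE !in_itv/=.
by case: (leP t x) => [tx|_]; rewrite ?(le_trans tx xy).
Qed.

Lemma step_left (e : R) x : 0 < e -> x <= 0 -> step e x = 0.
Proof.
move=> e0 x0; rewrite /step -[RHS](@int0 _ _ _ leb) int_indic.
apply: eq_int => t; rewrite indicE mem_setE in_itv/=; case: (leP t x) => tx; rewrite ?mul0r// mul1r.
rewrite /moll /bump /bump0 {1}/inv_exp ltNge (_ : e^-1 * t <= 0) ?mul0r ?mulr0//.
by rewrite pmulr_rle0 ?invr_gt0// (le_trans tx).
Qed.

Lemma step_right (e : R) x : 0 < e -> e <= x -> step e x = 1.
Proof.
move=> e0 ex; rewrite /step -(int_moll e0) int_indic.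
apply: eq_int => t; rewrite indicE mem_setE in_itv/=; case: (leP t x) => tx; rewrite ?mul1r// mul0r.
by rewrite moll_supp// negb_and -!ltNge (le_lt_trans ex tx) orbT.
Qed.

End bump_function.

(** * Tensor test functions and translates of BV functions *)

Section test_functions.
Context {R : realType}.
Local Notation leb := (@lebesgue_measure R).
Local Notation ig f := (integrable_real leb f).

Lemma Ck_lin (V : normedModType R) n (c d : R) (f g : V -> R) :
  Ck n f -> Ck n g -> Ck n (fun x => c * f x + d * g x).
Proof.
elim: n f g => [f g cf cg x|n IH f g [df Hf] [dg Hg]].
  by apply: cvgD; apply: cvgMr; [exact: cf|exact: cg].
have dcf x : differentiable (c *: f) x by exact: differentiableZ.
have ddg x : differentiable (d *: g) x by exact: differentiableZ.
split; first by move=> x; exact: (differentiableD (dcf x) (ddg x)).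
move=> v; rewrite (_ : 'D_v _ = fun x => c * 'D_v f x + d * 'D_v g x); first exact: (IH _ _ (Hf v) (Hg v)).
apply/funext => x.
have dfx : derivable f x v by exact: diff_derivable.
have dgx : derivable g x v by exact: diff_derivable.
have := deriveD (derivableZ (k := c) dfx) (derivableZ (k := d) dgx).
by rewrite !deriveZ.
Qed.

Lemma derive_scale (f : R -> R) (x v : R) : derivable f x 1 ->
  'D_v f x = v * (f^`())%classic x.
Proof.
move=> df; have dif : differentiable f x by apply/derivable1_diffP.
rewrite derive1E !deriveE// -[v in LHS]mulr1.
by rewrite -[v * 1]/(v *: (1 : R)) linearZ.
Qed.

Lemma differentiable_comp_fst (a : R -> R) (p : R * R) : (forall x : R, derivable a x 1) ->
  differentiable (fun p : R * R => a p.1) p.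
Proof.
move=> da; have df : differentiable (fst : R * R -> R) p.
  by apply: linear_differentiable => z; exact: cvg_fst.
by apply: (differentiable_comp df); apply/derivable1_diffP.
Qed.

Lemma differentiable_comp_snd (a : R -> R) (p : R * R) : (forall x : R, derivable a x 1) ->
  differentiable (fun p : R * R => a p.2) p.
Proof.
move=> da; have df : differentiable (snd : R * R -> R) p.
  by apply: linear_differentiable => z; exact: cvg_snd.
by apply: (differentiable_comp df); apply/derivable1_diffP.
Qed.

(** The induction closes because a directional derivative of a tensor product is a linear
    combination of two tensor products of lower order. *)
Lemma Ck_tensor n (a b : R -> R) : Sm n a -> Sm n b ->
  Ck n (fun p : R * R => a p.1 * b p.2).
Proof.
elim: n a b => [a b ca cb p|n IH a b Ha Hb].
  have c1 : a (q : R * R).1 @[q --> p] --> a p.1.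
    by apply: (@continuous_comp _ _ _ fst a); [exact: cvg_fst|exact: ca].
  have c2 : b (q : R * R).2 @[q --> p] --> b p.2.
    by apply: (@continuous_comp _ _ _ snd b); [exact: cvg_snd|exact: cb].
  exact: (cvgM c1 c2).
have [da Ha'] := Ha; have [db Hb'] := Hb.
have dA p := differentiable_comp_fst p da; have dB p := differentiable_comp_snd p db.
split; first by move=> p; exact: (differentiableM (dA p) (dB p)).
move=> v; rewrite (_ : 'D_v _ = fun p => v.1 * ((a^`())%classic p.1 * b p.2) + v.2 * (a p.1 * (b^`())%classic p.2)).
  by apply: Ck_lin; apply: IH => //; exact: SmW.
apply/funext => p.
rewrite (deriveM (@diff_derivable _ _ _ _ _ v (dA p)) (@diff_derivable _ _ _ _ _ v (dB p))).
(* Holds by computation: the difference quotient of [a p.1] along [v] sees only the first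
   coordinate. *)
have -> : 'D_v (fun p : R * R => a p.1) p = 'D_(v.1) a p.1 by [].
have -> : 'D_v (fun p : R * R => b p.2) p = 'D_(v.2) b p.2 by [].
by rewrite !derive_scale// /GRing.scale/=; ring.
Qed.

Lemma derive_tensor (a b : R -> R) (p v : R * R) : smooth a -> smooth b ->
  'D_v (fun p : R * R => a p.1 * b p.2) p =
  v.1 * ((a^`())%classic p.1 * b p.2) + v.2 * (a p.1 * (b^`())%classic p.2).
Proof.
move=> sa sb; have [da _] := sa 1; have [db _] := sb 1.
have dA := differentiable_comp_fst p da; have dB := differentiable_comp_snd p db.
rewrite (deriveM (@diff_derivable _ _ _ _ _ v dA) (@diff_derivable _ _ _ _ _ v dB)).
have -> : 'D_v (fun p : R * R => a p.1) p = 'D_(v.1) a p.1 by [].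
have -> : 'D_v (fun p : R * R => b p.2) p = 'D_(v.2) b p.2 by [].
by rewrite !derive_scale// /GRing.scale/=; ring.
Qed.

Definition compact_supp (f : R -> R) := exists a b, forall x, ~~ (a <= x <= b) -> f x = 0.

(** Products of a time factor and a space factor are the only test functions ever inserted in the
    entropy inequality. The time factor may live at negative times too, so that its value at 0 can
    be positive. *)
Lemma nonneg_test_tensor (T : R) (a b : R -> R) : smooth a -> smooth b ->
  (forall t, 0 <= a t) -> (forall x, 0 <= b x) ->
  (exists c d : R, d < T /\ forall x, ~~ (c <= x <= d) -> a x = 0) -> compact_supp b ->
  nonneg_test_function T (fun p : R * R => a p.1 * b p.2).
Proof.
move=> sa sb a0 b0 [c [d [dT Ha]]] [c' [d' Hb]]; split.
- by move=> n; exact: Ck_tensor.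
- exists (`[c, d]%classic `*` `[c', d']%classic); split.
  + by apply: compact_setX; exact: segment_compact.
  + by move=> p [/= + _]; rewrite in_itv/= => /andP[_ h]; exact: le_lt_trans dT.
  + move=> p /= /not_andP[|] /negP; rewrite in_itv/= => h.
      by rewrite Ha// mul0r.
    by rewrite Hb// mulr0.
- by move=> p _; exact: mulr_ge0.
Qed.

Lemma measurable_sg : measurable_fun setT (@Num.sg R).
Proof.
rewrite (_ : @Num.sg R = fun x : R => \1_`]0, +oo[%classic x - \1_`]-oo, 0[%classic x).
  by apply: measurable_funB; apply: measurable_indic; exact: measurable_itv.
apply/funext => x; rewrite !indicE !mem_setE !in_itv/= andbT.
by case: sgrP => // h; rewrite ?subr0 ?sub0r ?subrr.
Qed.

(** Dominated convergence along the exhausting intervals. It lets [TV_translate] work on a bounded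
    interval, where integrable functions are approximated by continuous ones. *)
Lemma le_int_itv (G : R -> R) (B : R) : ig G -> (forall x, 0 <= G x) ->
  (forall n : nat, \int[leb]_x (\1_`[- n%:R, n%:R]%classic x * G x) <= B) ->
  \int[leb]_x G x <= B.
Proof.
move=> igG G0 H; have mG := ig_meas igG.
pose F (n : nat) (x : R) := \1_`[- n%:R, n%:R]%classic x * G x.
have mF n : measurable_fun setT (F n).
  by apply: measurable_funM => //; apply: measurable_indic; exact: measurable_itv.
have FG n x : `|F n x| <= G x.
  rewrite /F indicE; case: (_ \in _); rewrite ?mul1r ?mul0r ?normr0// ger0_norm//.
have igF n : ig (F n) by apply: ig_le igG; [exact: mF|exact: FG].
have [|||||_ _ c] := @dominated_convergence _ _ _ leb setT measurableT (fun n => EFin \o F n) (EFin \o G) (EFin \o G).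
- by move=> n; exact: (measurable_int leb (igF n)).
- exact: (measurable_int leb igG).
- apply: aeW => x _ /=; apply/cvg_EFin; first by apply: nearW.
  apply: cvg_near_cst; near=> n; rewrite /comp/= /F indicE mem_setE in_itv/= -ler_norml.
  rewrite (_ : `|x| <= _) ?mul1r//; near: n; exact: nbhs_infty_ger.
- exact: igG.
- by apply: aeW => x n _ /=; rewrite lee_fin.
- move: c; rewrite [X in _ --> X](int_EFin igG) => /fine_cvgP[_ c].
  rewrite -(cvg_lim _ c)//; apply: limr_le; first by apply: cvgP c.
  by apply: nearW => n /=; rewrite int_EFin// /=; exact: H.
Unshelve. all: by end_near. Qed.

Lemma antiderivative (phi : R -> R) (a b : R) : continuous phi ->
  (forall x, ~~ (a <= x <= b) -> phi x = 0) ->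
  exists P : R -> R, forall x : R, is_derive x 1 P (phi x).
Proof.
move=> c0 s0; have ii := ig_continuous_compact c0 s0.
exists (fun x => \int[leb]_(t in `]-oo, x]) phi t) => x.
have xx : x < x + 1 by rewrite ltrDl.
have iix : leb.-integrable `]-oo, (x + 1)] (EFin \o phi) by apply: integrableS ii.
have [d dE] := continuous_FTC1 xx iix (ltNyr x) (c0 x).
by apply: (DeriveDef d); rewrite -derive1E; exact: dE.
Qed.

(** With P a primitive of [phi], the quotient Q = (P(x - r) - P(x)) / r is an admissible test
    function for [TV]: it is bounded by 1 because P is 1-Lipschitz. Its derivative is a difference
    quotient of [phi], and a translation moves that difference onto [u]. *)
Lemma TV_test (u : R -> R) (M r a b : R) (phi : R -> R) : ig u -> (TV u <= M%:E)%E ->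
  0 < r -> continuous phi -> (forall x, ~~ (a <= x <= b) -> phi x = 0) ->
  (forall x, `|phi x| <= 1) ->
  \int[leb]_x ((u (x + r) - u x) * phi x) <= M * r.
Proof.
move=> igu tv r0 cphi sphi phi1; have mphi := continuous_measurable_fun cphi.
have [P dP] := antiderivative cphi sphi.
have lipP := lipschitz_of_derive dP phi1.
pose Q x := r^-1 * (P (x - r) - P x).
pose dQ x := r^-1 * (phi (x - r) - phi x).
have dQP (x : R) : is_derive x 1 Q (dQ x).
  have d1 : is_derive x 1 (fun x => P (x - r)) (phi (x - r)).
    have := @is_derive_comp_affine _ P 1 (- r) x _ (dP _).
    rewrite !mul1r; under [X in is_derive _ _ X _]eq_fun do rewrite mul1r.
    by [].
  exact: (@is_deriveZ _ _ _ _ (r^-1) _ _ _ (is_deriveB d1 (dP x))).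
have cdQ : continuous dQ.
  move=> x; apply: cvgMr; apply: cvgB; last exact: cphi.
  apply: continuous_comp; last exact: cphi.
  by apply: cvgB; [exact: cvg_id|exact: cvg_cst].
have Q1 x : `|Q x| <= 1.
  rewrite normrM ger0_norm ?invr_ge0 ?(ltW r0)// ler_pdivrMl// mulr1.
  by apply: le_trans (lipP _ _) _; rewrite mul1r addrAC subrr sub0r normrN gtr0_norm.
have dQE : (Q^`())%classic = dQ by apply/funext => x; exact: derive1_is_derive.
have igM (h : R -> R) : continuous h -> (forall x, `|h x| <= 1) -> ig (fun x => u x * h x).
  move=> ch h1; have mh := continuous_measurable_fun ch.
  apply: (ig_le _ _ (ig_abs igu)).
    exact: (measurable_funM (ig_meas igu) mh).
  by move=> x; rewrite normrM ler_piMr.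
have key : \int[leb]_x (u x * dQ x) <= M.
  rewrite -lee_fin; apply: le_trans tv; apply: ereal_sup_ubound => /=.
  exists Q; last by rewrite dQE.
  split.
  - split; first by move=> x; apply/derivable1_diffP; have := dQP x => -[].
    move=> v x; rewrite (_ : 'D_v Q = fun x => v * dQ x); last first.
      apply/funext => y; by rewrite derive_scale ?dQE//; have := dQP y => -[].
    by apply: cvgMr; exact: cdQ.
  (* Outside [a, b + r] the segment [x - r, x] misses [a, b], where [phi] is supported, so [P] has
     equal values at its ends. *)
  - exists `[a, (b + r)]%classic; split => //; first exact: segment_compact.
    move=> x /= /negP; rewrite in_itv/= negb_and -!ltNge => xab.
    have xrx : x - r <= x by rewrite gerBl ltW.
    have [|c cx] := @MVT_segment _ P phi (x - r) x xrx (fun z _ => dP z).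
    + by apply: continuous_subspaceT; exact: is_derive_continuous dP.
    + move: cx; rewrite in_itv/= => /andP[c1 c2].
      move=> E; rewrite /Q -opprB E sphi ?mul0r ?oppr0 ?mulr0//.
      rewrite negb_and -!ltNge; case/orP: xab => h.
        by rewrite (le_lt_trans c2 h).
      by rewrite orbC (lt_le_trans _ c1)// ltrBrDr.
  - exact: Q1.
have igphi := igM _ cphi phi1.
have igphir : ig (fun x => u x * phi (x - r)).
  apply: igM => [x|x]; last exact: phi1.
  apply: continuous_comp; last exact: cphi.
  by apply: cvgB; [exact: cvg_id|exact: cvg_cst].
have E1 : \int[leb]_x (u x * dQ x) = r^-1 * (\int[leb]_x (u x * phi (x - r)) - \int[leb]_x (u x * phi x)).
  rewrite -intB// -intZ; last exact: igB.
  by apply: eq_int => x; rewrite /dQ; ring.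
have E2 : \int[leb]_x (u x * phi (x - r)) = \int[leb]_x (u (x + r) * phi x).
  rewrite -(int_shift r igphir); apply: eq_int => x.
  by rewrite addrK.
have igphir2 : ig (fun x => u (x + r) * phi x).
  have := ig_shift r igphir; apply: eq_integrable => // x _ /=.
  by rewrite addrK.
have -> : \int[leb]_x ((u (x + r) - u x) * phi x) = \int[leb]_x (u (x + r) * phi x) - \int[leb]_x (u x * phi x).
  by rewrite -intB//; apply: eq_int => x; rewrite mulrBl.
by rewrite -E2 -ler_pdivrMr// mulrC -E1.
Qed.


Definition clip (a b y : R) : R := Num.max a (Num.min b y).

Lemma clip_itv (a b y : R) : a <= b -> a <= clip a b y <= b.
Proof.
move=> ab; rewrite /clip; apply/andP.
case: (leP b y) => h1; rewrite ?(max_idPr ab); first by split; lra.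
by case: (leP a y) => h2; split; lra.
Qed.

Lemma clip_id (a b y : R) : a <= y <= b -> clip a b y = y.
Proof.
move=> /andP[ay yb]; rewrite /clip.
by case: (leP b y) => h1; case: leP => h2; lra.
Qed.

Lemma clip_lip (a b x y : R) : a <= b -> `|clip a b x - clip a b y| <= `|x - y|.
Proof.
move=> ab; have n1 := ler_norm (x - y); have n2 := ler_norm (- (x - y)).
rewrite normrN in n2; rewrite ler_norml /clip; apply/andP.
case: (leP b x) => h1; case: (leP b y) => h2; rewrite ?(max_idPr ab).
- by split; lra.
- by case: (leP a y) => h3; split; lra.
- by case: (leP a x) => h3; split; lra.
- by case: (leP a x) => h3; case: (leP a y) => h4; split; lra.
Qed.

Lemma lip_continuous (C : R) (F : R -> R) : (forall x y, `|F x - F y| <= C * `|x - y|) ->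
  continuous F.
Proof.
move=> H x; apply/cvgrPdist_le => e e0; have C0 : 0 <= C.
  by have := H 1 0; rewrite subr0 normr1 mulr1; apply: le_trans.
near=> y; apply: le_trans (H x y) _.
apply: (@le_trans _ _ ((C + 1) * `|x - y|)); first by rewrite ler_wpM2r// lerDl.
rewrite -ler_pdivlMl ?ltr_wpDl//; near: y; apply: cvgr_dist_le => //.
by rewrite mulr_gt0// invr_gt0 ltr_wpDl.
Unshelve. all: by end_near. Qed.

Lemma clip_continuous (a b : R) : a <= b -> continuous (clip a b).
Proof. by move=> ab; apply: (@lip_continuous 1) => x y; rewrite mul1r; exact: clip_lip. Qed.

(** Duality: the L^1 norm of the increment [g] is its pairing with the sign of [g], and continuous
    compactly supported approximations of that sign are controlled by [TV_test]. Since [|g| <= 1],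
    an L^1 approximation of the sign is good enough. *)
Lemma TV_translate (u : R -> R) (M : R) : ig u -> (forall x, 0 <= u x <= 1) ->
  (TV u <= M%:E)%E -> forall r : R, 0 < r -> \int[leb]_x `|u (x + r) - u x| <= M * r.
Proof.
move=> igu u01 tv r r0.
pose g x := u (x + r) - u x.
have igg : ig g by apply: igB => //; exact: ig_shift.
have mg := ig_meas igg.
have g1 x : `|g x| <= 1.
  have /andP[a1 a2] := u01 x; have /andP[b1 b2] := u01 (x + r).
  by rewrite ler_norml /g; apply/andP; split; lra.
apply: (@le_int_itv (fun x => `|g x|)); first exact: ig_abs.
  by [].
move=> n; set lhs := (X in X <= _).
suff H0 : forall e : R, 0 < e -> lhs <= M * r + e by exact/ler_addgt0Pr.
rewrite /lhs {lhs} => e e0.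
(* One unit larger than [D] on each side: the room in which the cut-off [theta] falls from 1 to
   0. *)
pose E : set R := `[- n.+1%:R, n.+1%:R]%classic.
pose D : set R := `[- n%:R, n%:R]%classic.
have mD : measurable D by exact: measurable_itv.
pose s x := \1_D x * Num.sg (g x).
have s1 x : `|s x| <= \1_D x.
  rewrite /s indicE; case: (x \in D); rewrite ?mul0r ?normr0// mul1r.
  by rewrite normr_sg; case: (_ != _).
have ig1D : ig (\1_D : R -> R) by exact: integrable_indic_itv.
have ms : measurable_fun setT s.
  apply: measurable_funM; first exact: measurable_indic.
  exact: (measurableT_comp measurable_sg mg).
have igs : ig s by apply: ig_le ig1D; [exact: ms|exact: s1].
have Efin : (leb E < +oo)%E.
  by rewrite lebesgue_measure_itv/=; case: ifP => _; rewrite -?EFinD ltry.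
have mE : measurable E by exact: measurable_itv.
have igsE : leb.-integrable E (EFin \o s) by apply: integrableS igs.
have [c_ [cc igc]] := approximation_continuous_integrable mE Efin igsE.
move=> /fine_cvgP[_ /cvgrPdist_lt /(_ _ e0)] [k _ /(_ k (leqnn _))].
rewrite sub0r normrN /=; set I := fine _ => HI.
have {HI} HI : \int[leb]_x (\1_E x * `|s x - c_ k x|) < e.
  rewrite -int_indic; apply: le_lt_trans HI; exact: ler_norm.
have l11 : (-1 : R) <= 1 by lra.
(* The approximants [c_ k] are neither bounded by 1 nor compactly supported; [clamp] restores the
   first property and [theta] the second. *)
pose clamp (y : R) : R := clip (-1) 1 y.
pose theta (x : R) : R := clip 0 1 (n.+1%:R - `|x|).
pose phi x := clamp (c_ k x) * theta x.
have th01 x : 0 <= theta x <= 1.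
  exact: clip_itv.
have cphi : continuous phi.
  have ccl : continuous (fun x => clamp (c_ k x)).
    by move=> x; apply: (@continuous_comp _ _ _ (c_ k) clamp); [exact: cc|exact: clip_continuous].
  have cth : continuous theta.
    apply: (@lip_continuous 1) => x y; rewrite mul1r; apply: le_trans (clip_lip _ _ ler01) _.
    have -> : n.+1%:R - `|x| - (n.+1%:R - `|y|) = - (`|x| - `|y|) by ring.
    by rewrite normrN; exact: ler_dist_dist.
  by move=> x; exact: (cvgM (ccl x) (cth x)).
have sphi x : ~~ (- n.+1%:R <= x <= n.+1%:R) -> phi x = 0.
  rewrite -ler_norml -ltNge => h; rewrite /phi /theta.
  rewrite /clip; case: (leP 1 _) => h1; case: leP => h2; rewrite ?mulr0//; lra.
have cl1 y : `|clamp y| <= 1.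
  by rewrite ler_norml; exact: clip_itv.
have phi1 x : `|phi x| <= 1.
  rewrite normrM; have /andP[t0 t1] := th01 x.
  by rewrite (ger0_norm t0) -[leRHS]mulr1 ler_pM.
have H := TV_test igu tv r0 cphi sphi phi1.
have igphi : ig (fun x => g x * phi x).
  apply: (ig_le _ _ (ig_abs igg)).
    exact: (measurable_funM mg (continuous_measurable_fun cphi)).
  by move=> x; rewrite normrM ler_piMr.
have igDg : ig (fun x => \1_D x * `|g x|).
  apply: (ig_le _ _ (ig_abs igg)).
    apply: measurable_funM; first exact: measurable_indic.
    exact: (ig_meas (ig_abs igg)).
  by move=> x; rewrite normrM normr_id indicE; case: (x \in D); rewrite ?normr0 ?normr1 ?mul0r ?mul1r.
have igEsc : ig (fun x => \1_E x * `|s x - c_ k x|).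
  apply: (ig_indic _ _).1 => //.
    apply: measurableT_comp => //; apply: measurable_funB; first exact: ms.
    exact: (continuous_measurable_fun (cc k)).
  have K : leb.-integrable E (fun x => (s x)%:E - (c_ k x)%:E)%E.
    by apply: integrableB => //; exact: igc.
  by apply: eq_integrable (integrable_abse K).
apply: (@le_trans _ _ (\int[leb]_x (g x * phi x + \1_E x * `|s x - c_ k x|))); last first.
  by rewrite intD// lerD// ltW.
apply: le_int => //; first exact: igD.
move=> x.
have sgE : \1_D x * `|g x| = g x * s x.
  by rewrite /s normrEsg; ring.
rewrite sgE; suff K : `|s x - phi x| <= \1_E x * `|s x - c_ k x|.
  have : g x * (s x - phi x) <= `|s x - phi x|.
    apply: le_trans (ler_norm _) _; rewrite normrM -[leRHS]mul1r ler_wpM2r//.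
  rewrite mulrBr; lra.
rewrite [X in _ <= X * _]indicE mem_setE in_itv/=.
case: (boolP (- n.+1%:R <= x <= n.+1%:R)) => xE; last first.
  rewrite sphi// subr0 mul0r (le_trans (s1 x))// indicE mem_setE in_itv/=.
  case: (boolP (- n%:R <= x <= n%:R)) => // xD; exfalso; move: xE; apply/negP/negPn.
  move: xD; rewrite -!ler_norml => /le_trans; apply; by rewrite ler_nat.
rewrite mul1r.
have sx1 : `|s x| <= 1 by apply: le_trans (s1 x) _; rewrite indicE; case: (x \in D).
(* [theta] is 1 on [D], outside which [s] vanishes, and [s] has values in [-1, 1]: both truncations
   fix [s] and do not increase distances. *)
have sth : s x = s x * theta x.
  rewrite /s indicE mem_setE in_itv/=; case: (boolP (- n%:R <= x <= n%:R)) => xD; last by rewrite !mul0r.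
  move: xD; rewrite -ler_norml /theta /clip -natr1 => xD.
  by case: (leP 1 _) => h1; case: leP => h2; rewrite ?mulr1//; lra.
have /andP[t0 t1] := th01 x.
rewrite [in leLHS]sth -mulrBl normrM (ger0_norm t0).
apply: (@le_trans _ _ (`|s x - clamp (c_ k x)|)); first by rewrite ler_piMr.
move: sx1; rewrite ler_norml => /clip_id {1}<-.
exact: clip_lip.
Qed.

Lemma TV_translate_abs (u : R -> R) (M : R) : ig u -> (forall x, 0 <= u x <= 1) ->
  (TV u <= M%:E)%E -> forall r : R, \int[leb]_x `|u (x + r) - u x| <= M * `|r|.
Proof.
move=> igu u01 tv r; have [r0|r0|->] := ltgtP r 0.
- rewrite ltr0_norm// -(int_shift (- r)); last first.
    by apply: ig_abs; apply: igB => //; exact: ig_shift.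
  apply: le_trans (TV_translate igu u01 tv (r := - r) _); last by rewrite oppr_gt0.
  rewrite le_eqVlt; apply/orP; left; apply/eqP; apply: eq_int => x.
  by rewrite subrK distrC.
- by rewrite gtr0_norm//; exact: TV_translate.
- rewrite normr0 mulr0 le_eqVlt; apply/orP; left; apply/eqP.
  by rewrite -[RHS](@int0 _ _ _ leb); apply: eq_int => x; rewrite addr0 subrr normr0.
Qed.

End test_functions.

(** * Doubling of the space variable *)

Section joint_measurability.
Context {R : realType}.
Local Notation leb := (@lebesgue_measure R).
Local Notation leb2 := (leb \x leb)%E.
Local Notation mR := (measurableTypeR R).
Local Notation ig f := (integrable_real leb f).
Local Notation ig2 f := (integrable_real leb2 f).

Lemma meas_fst d (T : measurableType d) : measurable_fun setT (fun w : mR * T => w.1 : R).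
Proof. exact: measurable_fst. Qed.

Lemma meas_snd d (T : measurableType d) : measurable_fun setT (fun w : T * mR => w.2 : R).
Proof. exact: measurable_snd. Qed.

Lemma meas_comp d (T : measurableType d) (k : R -> R) (F : T -> R) :
  measurable_fun setT k -> measurable_fun setT F -> measurable_fun setT (fun w => k (F w)).
Proof. by move=> mk mF; exact: (measurableT_comp mk mF). Qed.

Lemma meas_comp2 d (T : measurableType d) (u : R -> R -> R) (a b : T -> R) :
  measurable_fun setT (fun p : mR * mR => u p.1 p.2) ->
  measurable_fun setT a -> measurable_fun setT b ->
  measurable_fun setT (fun w => u (a w) (b w)).
Proof.
move=> mu ma mb.
have mab : measurable_fun setT (fun w => (a w : mR, b w : mR)) by exact: measurable_fun_pair.
exact: (measurableT_comp mu mab).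
Qed.

(** For fixed x the reflection y -> x - y makes the integral of the kernel independent of x, so the
    double integral factorises. *)
Lemma ig_kernel1 (u k : R -> R) : ig u -> ig k ->
  ig2 (fun w => u w.1 * k (w.1 - w.2)) /\
  \int[leb2]_w (u w.1 * k (w.1 - w.2)) = \int[leb]_x u x * \int[leb]_x k x.
Proof.
move=> igu igk; have mu := ig_meas igu; have mk := ig_meas igk.
have mF : measurable_fun setT (fun w : mR * mR => u w.1 * k (w.1 - w.2)).
  apply: measurable_funM; first exact: (measurableT_comp mu measurable_fst).
  apply: (measurableT_comp mk); apply: measurable_funB; [exact: meas_fst|exact: meas_snd].
have i2 : ig2 (fun w => u w.1 * k (w.1 - w.2)).
  apply: (@ig_prod1 _ _ mR mR R leb leb _ (fun x => `|u x| * \int[leb]_x `|k x|)).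
  - exact: mF.
  - have := igZ (\int[leb]_x `|k x|) (ig_abs igu).
    by apply: eq_integrable => // x _ /=; rewrite mulrC.
  - by move=> x /=; apply: igZ; exact: ig_refl.
  - move=> x /=; rewrite -(int_refl x (ig_abs igk)) -intZ; last exact: (ig_refl x (ig_abs igk)).
    by rewrite le_eqVlt; apply/orP; left; apply/eqP/eq_int => y; rewrite normrM.
split=> //; rewrite (Rfubini1 i2) /=.
rewrite mulrC -intZ//; apply: eq_int => x.
by rewrite intZ ?int_refl 1?mulrC//; exact: ig_refl.
Qed.

Lemma ig2_swap (F : R * R -> R) : ig2 F -> ig2 (fun w => F (w.2, w.1)) /\
  \int[leb2]_w F (w.2, w.1) = \int[leb2]_w F w.
Proof.
move=> igF; have mF := ig_meas igF.
have mG : measurable_fun setT (fun w : mR * mR => F (w.2, w.1)).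
  by apply: (measurableT_comp mF); apply: measurable_fun_pair; [exact: measurable_snd|exact: measurable_fst].
have igG : ig2 (fun w => F (w.2, w.1)).
  have := (integrable12ltyP leb leb (measurable_int _ igF)).1 igF => h.
  by apply/(integrable21ltyP leb leb _).2 => //; apply/measurable_EFinP.
by split => //; rewrite (Rfubini1 igF) (Rfubini2 igG).
Qed.

Lemma ig_kernel2 (u k : R -> R) : ig u -> ig k ->
  ig2 (fun w => u w.2 * k (w.1 - w.2)) /\
  \int[leb2]_w (u w.2 * k (w.1 - w.2)) = \int[leb]_x u x * \int[leb]_x k x.
Proof.
move=> igu igk; have [igk' <-] := ig_int_opp igk.
have [h <-] := ig_kernel1 igu igk'; have [h1 <-] := ig2_swap h.
split; last by apply: eq_int => w; rewrite opprB.
by move: h1; apply: eq_integrable => // w _ /=; rewrite opprB.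
Qed.

(** The common domination of all doubled integrands: two functions in [0, 1] enter through the sum
    of their values, hence through their masses, and the kernel through its L^1 norm. *)
Lemma ig2_kernel_dom (F : R * R -> R) (u z k : R -> R) :
  ig u -> ig z -> ig k -> measurable_fun setT (F : mR * mR -> R) ->
  (forall w, `|F w| <= (u w.1 + z w.2) * k (w.1 - w.2)) ->
  ig2 F /\ \int[leb2]_w `|F w| <= (\int[leb]_x u x + \int[leb]_x z x) * \int[leb]_x k x.
Proof.
move=> igu igz igk mF FD.
have [i1 e1] := ig_kernel1 igu igk; have [i2 e2] := ig_kernel2 igz igk.
have i3 := igD i1 i2.
have i4 : ig2 F.
  apply: ig_le i3; first exact: mF.
  by move=> w; rewrite -mulrDl; exact: FD.
split => //; rewrite mulrDl -e1 -e2 -intD//.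
apply: le_int => //; first exact: ig_abs.
by move=> w; rewrite -mulrDl; exact: FD.
Qed.

Definition density (z : R -> R) := (forall x, 0 <= z x <= 1) /\ ig z.

Definition bounded_field (m : R) (u : R -> R -> R) :=
  [/\ measurable_fun setT (fun p : mR * mR => u p.1 p.2), forall t, density (u t) &
      forall t, \int[leb]_x u t x <= m].

(** Uniform regularity in space but mere measurability in time; a modulus in time is requested
    separately, and of one velocity only, when time is doubled. *)
Definition velocity (C : R) (V Vx : R -> R -> R) :=
  [/\ measurable_fun setT (fun p : mR * mR => V p.1 p.2),
      measurable_fun setT (fun p : mR * mR => Vx p.1 p.2) &
      forall t, C11 C (V t) (Vx t)].

(* The flux terms of the Kruzhkov inequality for [u] with the constant replaced
   by [z y], tested with [r (x - y)]. *)
Definition flux (f V Vx r r' u z : R -> R) (w : R * R) : R :=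
  Num.sg (u w.1 - z w.2) * (f (u w.1) - f (z w.2)) * V w.1 * r' (w.1 - w.2)
  - f (z w.2) * Num.sg (u w.1 - z w.2) * Vx w.1 * r (w.1 - w.2).

Definition moll_dist (r u z : R -> R) : R :=
  \int[leb2]_w (`|u w.1 - z w.2| * r (w.1 - w.2)).

(* The entropy inequality tested with [chi t * r x]; [V] and [Vx] stand for
   [nu (W[U])] and its space derivative. *)
Definition kruzkov (T : R) (f : R -> R) (V Vx : R -> R -> R) (u0 : R -> R) (u : R -> R -> R) :=
  forall (chi r : R -> R) (alpha : R), smooth chi -> smooth r ->
  (forall t, 0 <= chi t) -> (forall x, 0 <= r x) ->
  (exists c d : R, d < T /\ forall t, ~~ (c <= t <= d) -> chi t = 0) -> compact_supp r ->
  0 <= \int[leb]_t (\1_`]0, T[%classic t * \int[leb]_x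
         (`|u t x - alpha| * ((chi^`())%classic t * r x) +
          (Num.sg (u t x - alpha) * (f (u t x) - f alpha) * V t x * (r^`())%classic x
           - f alpha * Num.sg (u t x - alpha) * Vx t x * r x) * chi t))
     + chi 0 * \int[leb]_x (`|u0 x - alpha| * r x).

Definition flux_kernel (C L : R) (r r' : R -> R) (x : R) : R := C * L * (`|r' x| + `|r x|).

(** As f 0 = 0, the term [f (z y)] is at most [L * z y], which is integrable; without this the flux
    could fail to be integrable on the plane. *)
Lemma flux_le (C L : R) (f V Vx r r' u z : R -> R) (w : R * R) :
  (forall a b, `|f a - f b| <= L * `|a - b|) -> f 0 = 0 ->
  (forall x, `|V x| <= C) -> (forall x, `|Vx x| <= C) ->
  (forall x, 0 <= u x <= 1) -> (forall x, 0 <= z x <= 1) ->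
  `|flux f V Vx r r' u z w| <= (u w.1 + z w.2) * flux_kernel C L r r' (w.1 - w.2).
Proof.
move=> fL f0 VC VxC u01 z01.
have C0 : 0 <= C by exact: le_trans (VC 0).
have L0 : 0 <= L by have := fL 1 0; rewrite subr0 normr1 mulr1; apply: le_trans.
have /andP[ua ub] := u01 w.1; have /andP[za zb] := z01 w.2.
have sg1 a : `|Num.sg a : R| <= 1 by rewrite normr_sg; case: (_ != _).
have fz : `|f (z w.2)| <= L * (u w.1 + z w.2).
  by have := fL (z w.2) 0; rewrite f0 !subr0 (ger0_norm za) => /le_trans -> //; rewrite ler_wpM2l// lerDr.
have fuz : `|f (u w.1) - f (z w.2)| <= L * (u w.1 + z w.2).
  apply: le_trans (fL _ _) _; rewrite ler_wpM2l// (le_trans (ler_normB _ _))//.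
  by rewrite !ger0_norm.
have uz0 : 0 <= L * (u w.1 + z w.2) by rewrite mulr_ge0// addr_ge0.
rewrite /flux /flux_kernel; apply: le_trans (ler_normB _ _) _.
rewrite !normrM.
have -> : (u w.1 + z w.2) * (C * L * (`|r' (w.1 - w.2)| + `|r (w.1 - w.2)|)) =
  1 * (L * (u w.1 + z w.2)) * C * `|r' (w.1 - w.2)| + (L * (u w.1 + z w.2)) * 1 * C * `|r (w.1 - w.2)| by ring.
by apply: lerD; rewrite ler_wpM2r//; apply: ler_pM => //; rewrite ?mulr_ge0//; apply: ler_pM.
Qed.

Lemma measurable_flux d (S : measurableType d) (f : R -> R) (V Vx : S -> R) (r r' : R -> R)
  (a b : S -> R) (x y : S -> R) :
  measurable_fun setT f -> measurable_fun setT V -> measurable_fun setT Vx ->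
  measurable_fun setT r -> measurable_fun setT r' -> measurable_fun setT a ->
  measurable_fun setT b -> measurable_fun setT x -> measurable_fun setT y ->
  measurable_fun setT (fun s => Num.sg (a s - b s) * (f (a s) - f (b s)) * V s * r' (x s - y s)
  - f (b s) * Num.sg (a s - b s) * Vx s * r (x s - y s)).
Proof.
move=> mf mV mVx mr mr' ma mb mx my.
have mab : measurable_fun setT (fun s => a s - b s) by exact: measurable_funB.
have mxy : measurable_fun setT (fun s => x s - y s) by exact: measurable_funB.
have msg : measurable_fun setT (fun s => Num.sg (a s - b s)).
  exact: (measurableT_comp measurable_sg mab).
apply: measurable_funB; repeat apply: measurable_funM => //.
- by apply: measurable_funB; exact: meas_comp.
- exact: (meas_comp mr' mxy).
- exact: meas_comp.
- exact: (meas_comp mr mxy).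
Qed.

Lemma smooth_measurable (h : R -> R) : smooth h -> measurable_fun setT h.
Proof. by move=> /(_ 0) /Sm_continuous; exact: continuous_measurable_fun. Qed.

Lemma smooth_ig (h : R -> R) : smooth h -> compact_supp h -> ig h /\ ig (h^`())%classic.
Proof.
move=> sh [a [b Hab]]; split; first exact: (ig_continuous_compact (Sm_continuous (sh 0)) Hab).
exact: (ig_continuous_compact (Sm_continuous (smooth_derive1 sh 0)) (derive1_supp sh Hab)).
Qed.

Lemma ig_flux_kernel (C L : R) (h : R -> R) : smooth h -> compact_supp h ->
  ig (flux_kernel C L h (h^`())%classic).
Proof.
by move=> sh ch; have [i1 i2] := smooth_ig sh ch; apply: igZ; apply: igD; exact: ig_abs.
Qed.

Lemma smooth_is_derive_shift (h : R -> R) (y x : R) : smooth h ->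
  is_derive x 1 (fun x => h (x - y)) ((h^`())%classic (x - y)).
Proof.
move=> sh; have := @is_derive_comp_affine _ h 1 (- y) x _ (smooth_is_derive sh _).
rewrite !mul1r; under [X in is_derive _ _ X _]eq_fun do rewrite mul1r.
by [].
Qed.

Lemma smooth_shift (h : R -> R) (y : R) : smooth h -> smooth (fun x => h (x - y)).
Proof.
move=> sh n; have := @Sm_comp_affine _ n h 1 (- y) (sh n).
by under [X in Sm _ X -> _]eq_fun do rewrite mul1r.
Qed.

Lemma compact_supp_shift (h : R -> R) (y : R) : compact_supp h -> compact_supp (fun x => h (x - y)).
Proof.
move=> [a [b Hab]]; exists (a + y), (b + y) => x xab; apply: Hab.
by move: xab; rewrite lerBrDr lerBlDr.
Qed.

Lemma C11_measurable (C : R) (F F' : R -> R) : C11 C F F' ->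
  measurable_fun setT F /\ measurable_fun setT F'.
Proof.
move=> H; split; apply: continuous_measurable_fun; apply: lip_continuous.
- exact: (C11_lip H).
- exact: (C11_lip' H).
Qed.

End joint_measurability.

(** * One half of the doubling: integrating the Kruzhkov inequality over its constant *)

Section half_doubling.
Context {R : realType}.
Local Notation leb := (@lebesgue_measure R).
Local Notation leb2 := (leb \x leb)%E.
Local Notation mR := (measurableTypeR R).
Local Notation ig f := (integrable_real leb f).
Local Notation ig2 f := (integrable_real leb2 f).
Variables (T L C m : R) (f : R -> R) (V Vx : R -> R -> R) (u0 : R -> R) (u : R -> R -> R).
Hypotheses (fL : forall a b, `|f a - f b| <= L * `|a - b|) (f0 : f 0 = 0).
Hypotheses (HV : velocity C V Vx) (Hu : bounded_field m u) (Hu0 : density u0).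

Lemma mf_lip : measurable_fun setT f.
Proof. by apply: continuous_measurable_fun; exact: (lip_continuous fL). Qed.

Lemma ig2_flux t (r z : R -> R) : smooth r -> compact_supp r -> density z ->
  ig2 (flux f (V t) (Vx t) r (r^`())%classic (u t) z) /\
  \int[leb2]_w `|flux f (V t) (Vx t) r (r^`())%classic (u t) z w| <=
    (m + \int[leb]_x z x) * \int[leb]_x (flux_kernel C L r (r^`())%classic x).
Proof.
move=> sr cr [z01 igz]; have [mu du um] := Hu; have [mV mVx HC] := HV.
have [u01 igu] := du t.
have VC x : `|V t x| <= C by have [] := HC t x.
have VxC x : `|Vx t x| <= C by have [] := HC t x.
have igk := ig_flux_kernel C L sr cr.
have [||i1 e1] := @ig2_kernel_dom _ (flux f (V t) (Vx t) r (r^`())%classic (u t) z) _ _ _ igu igz igk.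
- apply: measurable_flux.
  + exact: mf_lip.
  + by apply: (meas_comp2 mV); [exact: measurable_cst|exact: meas_fst].
  + by apply: (meas_comp2 mVx); [exact: measurable_cst|exact: meas_fst].
  + exact: smooth_measurable.
  + by apply: smooth_measurable; exact: smooth_derive1.
  + by apply: (meas_comp2 mu); [exact: measurable_cst|exact: meas_fst].
  + exact: (measurableT_comp (ig_meas igz) measurable_snd).
  + exact: meas_fst.
  + exact: meas_snd.
- by move=> w; exact: flux_le.
split => //; apply: le_trans e1 _; rewrite ler_wpM2r ?lerD2r//.
apply: int_ge0 => x; rewrite /flux_kernel.
have C0 : 0 <= C by exact: le_trans (VC 0).
have L0 : 0 <= L by have := fL 1 0; rewrite subr0 normr1 mulr1; apply: le_trans.
by rewrite !mulr_ge0// addr_ge0.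
Qed.

Lemma ig2_dist (a b r : R -> R) : density a -> density b -> ig r ->
  ig2 (fun w => `|a w.1 - b w.2| * r (w.1 - w.2)) /\
  \int[leb2]_w `| `|a w.1 - b w.2| * r (w.1 - w.2)| <= (\int[leb]_x a x + \int[leb]_x b x) * \int[leb]_x `|r x|.
Proof.
move=> [a01 iga] [b01 igb] igr.
apply: (ig2_kernel_dom iga igb (ig_abs igr)).
  apply: measurable_funM; last first.
    apply: (measurableT_comp (ig_meas igr)); apply: measurable_funB; [exact: meas_fst|exact: meas_snd].
  apply: measurableT_comp => //; apply: measurable_funB.
    exact: (measurableT_comp (ig_meas iga) measurable_fst).
  exact: (measurableT_comp (ig_meas igb) measurable_snd).
move=> w; rewrite normrM normr_id ler_wpM2r// (le_trans (ler_normB _ _))//.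
have /andP[aa _] := a01 w.1; have /andP[bb _] := b01 w.2.
by rewrite !ger0_norm.
Qed.

Hypothesis HK : kruzkov T f V Vx u0 u.

(** The constant is taken to be [z y] and the space test is centred at [y]; the inequality is then
    integrated over [y] and Fubini's theorem brings the time integral outside. *)
Lemma kruzkov_half (chi r z : R -> R) : smooth chi -> smooth r ->
  (forall t, 0 <= chi t) -> (forall x, 0 <= r x) ->
  (exists c d : R, d < T /\ forall t, ~~ (c <= t <= d) -> chi t = 0) -> compact_supp r ->
  density z ->
  0 <= \int[leb]_t (\1_`]0, T[%classic t * ((chi^`())%classic t * moll_dist r (u t) z +
         chi t * \int[leb2]_w flux f (V t) (Vx t) r (r^`())%classic (u t) z w))
     + chi 0 * moll_dist r u0 z.
Proof.
move=> schi sr chi0 r0 [c [d [dT Hchi]]] cr dz; have [z01 igz] := dz.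
have [mu du um] := Hu; have [mV mVx HC] := HV.
have [igr igr'] := smooth_ig sr cr.
pose D : R -> R := \1_`]0, T[%classic.
have ig1 : ig D by exact: integrable_indic_itv.
have D0 t : 0 <= D t by rewrite /D indicE.
have [K HKb] := smooth_C11 schi Hchi.
have K0 := C11_ge0 HKb.
pose X (t : R) (w : R * R) : R := `|u t w.1 - z w.2| * r (w.1 - w.2) * (chi^`())%classic t +
   flux f (V t) (Vx t) r (r^`())%classic (u t) z w * chi t.
(* A bound independent of t, thanks to the uniform mass bound [m]; it gives integrability in (t,
   y). *)
pose B := K * ((m + \int[leb]_x z x) * \int[leb]_x `|r x|) +
  K * ((m + \int[leb]_x z x) * \int[leb]_x (flux_kernel C L r (r^`())%classic x)).
have XE t : ig2 (X t) /\ \int[leb2]_w X t w = (chi^`())%classic t * moll_dist r (u t) z +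
    chi t * \int[leb2]_w flux f (V t) (Vx t) r (r^`())%classic (u t) z w.
  have [i1 _] := ig2_flux t sr cr dz; have [i2 _] := ig2_dist (du t) dz igr.
  have i1' := igZ (chi t) i1; have i2' := igZ ((chi^`())%classic t) i2.
  have Xeq w : X t w = (chi^`())%classic t * (`|u t w.1 - z w.2| * r (w.1 - w.2)) +
     chi t * flux f (V t) (Vx t) r (r^`())%classic (u t) z w by rewrite /X; ring.
  split; first by have := igD i2' i1'; apply: eq_integrable => // w _ /=; rewrite Xeq.
  have -> : \int[leb2]_w X t w = \int[leb2]_w ((chi^`())%classic t * (`|u t w.1 - z w.2| * r (w.1 - w.2)) +
     chi t * flux f (V t) (Vx t) r (r^`())%classic (u t) z w) by exact: eq_int.
  by rewrite intD// !intZ.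
have distB t : \int[leb2]_w `|X t w| <= B.
  have [i1 e1] := ig2_flux t sr cr dz; have [i2 e2] := ig2_dist (du t) dz igr.
  have [iX _] := XE t.
  have i1' := igZ K (ig_abs i1); have i2' := igZ K (ig_abs i2).
  have chiK : `|chi t| <= K by have [] := HKb t.
  have chi'K : `|(chi^`())%classic t| <= K by have [] := HKb t.
  apply: (@le_trans _ _ (\int[leb2]_w (K * `| `|u t w.1 - z w.2| * r (w.1 - w.2)| +
     K * `|flux f (V t) (Vx t) r (r^`())%classic (u t) z w|))).
    apply: le_int; [exact: ig_abs|exact: igD|] => w.
    rewrite /X; apply: le_trans (ler_normD _ _) _.
    by apply: lerD; rewrite normrM mulrC ler_wpM2r.
  rewrite intD// !intZ ?lerD ?ler_wpM2l//; [|exact: ig_abs..].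
  apply: le_trans e2 _; rewrite ler_wpM2r ?lerD2r// int_ge0//.
(* For fixed [y] this is the time integrand of the inequality with constant [z y]. The claim is its
   integral over y and t in the other order. *)
pose Y (p : mR * mR) := D p.1 * \int[leb]_x X p.1 (x, p.2).
have mX3 : measurable_fun setT (fun q : (mR * mR) * mR => X q.1.1 (q.2, q.1.2)).
  have m11 : measurable_fun setT (fun q : (mR * mR) * mR => q.1.1 : R).
    exact: (measurableT_comp measurable_fst measurable_fst).
  have m12 : measurable_fun setT (fun q : (mR * mR) * mR => q.1.2 : R).
    exact: (measurableT_comp measurable_snd measurable_fst).
  have m2 : measurable_fun setT (fun q : (mR * mR) * mR => q.2 : R).
    exact: meas_snd.
  have mr := smooth_measurable sr; have mr' := smooth_measurable (smooth_derive1 sr).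
  have mchi := smooth_measurable schi; have mchi' := smooth_measurable (smooth_derive1 schi).
  have mz : measurable_fun setT (fun q : (mR * mR) * mR => z q.1.2).
    exact: (measurableT_comp (ig_meas igz) m12).
  have muq := meas_comp2 mu m11 m2.
  rewrite /X /flux /=; apply: measurable_funD.
    apply: measurable_funM; last exact: (meas_comp mchi' m11).
    apply: measurable_funM; last first.
      by apply: (meas_comp mr); exact: measurable_funB.
    by apply: measurableT_comp => //; exact: measurable_funB.
  apply: measurable_funM; last exact: (meas_comp mchi m11).
  apply: measurable_flux => //; first exact: mf_lip.
    exact: (meas_comp2 mV).
  exact: (meas_comp2 mVx).
have mY : measurable_fun setT Y.
  apply: measurable_funM.
    have mD : measurable_fun setT D by apply: measurable_indic; exact: measurable_itv.
    exact: (measurableT_comp mD measurable_fst).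
  exact: (@meas_param1 _ _ (mR * mR)%type mR R leb _ mX3).
have YE t : ig (fun y => Y (t, y)) /\ \int[leb]_y Y (t, y) = D t * ((chi^`())%classic t * moll_dist r (u t) z +
    chi t * \int[leb2]_w flux f (V t) (Vx t) r (r^`())%classic (u t) z w).
  have [iX eX] := XE t; split.
    exact: (igZ (D t) (ig_param2 iX)).
  rewrite (intZ (D t) (ig_param2 iX)) -eX (Rfubini2 iX).
  by [].
have iY : ig2 Y.
  apply: (@ig_prod1 _ _ mR mR R leb leb _ (fun t => D t * B)).
  - exact: mY.
  - by have := igZ B ig1; apply: eq_integrable => // t _ /=; rewrite mulrC.
  - by move=> t /=; have [] := YE t.
  - move=> t /=; have [iX _] := XE t.
    have -> : \int[leb]_y `|Y (t, y)| = D t * \int[leb]_y `|\int[leb]_x X t (x, y)|.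
      rewrite -intZ; last by apply: ig_abs; exact: (ig_param2 iX).
      by apply: eq_int => y; rewrite normrM ger0_norm.
    rewrite ler_wpM2l// (le_trans _ (distB t))//.
    exact: (int_abs_param2 iX).
have HKy y : 0 <= \int[leb]_t Y (t, y) + chi 0 * \int[leb]_x (`|u0 x - z y| * r (x - y)).
  have := HK (z y) schi (smooth_shift y sr) chi0 (fun x => r0 (x - y)) _ (compact_supp_shift y cr).
  move=> /(_ (ex_intro _ c (ex_intro _ d (conj dT Hchi)))).
  set I1 := (X in 0 <= X + _ -> _); suff -> : \int[leb]_t Y (t, y) = I1 by [].
  have E t : \int[leb]_x X t (x, y) = \int[leb]_x
      (`|u t x - z y| * ((chi^`())%classic t * r (x - y)) +
       (Num.sg (u t x - z y) * (f (u t x) - f (z y)) * V t x * ((fun x => r (x - y))^`())%classic x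
        - f (z y) * Num.sg (u t x - z y) * Vx t x * r (x - y)) * chi t).
    apply: (@eq_int _ _ _ leb) => x.
    by rewrite (derive1_is_derive (smooth_is_derive_shift y x sr)) /X /flux /=; ring.
  by rewrite /I1; apply: (@eq_int _ _ _ leb) => t; rewrite /Y /= E.
have [i0 _] := ig2_dist Hu0 dz igr.
have i0y := ig_param2 i0; have iYy := ig_param2 iY.
have : 0 <= \int[leb]_y (\int[leb]_t Y (t, y) + chi 0 * \int[leb]_x (`|u0 x - z y| * r (x - y))).
  exact: int_ge0.
rewrite (intD iYy (igZ (chi 0) i0y)) (intZ _ i0y) -(Rfubini2 i0).
rewrite -(int_swap iY).
by congr (_ <= _ + _); apply: eq_int => t; have [_ ->] := YE t.
Qed.

End half_doubling.

(** * Time regularity *)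

Section weak_monotonicity.
Context {R : realType}.
Local Notation leb := (@lebesgue_measure R).
Local Notation ig f := (integrable_real leb f).

(** The mollifier has mass one on [t, t + h], which lies inside ]0, T[: the indicator cuts nothing
    and the average inherits the oscillation of [E]. *)
Lemma moll_average (T h t om : R) (E : R -> R) : continuous E -> 0 < t -> 0 < h -> t + h < T ->
  (forall tau, t <= tau <= t + h -> `|E tau - E t| <= om) ->
  ig (fun tau => \1_`]0, T[%classic tau * (moll h (tau - t) * E tau)) /\
  `|\int[leb]_tau (\1_`]0, T[%classic tau * (moll h (tau - t) * E tau)) - E t| <= om.
Proof.
move=> cE t0 h0 thT HE.
have sm := smooth_shift t (smooth_moll h).
have cm := Sm_continuous (sm 0).
have supp tau : ~~ (t <= tau <= t + h) -> moll h (tau - t) = 0.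
  move=> H; rewrite moll_supp//; apply: contra H => /andP[a b].
  by apply/andP; split; lra.
have cmE : continuous (fun tau => moll h (tau - t) * E tau).
  by move=> x; exact: (cvgM (cm x) (cE x)).
have igmE : ig (fun tau => moll h (tau - t) * E tau).
  by apply: (@ig_continuous_compact _ _ t (t + h) cmE) => x /supp ->; rewrite mul0r.
have igm : ig (fun tau => moll h (tau - t)) by exact: (@ig_continuous_compact _ _ t (t + h) cm).
have eqf tau : \1_`]0, T[%classic tau * (moll h (tau - t) * E tau) = moll h (tau - t) * E tau.
  rewrite indicE mem_setE in_itv/=.
  have [/andP[a b]|/supp ->] := boolP (t <= tau <= t + h); last by rewrite mul0r mulr0.
  by rewrite (lt_le_trans t0 a) (le_lt_trans b thT) mul1r.
split.
  by move: igmE; apply: eq_integrable => // x _ /=; rewrite eqf.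
have -> : \int[leb]_tau (\1_`]0, T[%classic tau * (moll h (tau - t) * E tau)) =
   \int[leb]_tau (moll h (tau - t) * E tau) by apply: eq_int => tau; rewrite eqf.
have im : \int[leb]_tau moll h (tau - t) = 1.
  by rewrite (int_shift (- t) (ig_moll h0)) int_moll.
have -> : E t = \int[leb]_tau (E t * moll h (tau - t)) by rewrite intZ// im mulr1.
have -> : om = \int[leb]_tau (om * moll h (tau - t)) by rewrite intZ// im mulr1.
have igEt := igZ (E t) igm; have igom := igZ om igm.
apply: (le_trans (abs_intB_le igmE igEt)).
apply: le_int => //; first by apply: ig_abs; exact: igB.
move=> tau; have [/HE H|/supp ->] := boolP (t <= tau <= t + h); last first.
  by rewrite mul0r !mulr0 subrr normr0.
have -> : moll h (tau - t) * E tau - E t * moll h (tau - t) = (E tau - E t) * moll h (tau - t) by ring.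
by rewrite normrM (ger0_norm (moll_ge0 _ h0)) ler_wpM2r ?moll_ge0.
Qed.

Lemma continuous_modulus (E : R -> R) (t om : R) : continuous E -> 0 < om ->
  exists2 d : R, 0 < d & forall tau, `|tau - t| <= d -> `|E tau - E t| <= om.
Proof.
move=> cE om0; have /cvgrPdist_le /(_ _ om0) /nbhs_ballP [d /= d0 H] := cE t.
exists (d / 2); first by rewrite divr_gt0.
move=> tau Ht; rewrite distrC; apply: H; rewrite /ball/= distrC.
by apply: le_lt_trans Ht _; rewrite ltr_pdivrMr// ltr_pMr// ltr1n.
Qed.

Lemma is_derive_step_shift (h s tau : R) : 0 < h ->
  is_derive tau 1 (fun x => step h (x - s)) (moll h (tau - s)).
Proof.
move=> h0; have := smooth_is_derive_shift s tau (smooth_step h0).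
by rewrite (derive1_is_derive (is_derive_step _ h0)).
Qed.

(** The derivative is an approximate Dirac mass at [s] minus one at [t], so testing a weak
    inequality with it compares the values at these two times. *)
Lemma plateau (h s t : R) : 0 < h -> s <= t ->
  let chi := fun x => step h (x - s) - step h (x - t) in
  [/\ smooth chi, (forall x, 0 <= chi x),
      forall x, (chi^`())%classic x = moll h (x - s) - moll h (x - t) &
      forall x, ~~ (s <= x <= t + h) -> chi x = 0].
Proof.
move=> h0 st chi; split.
- move=> n; apply: SmD; first exact: smooth_shift (smooth_step h0) n.
  rewrite (_ : (fun x => _) = (fun x => (-1) * step h (x - t))).
    by apply: SmM; [exact: Sm_cst|exact: smooth_shift (smooth_step h0) n].
  by apply/funext => x; rewrite mulN1r.
- by move=> x; rewrite /chi subr_ge0 step_le// lerB.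
- move=> x; apply: derive1_is_derive.
  exact: is_deriveB (is_derive_step_shift _ _ h0) (is_derive_step_shift _ _ h0).
- move=> x; rewrite negb_and -!ltNge /chi => /orP[xs|tx].
    by rewrite !step_left ?subrr//; lra.
  by rewrite !step_right ?subrr//; lra.
Qed.

Lemma weak_nonincreasing (T : R) (E : R -> R) : continuous E ->
  (forall chi : R -> R, smooth chi -> (forall t, 0 <= chi t) ->
    (exists c d : R, [/\ 0 < c, d < T & forall t, ~~ (c <= t <= d) -> chi t = 0]) ->
    0 <= \int[leb]_t (\1_`]0, T[%classic t * ((chi^`())%classic t * E t))) ->
  forall s t, 0 <= s -> s <= t -> t <= T -> E t <= E s.
Proof.
move=> cE H; have lem s t : 0 < s -> s < t -> t < T -> E t <= E s.
  move=> s0 st tT; apply/ler_addgt0Pr => /= om om0.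
  have om2 : 0 < om / 2 by rewrite divr_gt0.
  have [d1 d10 H1] := continuous_modulus s cE om2.
  have [d2 d20 H2] := continuous_modulus t cE om2.
  (* Within the moduli at both times, while (T - t) / 2 keeps the falling edge, of width [h], before
     [T]. *)
  pose h := Num.min (Num.min d1 d2) ((T - t) / 2).
  have hT : 0 < (T - t) / 2 by rewrite divr_gt0 ?subr_gt0.
  have h0 : 0 < h by rewrite /h !lt_min d10 d20 hT.
  have hd1 : h <= d1 by rewrite /h !ge_min lexx.
  have hd2 : h <= d2 by rewrite /h !ge_min lexx orbT.
  have hT2 : h <= (T - t) / 2 by rewrite /h ge_min lexx orbT.
  have thT : t + h < T by lra.
  have shT : s + h < T by lra.
  have [chis chi0 chi' supp] := plateau h0 (ltW st).
  have := H _ chis chi0 (ex_intro _ s (ex_intro _ (t + h) (And3 s0 thT supp))).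
  have [tau Ht|i1 a1] := moll_average (om := om / 2) cE s0 h0 shT.
    by apply: H1; rewrite ger0_norm; case/andP: Ht => ? ?; lra.
  have [tau Ht|i2 a2] := moll_average (om := om / 2) cE (lt_trans s0 st) h0 thT.
    by apply: H2; rewrite ger0_norm; case/andP: Ht => ? ?; lra.
  set I := \int[leb]_t _; have -> : I = \int[leb]_tau (\1_`]0, T[%classic tau * (moll h (tau - s) * E tau))
     - \int[leb]_tau (\1_`]0, T[%classic tau * (moll h (tau - t) * E tau)).
    by rewrite -intB//; apply: eq_int => tau; rewrite chi'; ring.
  move: a1 a2; move: (\int[leb]_tau _) => A; move: (\int[leb]_tau _) => B.
  rewrite !ler_norml => /andP[? ?] /andP[? ?] ?; lra.
move=> s t s0 st tT; have [->//|nst] := eqVneq s t.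
have {}st : s < t by rewrite lt_neqAle nst.
apply/ler_addgt0Pr => /= om om0.
have om2 : 0 < om / 2 by rewrite divr_gt0.
have [d1 d10 H1] := continuous_modulus s cE om2.
have [d2 d20 H2] := continuous_modulus t cE om2.
(* The tests vanish near 0 and T, so both times are moved inwards by [d]; (t - s) / 3 keeps s + d
   below t - d. *)
pose d := Num.min (Num.min d1 d2) ((t - s) / 3).
have hT : 0 < (t - s) / 3 by rewrite divr_gt0 ?subr_gt0.
have d0 : 0 < d by rewrite /d !lt_min d10 d20 hT.
have hd1 : d <= d1 by rewrite /d !ge_min lexx.
have hd2 : d <= d2 by rewrite /d !ge_min lexx orbT.
have hd3 : d <= (t - s) / 3 by rewrite /d ge_min lexx orbT.
have a1 : `|E (s + d) - E s| <= om / 2 by apply: H1; rewrite addrAC subrr add0r gtr0_norm.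
have a2 : `|E (t - d) - E t| <= om / 2 by apply: H2; rewrite addrAC subrr add0r normrN gtr0_norm.
have : E (t - d) <= E (s + d) by apply: lem; lra.
move: a1 a2; rewrite !ler_norml => /andP[? ?] /andP[? ?] ?; lra.
Qed.

Lemma weak_le_initial (T : R) (E : R -> R) (E0 : R) : 0 < T -> continuous E ->
  (forall chi : R -> R, smooth chi -> (forall t, 0 <= chi t) ->
    (exists c d : R, d < T /\ forall t, ~~ (c <= t <= d) -> chi t = 0) ->
    0 <= \int[leb]_t (\1_`]0, T[%classic t * ((chi^`())%classic t * E t)) + chi 0 * E0) ->
  forall t, 0 <= t -> t <= T -> E t <= E0.
Proof.
move=> T0 cE H; have lem t : 0 < t -> t < T -> E t <= E0.
  move=> t0 tT; apply/ler_addgt0Pr => /= om om0.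
  have [d2 d20 H2] := continuous_modulus t cE om0.
  pose h := Num.min (Num.min d2 1) ((T - t) / 2).
  have hT : 0 < (T - t) / 2 by rewrite divr_gt0 ?subr_gt0.
  have h0 : 0 < h by rewrite /h !lt_min d20 ltr01 hT.
  have hd2 : h <= d2 by rewrite /h !ge_min lexx.
  have h1 : h <= 1 by rewrite /h !ge_min lexx orbT.
  have hT2 : h <= (T - t) / 2 by rewrite /h ge_min lexx orbT.
  have thT : t + h < T by lra.
  (* The plateau rises on [-1, -1 + h], before time 0 since h <= 1. Hence [chi 0 = 1], and on ]0, T[
     only the descent near [t] contributes. *)
  have m1t : -1 <= t by lra.
  have [chis chi0 chi' supp] := plateau h0 m1t.
  have := H _ chis chi0 (ex_intro _ (-1) (ex_intro _ (t + h) (conj thT supp))).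
  have [tau Ht|i2 a2] := moll_average (om := om) cE t0 h0 thT.
    by apply: H2; rewrite ger0_norm; case/andP: Ht => ? ?; lra.
  rewrite (@step_right _ h (0 - -1)) ?(@step_left _ h (0 - t))//; [|lra..].
  rewrite subr0 mul1r.
  set I := \int[leb]_t _; have -> : I = \int[leb]_tau (- (\1_`]0, T[%classic tau * (moll h (tau - t) * E tau))).
    apply: eq_int => tau; rewrite chi' indicE mem_setE in_itv/=.
    have [/andP[a b]|_] := boolP (0 < tau < T); last by rewrite !mul0r oppr0.
    rewrite (@moll_supp _ h (tau - -1))//; first by rewrite sub0r; ring.
    by rewrite negb_and -!ltNge; apply/orP; right; lra.
  rewrite intN//.
  move: a2; move: (\int[leb]_tau _) => A; rewrite !ler_norml => /andP[? ?] ?; lra.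
move=> t t0 tT; apply/ler_addgt0Pr => /= om om0.
have [d2 d20 H2] := continuous_modulus t cE om0.
(* [t] may be 0 or [T]; an interior time within the modulus is found by moving towards the middle of
   the interval. *)
have [t' [Ht' t'0 t'T]] : exists t', [/\ `|t' - t| <= d2, 0 < t' & t' < T].
  have [tT2|tT2] := leP t (T / 2).
    exists (t + Num.min d2 (T / 4)); have h : 0 < Num.min d2 (T / 4) by rewrite lt_min d20 divr_gt0.
    have h2 : Num.min d2 (T / 4) <= T / 4 by rewrite ge_min lexx orbT.
    split; [|lra..]; rewrite addrAC subrr add0r gtr0_norm// ge_min lexx//.
  exists (t - Num.min d2 (T / 4)); have h : 0 < Num.min d2 (T / 4) by rewrite lt_min d20 divr_gt0.
  have h2 : Num.min d2 (T / 4) <= T / 4 by rewrite ge_min lexx orbT.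
  split; [|lra..]; rewrite addrAC subrr add0r normrN gtr0_norm// ge_min lexx//.
have := lem _ t'0 t'T; have := H2 _ Ht'; rewrite ler_norml => /andP[? ?] ?; lra.
Qed.

Lemma int_test_parts (T : R) (chi P c : R -> R) : 0 < T -> smooth chi ->
  (exists a d : R, d < T /\ forall t, ~~ (a <= t <= d) -> chi t = 0) ->
  (forall x : R, is_derive x 1 P (c x)) -> continuous c ->
  \int[leb]_t (\1_`]0, T[%classic t * (chi t * c t)) =
  - (chi 0 * P 0) - \int[leb]_t (\1_`]0, T[%classic t * ((chi^`())%classic t * P t)).
Proof.
move=> T0 schi [a [d [dT supp]]] dP cc.
have cP := is_derive_continuous dP.
have cchi := Sm_continuous (schi 0); have cchi' := Sm_continuous (smooth_derive1 schi 0).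
have d1 (x : R) : is_derive x 1 (fun x => chi x * P x) (chi x * c x + (chi^`())%classic x * P x).
  have dchi := smooth_is_derive schi x; have dPx := dP x.
  by have := is_deriveM dchi dPx; rewrite /GRing.scale/= (mulrC (P x)).
have c1 : continuous (fun x => chi x * c x) by move=> x; exact: (cvgM (cchi x) (cc x)).
have c2 : continuous (fun x => (chi^`())%classic x * P x) by move=> x; exact: (cvgM (cchi' x) (cP x)).
have c3 : continuous (fun x => chi x * c x + (chi^`())%classic x * P x).
  by move=> x; exact: (cvgD (c1 x) (c2 x)).
have s1 : (`]0, T[%classic : set R) `<=` `[0, T]%classic by apply: subset_itv; rewrite bnd_simp.
have := int_FTC_oo T0 d1 c3.
have -> : \int[leb]_x (\1_`]0, T[%classic x * (chi x * c x + (chi^`())%classic x * P x)) =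
  \int[leb]_x (\1_`]0, T[%classic x * (chi x * c x)) + \int[leb]_x (\1_`]0, T[%classic x * ((chi^`())%classic x * P x)).
  rewrite -intD; [|exact: ig_itv c1 s1|exact: ig_itv c2 s1].
  by apply: eq_int => x; rewrite mulrDr.
rewrite (supp T) ?mul0r; last by rewrite negb_and -!ltNge dT orbT.
lra.
Qed.

End weak_monotonicity.

Section time_regularity.
Context {R : realType}.
Local Notation leb := (@lebesgue_measure R).
Local Notation leb2 := (leb \x leb)%E.
Local Notation mR := (measurableTypeR R).
Local Notation ig f := (integrable_real leb f).
Local Notation ig2 f := (integrable_real leb2 f).

Definition uniformly_L1_continuous (u : R -> R -> R) := forall e : R, 0 < e ->
  exists2 d : R, 0 < d & forall s t, `|s - t| <= d -> \int[leb]_x `|u s x - u t x| <= e.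

Lemma ig_distB (a b : R -> R) : density a -> density b -> ig (fun x => `|a x - b x|).
Proof. by move=> [_ iga] [_ igb]; apply: ig_abs; exact: igB. Qed.

Lemma moll_dist_lip (r a b z : R -> R) : density a -> density b -> density z ->
  ig r -> (forall x, 0 <= r x) ->
  `|moll_dist r a z - moll_dist r b z| <= \int[leb]_x `|a x - b x| * \int[leb]_x r x.
Proof.
move=> da db dz igr r0.
have [i1 _] := ig2_dist da dz igr; have [i2 _] := ig2_dist db dz igr.
have [i3 <-] := ig_kernel1 (ig_distB da db) igr.
apply: le_trans (abs_intB_le i1 i2) _.
apply: le_int => //; first by apply: ig_abs; exact: igB.
move=> w; rewrite -mulrBl normrM (ger0_norm (r0 _)) ler_wpM2r//.
apply: le_trans (ler_dist_dist _ _) _.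
by rewrite opprB addrA subrK.
Qed.

Lemma moll_dist_continuous (r z : R -> R) (u : R -> R -> R) : (forall t, density (u t)) ->
  uniformly_L1_continuous u -> density z -> ig r -> (forall x, 0 <= r x) ->
  continuous (fun t => moll_dist r (u t) z).
Proof.
move=> du cu dz igr r0 t; apply/cvgrPdist_le => e e0.
have I0 : 0 <= \int[leb]_x r x by exact: int_ge0.
have e'0 : 0 < e / (1 + \int[leb]_x r x) by rewrite divr_gt0// ltr_wpDr.
have [d d0 H] := cu _ e'0.
near=> s; apply: le_trans (moll_dist_lip (du t) (du s) dz igr r0) _.
apply: (@le_trans _ _ (e / (1 + \int[leb]_x r x) * (1 + \int[leb]_x r x))); last first.
  by rewrite divfK// gt_eqF// ltr_wpDr.
apply: ler_pM => //; [exact: int_ge0| |by rewrite lerDr].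
apply: H; near: s; exact: cvgr_dist_le.
Unshelve. all: by end_near. Qed.

(** The arguments are nested as [(S * mR) * mR] so that parametric measurability can be applied
    twice, once for each space variable. *)
Lemma meas_param_leb2 d (S : measurableType d) (F : (S * mR) * mR -> R) :
  measurable_fun setT F -> (forall s, ig2 (fun w => F ((s, w.1), w.2))) ->
  measurable_fun setT (fun s => \int[leb2]_w F ((s, w.1), w.2)).
Proof.
move=> mF iF.
rewrite (_ : (fun s => _) = (fun s => \int[leb]_x \int[leb]_y F ((s, x), y))); last first.
  by apply/funext => s; rewrite (Rfubini1 (iF s)).
have m1 : measurable_fun setT (fun p : S * mR => \int[leb]_y F (p, y)).
  exact: (@meas_param1 _ _ (S * mR)%type mR R leb _ mF).
exact: (@meas_param1 _ _ S mR R leb _ m1).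
Qed.

Variables (T L C m : R) (f : R -> R) (V Vx : R -> R -> R) (u : R -> R -> R).
Hypotheses (fL : forall a b, `|f a - f b| <= L * `|a - b|) (f0 : f 0 = 0).
Hypotheses (HV : velocity C V Vx) (Hu : bounded_field m u).

(** [u] and [v] are read at separate times [a s] and [b s], as doubling in time requires. *)
Lemma measurable_int_flux d (S : measurableType d) (a b : S -> R) (v : R -> R -> R) (mv : R)
  (r : R -> R) : bounded_field mv v -> measurable_fun setT a -> measurable_fun setT b ->
  smooth r -> compact_supp r ->
  measurable_fun setT (fun s => \int[leb2]_w flux f (V (a s)) (Vx (a s)) r (r^`())%classic (u (a s)) (v (b s)) w).
Proof.
move=> [mvv dv _] ma mb sr cr.
have [mu du um] := Hu; have [mV mVx HC] := HV.
apply: (@meas_param_leb2 _ S (fun q => flux f (V (a q.1.1)) (Vx (a q.1.1)) r (r^`())%classic (u (a q.1.1)) (v (b q.1.1)) (q.1.2, q.2))); last first.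
  by move=> s; have [] := ig2_flux fL f0 HV Hu (a s) sr cr (dv (b s)).
have m11 : measurable_fun setT (fun q : (S * mR) * mR => q.1.1 : S).
  exact: (measurableT_comp measurable_fst measurable_fst).
have m12 : measurable_fun setT (fun q : (S * mR) * mR => q.1.2 : R).
  exact: (measurableT_comp measurable_snd measurable_fst).
have m2 : measurable_fun setT (fun q : (S * mR) * mR => q.2 : R) by exact: meas_snd.
have maq : measurable_fun setT (fun q : (S * mR) * mR => a q.1.1) by exact: (measurableT_comp ma m11).
have mbq : measurable_fun setT (fun q : (S * mR) * mR => b q.1.1) by exact: (measurableT_comp mb m11).
rewrite /flux /=; apply: measurable_flux.
- exact: (mf_lip fL).
- exact: (meas_comp2 mV).
- exact: (meas_comp2 mVx).
- exact: smooth_measurable.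
- by apply: smooth_measurable; exact: smooth_derive1.
- exact: (meas_comp2 mu).
- exact: (meas_comp2 mvv).
- exact: m12.
- exact: m2.
Qed.

Lemma abs_int_flux t (r z : R -> R) : smooth r -> compact_supp r -> density z ->
  `|\int[leb2]_w flux f (V t) (Vx t) r (r^`())%classic (u t) z w| <=
  (m + \int[leb]_x z x) * \int[leb]_x (flux_kernel C L r (r^`())%classic x).
Proof.
move=> sr cr dz; have [i1 e1] := ig2_flux fL f0 HV Hu t sr cr dz.
apply: le_trans e1; apply: abs_int_le => //; [exact: (ig_meas i1)|exact: ig_abs].
Qed.

Lemma bounded_field_cst (z : R -> R) : density z -> bounded_field (\int[leb]_x z x) (fun=> z).
Proof.
move=> dz; split => //; exact: (measurableT_comp (ig_meas dz.2) measurable_snd).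
Qed.

Lemma ig_bounded_oo (a b K : R) (F : R -> R) : measurable_fun setT F -> (forall x, `|F x| <= K) ->
  ig (fun t => \1_`]a, b[%classic t * F t).
Proof.
move=> mF FK; have i1 : ig (\1_`]a, b[%classic : R -> R) by exact: integrable_indic_itv.
apply: (ig_le _ _ (igZ K i1)).
  by apply: measurable_funM => //; apply: measurable_indic; exact: measurable_itv.
by move=> x; rewrite normrM mulrC indicE; case: (_ \in _); rewrite ?normr1 ?normr0 ?mulr0 ?mulr1.
Qed.

Variables (u0 : R -> R) (T0 : 0 < T) (Hu0 : density u0) (HK : kruzkov T f V Vx u0 u).
Hypothesis (cu : uniformly_L1_continuous u).

(** The flux term is bounded by [K]; subtracting [K t] makes the mollified distance to the fixed
    profile [z] weakly nonincreasing. [K] contains the L^1 norm of the derivative of the kernel, so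
    it degenerates as the kernel concentrates. *)
Lemma moll_dist_growth (r z : R -> R) : smooth r -> compact_supp r -> (forall x, 0 <= r x) ->
  density z ->
  let K := (m + \int[leb]_x z x) * \int[leb]_x (flux_kernel C L r (r^`())%classic x) in
  (forall s t, 0 <= s -> s <= t -> t <= T ->
     moll_dist r (u t) z <= moll_dist r (u s) z + K * (t - s)) /\
  (forall t, 0 <= t -> t <= T -> moll_dist r (u t) z <= moll_dist r u0 z + K * t).
Proof.
move=> sr cr r0 dz K; have [igr igr'] := smooth_ig sr cr; have [_ du um] := Hu.
have cg := moll_dist_continuous du cu dz igr r0.
pose g t := moll_dist r (u t) z; pose E t := g t - K * t.
have cK : continuous (fun t : R => K * t) by move=> x; apply: cvgMr; exact: cvg_id.
have cE : continuous E by move=> x; exact: (cvgB (cg x) (cK x)).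
have ds1 : (`]0, T[%classic : set R) `<=` `[0, T]%classic by apply: subset_itv; rewrite bnd_simp.
have key (chi : R -> R) : smooth chi -> (forall t, 0 <= chi t) ->
    (exists c d : R, d < T /\ forall t, ~~ (c <= t <= d) -> chi t = 0) ->
    0 <= \int[leb]_t (\1_`]0, T[%classic t * ((chi^`())%classic t * E t)) + chi 0 * moll_dist r u0 z.
  move=> schi chi0 hchi; have := kruzkov_half fL f0 HV Hu Hu0 HK schi sr chi0 r0 hchi cr dz.
  move=> /le_trans; apply; rewrite lerD2r.
  have [c [d [dT supp]]] := hchi.
  have [B B0 HB] := bounded_continuous_compact (Sm_continuous (schi 0)) supp.
  have cchi := Sm_continuous (schi 0); have cchi' := Sm_continuous (smooth_derive1 schi 0).
  have mA : measurable_fun setT (fun t : mR => \int[leb2]_w flux f (V t) (Vx t) r (r^`())%classic (u t) z w).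
    exact: (@measurable_int_flux _ mR (fun t => t) (fun t => t) (fun=> z) _ r (bounded_field_cst dz)).
  have i1 : ig (fun t => \1_`]0, T[%classic t * ((chi^`())%classic t * g t)).
    apply: (ig_itv (f := fun t => (chi^`())%classic t * g t) _ ds1).
    by move=> x; exact: (cvgM (cchi' x) (cg x)).
  have i2 : ig (fun t => \1_`]0, T[%classic t * (chi t * \int[leb2]_w flux f (V t) (Vx t) r (r^`())%classic (u t) z w)).
    apply: (@ig_bounded_oo _ _ (B * K)).
      by apply: measurable_funM; [exact: smooth_measurable|exact: mA].
    by move=> t; rewrite normrM ler_pM//; exact: abs_int_flux.
  have i3 : ig (fun t => \1_`]0, T[%classic t * (chi t * K)).
    apply: (ig_itv (f := fun t => chi t * K) _ ds1).
    by move=> x; apply: cvgMl; exact: cchi.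
  have i4 : ig (fun t => \1_`]0, T[%classic t * ((chi^`())%classic t * (K * t))).
    apply: (ig_itv (f := fun t => (chi^`())%classic t * (K * t)) _ ds1).
    by move=> x; exact: (cvgM (cchi' x) (cK x)).
  have -> : \int[leb]_t (\1_`]0, T[%classic t * ((chi^`())%classic t * E t)) =
     \int[leb]_t (\1_`]0, T[%classic t * ((chi^`())%classic t * g t)) + \int[leb]_t (\1_`]0, T[%classic t * (chi t * K)).
    (* [K] is itself a derivative: an integration by parts turns the flux bound into the term
       [K * t] of [E], without contribution at time 0. *)
    have dP (x : R) : is_derive x 1 (fun t : R => K * t) K.
      by apply: (@is_derive_quad _ _ _ _ 0) => h; rewrite mul0r (_ : _ - _ - _ = 0) ?normr0//; ring.
    have cc : continuous (fun _ : R => K) by move=> x; exact: cvg_cst.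
    rewrite (int_test_parts T0 schi hchi dP cc) !mulr0 oppr0 sub0r -intB//.
    by apply: eq_int => t; rewrite /E; ring.
  rewrite -intD//.
  apply: le_int.
  - have := igD i1 i2; apply: eq_integrable => // t _ /=.
    by rewrite -mulrDr.
  - exact: igD.
  - move=> t; rewrite -mulrDr; apply: ler_wpM2l; first by rewrite indicE.
    rewrite lerD2l ler_wpM2l//.
    by apply: le_trans (ler_norm _) _; exact: abs_int_flux.
split.
  move=> s t s0 st tT.
  have := weak_nonincreasing (T := T) cE _ s0 st tT; rewrite /E => H.
  have : g t - K * t <= g s - K * s.
    apply: H => chi schi chi0 [c [d [c0 dT supp]]].
    have := key chi schi chi0 (ex_intro _ c (ex_intro _ d (conj dT supp))).
    by rewrite (supp 0) ?mul0r ?addr0// negb_and -!ltNge c0.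
  by rewrite /g; lra.
move=> t t0 tT.
have := weak_le_initial T0 cE key t0 tT; rewrite /E /g; lra.
Qed.

End time_regularity.

(** * Translation bounds, Hoelder continuity in time and the initial trace *)

Section translation_estimates.
Context {R : realType}.
Local Notation leb := (@lebesgue_measure R).
Local Notation leb2 := (leb \x leb)%E.
Local Notation mR := (measurableTypeR R).
Local Notation ig f := (integrable_real leb f).
Local Notation ig2 f := (integrable_real leb2 f).

Definition translation_bound (M : R) (a : R -> R) :=
  forall r : R, \int[leb]_x `|a (x + r) - a x| <= M * `|r|.

Lemma translation_bound_ge0 M a : translation_bound M a -> 0 <= M.
Proof.
move=> /(_ 1); rewrite normr1 mulr1; apply: le_trans; exact: int_ge0.
Qed.

Lemma density_shift (a : R -> R) r : density a -> density (fun x => a (x + r)).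
Proof. by move=> [a01 iga]; split=> [x|]; [exact: a01|exact: ig_shift]. Qed.

Lemma density_ge0 (a : R -> R) x : density a -> 0 <= a x.
Proof. by move=> [/(_ x) /andP[]]. Qed.

Lemma density_int_ge0 (a : R -> R) : density a -> 0 <= \int[leb]_x a x.
Proof. by move=> da; apply: int_ge0 => x; exact: density_ge0. Qed.

(** After the substitution x -> y + x the kernel confines the displacement to [0, e], where the
    translation bound is at most [M * e]. *)
Lemma moll_dist_self (M e : R) (a r : R -> R) : density a -> translation_bound M a ->
  ig r -> (forall x, 0 <= r x) -> (forall x, ~~ (0 <= x <= e) -> r x = 0) ->
  moll_dist r a a <= M * e * \int[leb]_x r x.
Proof.
move=> da tb igr r0 supp; have [a01 iga] := da.
have M0 := translation_bound_ge0 tb.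
have [i1 _] := ig2_dist da da igr.
pose H (w : mR * mR) : R := `|a (w.2 + w.1) - a w.2| * r w.1.
have mH : measurable_fun setT H.
  have ma := ig_meas iga; have mr := ig_meas igr.
  have m12 : measurable_fun setT (fun w : mR * mR => w.2 + w.1).
    by apply: measurable_funD; [exact: meas_snd|exact: meas_fst].
  apply: measurable_funM; last exact: (measurableT_comp mr measurable_fst).
  apply: measurableT_comp => //; apply: measurable_funB.
    exact: (measurableT_comp ma m12).
  exact: (measurableT_comp ma measurable_snd).
have igd x : ig (fun y => `|a (y + x) - a y|).
  by apply: ig_distB => //; exact: density_shift.
have He x : \int[leb]_y H (x, y) <= (M * e) * r x.
  rewrite (_ : \int[leb]_y H (x, y) = r x * \int[leb]_y `|a (y + x) - a y|); last first.
    by rewrite -intZ//; apply: eq_int => y; rewrite mulrC.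
  have [/andP[x0 xe]|/supp ->] := boolP (0 <= x <= e); last by rewrite mul0r mulr0.
  rewrite mulrC ler_wpM2r// (le_trans (tb x))// ger0_norm// ler_wpM2l//.
have iH : ig2 H.
  apply: (@ig_prod1 _ _ mR mR R leb leb _ (fun x => (M * e) * r x)) => //.
  - exact: igZ.
  - move=> x /=; have := igZ (r x) (igd x); apply: eq_integrable => // y _ /=.
    by rewrite /H mulrC.
  - move=> x /=; rewrite (_ : \int[leb]_y `|H (x, y)| = \int[leb]_y H (x, y)) ?He//.
    by apply: eq_int => y; rewrite ger0_norm// mulr_ge0.
have -> : moll_dist r a a = \int[leb2]_w H w.
  rewrite /moll_dist (Rfubini2 i1) (Rfubini2 iH); apply: eq_int => y.
  have igs : ig (fun x => `|a x - a y| * r (x - y)).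
    apply: (ig_le _ _ (ig_shift (- y) igr)).
      have mr := ig_meas (ig_shift (- y) igr).
      apply: measurable_funM; last exact: mr.
      apply: measurableT_comp => //; apply: measurable_funB; first exact: (ig_meas iga).
      exact: measurable_cst.
    move=> x; rewrite normrM normr_id (ger0_norm (r0 _)) ler_piMl//.
    have /andP[? ?] := a01 x; have /andP[? ?] := a01 y.
    by rewrite ler_norml; apply/andP; split; lra.
  rewrite -(int_shift y igs); apply: eq_int => x.
  by rewrite addrK /H /= (addrC y x).
rewrite (Rfubini1 iH) -intZ//.
by apply: le_int; [exact: ig_param1|exact: igZ|exact: He].
Qed.

(** Replacing [a x] by [a y] costs [moll_dist r a a], and then both functions are evaluated at [y].
    Only translates of [a] are involved. *)
Lemma moll_dist_L1 (M e : R) (a b r : R -> R) : density a -> density b -> translation_bound M a ->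
  ig r -> (forall x, 0 <= r x) -> (forall x, ~~ (0 <= x <= e) -> r x = 0) ->
  \int[leb]_x r x = 1 ->
  `|moll_dist r a b - \int[leb]_x `|a x - b x| | <= M * e.
Proof.
move=> da db tb igr r0 supp r1.
have [i1 _] := ig2_dist da db igr; have [i2 _] := ig2_dist da da igr.
have [i3 e3] := ig_kernel2 (ig_distB da db) igr.
rewrite r1 mulr1 in e3; rewrite -e3.
have := moll_dist_self da tb igr r0 supp; rewrite r1 mulr1; apply: le_trans.
apply: le_trans (abs_intB_le i1 i3) _.
apply: le_int => //; first by apply: ig_abs; exact: igB.
move=> w; rewrite -mulrBl normrM (ger0_norm (r0 _)) ler_wpM2r//.
apply: le_trans (ler_dist_dist _ _) _.
have -> : a w.1 - b w.2 - (a w.2 - b w.2) = a w.1 - a w.2 by ring.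
by [].
Qed.

(** A supremum of order 1/e^2 on a support of length e. *)
Lemma int_moll_derive1 : exists2 B : R, 0 <= B & forall e : R, 0 < e ->
  \int[leb]_x `|((moll e)^`())%classic x| <= B / e.
Proof.
have [B B0 HB] := @moll_derive1_bound R; exists B => // e e0.
have supp x := moll_supp (x := x) e0.
have s0 := smooth_moll e; have s1 := smooth_derive1 s0.
have supp' := derive1_supp s0 supp.
have ig' : ig ((moll e)^`())%classic := ig_continuous_compact (Sm_continuous (s1 0)) supp'.
have cB : continuous (fun _ : R => B / e ^+ 2) by move=> x; exact: cvg_cst.
have iB := ig_itv (i := `[0, e]) cB (@subset_refl _ _).
have dB (x : R) : is_derive x 1 (fun x => B / e ^+ 2 * x) (B / e ^+ 2).
  by apply: (@is_derive_quad _ _ _ _ 0) => h; rewrite mul0r (_ : _ - _ - _ = 0) ?normr0//; ring.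
have := int_FTC e0 dB cB; rewrite mulr0 subr0 => E.
have -> : B / e = \int[leb]_x (\1_`[0, e]%classic x * (B / e ^+ 2)).
  by rewrite E; field; rewrite gt_eqF.
apply: le_int; [exact: ig_abs|exact: iB|].
move=> x; rewrite indicE mem_setE in_itv/=.
by have [_|/supp' ->] := boolP (0 <= x <= e); rewrite ?mul1r ?mul0r ?normr0 ?HB.
Qed.

Lemma moll_compact_supp (e : R) : 0 < e -> compact_supp (moll e).
Proof. by move=> e0; exists 0, e => x; exact: moll_supp. Qed.

Variables (T L C m M M0 : R) (f : R -> R) (V Vx : R -> R -> R) (u : R -> R -> R) (u0 : R -> R).
Hypotheses (fL : forall a b, `|f a - f b| <= L * `|a - b|) (f0 : f 0 = 0).
Hypotheses (HV : velocity C V Vx) (Hu : bounded_field m u).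
Hypotheses (T0 : 0 < T) (Hu0 : density u0) (HK : kruzkov T f V Vx u0 u).
Hypothesis (cu : uniformly_L1_continuous u).
Hypothesis (tbu : forall t, translation_bound M (u t)).

Lemma holder_time : exists2 K : R, 0 <= K & forall s t, 0 <= s <= T -> 0 <= t <= T ->
  \int[leb]_x `|u t x - u s x| <= K * Num.sqrt `|t - s|.
Proof.
have [_ du um] := Hu; have [_ _ HC] := HV.
have [B B0 HB] := int_moll_derive1.
have C0 := C11_ge0 (HC 0).
have L0 : 0 <= L by have := fL 1 0; rewrite subr0 normr1 mulr1; apply: le_trans.
have M0' := translation_bound_ge0 (tbu 0).
have m0 : 0 <= m by apply: le_trans (um 0); exact: density_int_ge0.
have CL0 : 0 <= C * L by exact: mulr_ge0.
(* At scale e, mollifying costs [2 * M * e], and the growth over time t - s costs at most 2 m C L (B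
   / e + 1) (t - s). For e^2 = t - s the latter is 2 m C L (B + e) e, and e <= sqrt T. *)
pose K := 2 * M + (m + m) * (C * L * (B + Num.sqrt T)).
exists K.
  by rewrite /K addr_ge0// ?mulr_ge0// ?addr_ge0 ?sqrtr_ge0.
have lem s t : 0 <= s -> s <= t -> t <= T -> \int[leb]_x `|u t x - u s x| <= K * Num.sqrt (t - s).
  move=> s0 st tT; have [->|nst] := eqVneq s t.
    rewrite subrr sqrtr0 mulr0 le_eqVlt; apply/orP; left; apply/eqP.
    by rewrite -[RHS](@int0 _ _ _ leb); apply: eq_int => x; rewrite subrr normr0.
  have ts0 : 0 < t - s by rewrite subr_gt0 lt_neqAle nst.
  set e := Num.sqrt (t - s); have e0 : 0 < e by rewrite sqrtr_gt0.
  have e2 : e ^+ 2 = t - s by rewrite sqr_sqrtr// ltW.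
  have eT : e <= Num.sqrt T by rewrite ler_sqrt; lra.
  have r0 x := moll_ge0 x e0; have igr := ig_moll e0.
  have cr := moll_compact_supp e0; have sr := smooth_moll e.
  have [G _] := moll_dist_growth fL f0 HV Hu T0 Hu0 HK cu sr cr r0 (du s).
  have {G} := G s t s0 st tT.
  have supp x := moll_supp (x := x) e0.
  have h1 := moll_dist_L1 (du t) (du s) (tbu t) igr r0 supp (int_moll e0).
  have h2 := moll_dist_self (du s) (tbu s) igr r0 supp.
  rewrite (int_moll e0) mulr1 in h2.
  have [_ igr'] := smooth_ig sr cr.
  have kE : \int[leb]_x flux_kernel C L (moll e) ((moll e)^`())%classic x <= C * L * (B / e + 1).
    rewrite /flux_kernel intZ; last by apply: igD; exact: ig_abs.
    rewrite ler_wpM2l// intD; [|exact: ig_abs..].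
    apply: lerD; first exact: HB.
    rewrite -(int_moll e0) le_eqVlt; apply/orP; left; apply/eqP/eq_int => x.
    by rewrite ger0_norm.
  have k0 : 0 <= \int[leb]_x flux_kernel C L (moll e) ((moll e)^`())%classic x.
    by apply: int_ge0 => x; rewrite mulr_ge0// addr_ge0.
  have h3 : (m + \int[leb]_x u s x) * \int[leb]_x (flux_kernel C L (moll e) ((moll e)^`())%classic x) * (t - s)
     <= (m + m) * (C * L * (B + Num.sqrt T)) * e.
    apply: (@le_trans _ _ ((m + m) * (C * L * (B / e + 1)) * (t - s))).
      rewrite ler_wpM2r ?(ltW ts0)// ler_pM// ?addr_ge0 ?density_int_ge0// lerD2l; exact: um.
    have -> : (m + m) * (C * L * (B / e + 1)) * (t - s) = (m + m) * (C * L * (B + e)) * e.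
      by rewrite -e2; field; rewrite gt_eqF.
    rewrite ler_wpM2r ?(ltW e0)// ler_wpM2l ?addr_ge0// ler_wpM2l// lerD2l; exact: eT.
  move: h1 h2 h3; move: (moll_dist _ _ _) (moll_dist _ _ _) (_ * _ * (t - s)) (\int[leb]_x `|_|) => a b c d.
  rewrite ler_norml /K => /andP[h1 _] h2 h3 h4; lra.
move=> s t /andP[s0 sT] /andP[t0 tT]; have [st|/ltW ts] := leP s t.
  by rewrite ger0_norm ?subr_ge0//; exact: lem.
rewrite distrC ger0_norm ?subr_ge0//.
have -> : \int[leb]_x `|u t x - u s x| = \int[leb]_x `|u s x - u t x|.
  by apply: eq_int => x; rewrite distrC.
exact: lem.
Qed.

(** At time 0 the growth estimate, taken with [z = u0], bounds the mollified distance from [u 0] to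
    [u0] by that from [u0] to itself, which is of order e; then e tends to 0. *)
Lemma initial_trace : translation_bound M0 u0 -> \int[leb]_x `|u 0 x - u0 x| = 0.
Proof.
move=> tb0; have [_ du um] := Hu.
have M0' := translation_bound_ge0 (tbu 0); have M00 := translation_bound_ge0 tb0.
apply/eqP; rewrite eq_le int_ge0// andbT; apply/ler_addgt0Pr => /= om om0.
pose e := om / (M + M0 + 1); have MM : 0 < M + M0 + 1 by rewrite ltr_wpDl// addr_ge0.
have e0 : 0 < e by rewrite divr_gt0.
have r0 x := moll_ge0 x e0; have igr := ig_moll e0.
have cr := moll_compact_supp e0; have sr := smooth_moll e.
have [_ G] := moll_dist_growth fL f0 HV Hu T0 Hu0 HK cu sr cr r0 Hu0.
have {G} := G 0 (lexx _) (ltW T0).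
have supp x := moll_supp (x := x) e0.
have h1 := moll_dist_L1 (du 0) Hu0 (tbu 0) igr r0 supp (int_moll e0).
have h2 := moll_dist_self Hu0 tb0 igr r0 supp.
rewrite (int_moll e0) mulr1 in h2; rewrite mulr0 addr0.
have h3 : (M + M0) * e <= om.
  by rewrite /e mulrA ler_pdivrMr// mulrC ler_wpM2l// ?(ltW om0)// lerDl.
move: h1 h2 h3; move: (moll_dist _ _ _) (moll_dist _ _ _) (\int[leb]_x `|_|) => a b d.
rewrite ler_norml => /andP[h1 _] h2 h3 h4; lra.
Qed.

End translation_estimates.

(** * Spatial estimate of the doubled fluxes *)

Section spatial_estimate.
Context {R : realType}.
Local Notation leb := (@lebesgue_measure R).
Local Notation leb2 := (leb \x leb)%E.
Local Notation mR := (measurableTypeR R).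
Local Notation ig f := (integrable_real leb f).
Local Notation ig2 f := (integrable_real leb2 f).
Variables (L : R) (f : R -> R).
Hypotheses (fL : forall a b, `|f a - f b| <= L * `|a - b|) (f0 : f 0 = 0).

(** The Kruzhkov entropy flux attached to the entropy |a - b|. *)
Definition kflux (a b : R) : R := Num.sg (a - b) * (f a - f b).

Lemma L_ge0 : 0 <= L.
Proof. by have := fL 1 0; rewrite subr0 normr1 mulr1; apply: le_trans. Qed.

Lemma abs_kflux a b : `|kflux a b| <= L * `|a - b|.
Proof.
rewrite /kflux normrM normr_sg; apply: le_trans (fL a b).
by rewrite ler_piMl//; case: (_ != _).
Qed.

(** If [a] and [a'] lie on the same side of [b], the difference is that of [f] up to sign. Otherwise
    both fluxes are bounded separately, and |a - b| + |a' - b| = |a - a'|. *)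
Lemma kflux_lip a a' b : `|kflux a b - kflux a' b| <= L * `|a - a'|.
Proof.
have same : kflux a b - kflux a' b = f a - f a' \/ kflux a b - kflux a' b = - (f a - f a') \/
    `|kflux a b| + `|kflux a' b| <= L * `|a - a'|.
  have [h1|h1|h1] := ltgtP a b; have [h2|h2|h2] := ltgtP a' b.
  - by right; left; rewrite /kflux !ltr0_sg ?subr_lt0//; ring.
  - right; right; apply: le_trans (lerD (abs_kflux _ _) (abs_kflux _ _)) _.
    rewrite -mulrDr ler_wpM2l ?L_ge0// ltr0_norm ?subr_lt0// gtr0_norm ?subr_gt0// ltr0_norm ?subr_lt0//; lra.
  - right; right; rewrite h2 {2}/kflux subrr sgr0 mul0r normr0 addr0; exact: abs_kflux.
  - right; right; apply: le_trans (lerD (abs_kflux _ _) (abs_kflux _ _)) _.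
    rewrite -mulrDr ler_wpM2l ?L_ge0// gtr0_norm ?subr_gt0// ltr0_norm ?subr_lt0// gtr0_norm ?subr_gt0//; lra.
  - by left; rewrite /kflux !gtr0_sg ?subr_gt0//; ring.
  - right; right; rewrite h2 {2}/kflux subrr sgr0 mul0r normr0 addr0; exact: abs_kflux.
  - right; right; rewrite -h1 {1}/kflux subrr sgr0 mul0r normr0 add0r distrC; exact: abs_kflux.
  - right; right; rewrite -h1 {1}/kflux subrr sgr0 mul0r normr0 add0r distrC; exact: abs_kflux.
  - by right; right; rewrite h1 h2 /kflux subrr sgr0 mul0r normr0 addr0 mulr0.
case: same => [->|[->|h]]; first exact: fL.
  by rewrite normrN; exact: fL.
by apply: le_trans h; exact: ler_normB.
Qed.

Lemma smooth_refl (r : R -> R) : smooth r -> smooth (fun x => r (- x)).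
Proof.
move=> sr n; have := @Sm_comp_affine _ n r (-1) 0 (sr n).
by under [X in Sm _ X -> _]eq_fun do rewrite mulN1r addr0.
Qed.

Lemma derive1_refl (r : R -> R) (x : R) : smooth r ->
  ((fun x => r (- x))^`())%classic x = - (r^`())%classic (- x).
Proof.
move=> sr; apply: derive1_is_derive.
have := @is_derive_comp_affine _ r (-1) 0 x _ (smooth_is_derive sr _).
rewrite !mulN1r addr0; under [X in is_derive _ _ X _]eq_fun do rewrite mulN1r addr0.
by [].
Qed.

Lemma compact_supp_refl (r : R -> R) : compact_supp r -> compact_supp (fun x => r (- x)).
Proof.
move=> [a [b H]]; exists (- b), (- a) => x xab; apply: H; apply: contra xab => /andP[? ?].
by apply/andP; split; lra.
Qed.

Lemma C11_sub_cst (C K c : R) (F F' : R -> R) : C11 C F F' -> `|c| <= K -> C11 (C + K) (fun x => F x - c) F'.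
Proof.
move=> HF cK x; have C0 := C11_ge0 HF; have K0 : 0 <= K by exact: le_trans cK.
have [h1 h2 h3] := HF x; split.
- by apply: le_trans (ler_normB _ _) _; exact: lerD.
- by apply: le_trans h2 _; rewrite lerDl.
move=> h; have [i1 i2 i3] := h3 h; split.
- by rewrite opprB addrA subrK (le_trans i1)// ler_wpM2r// lerDl.
- by rewrite (le_trans i2)// ler_wpM2r// lerDl.
- by rewrite opprB addrA subrK (le_trans i3)// ler_wpM2r ?sqr_ge0// lerDl.
Qed.

Lemma C11_shift (C y : R) (F F' : R -> R) : C11 C F F' -> C11 C (fun x => F (x - y)) (fun x => F' (x - y)).
Proof.
move=> HF x; have [h1 h2 h3] := HF (x - y); split=> // h; have := h3 h.
by rewrite addrAC.
Qed.

Variables (C e M ma K1 K2 : R) (a b V Vx W Wx : R -> R).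
Hypotheses (da : density a) (db : density b) (HV : C11 C V Vx) (HW : C11 C W Wx) (e0 : 0 < e).
Hypotheses (tb : translation_bound M a) (Ha : \int[leb]_x a x <= ma).
Hypotheses (HK1 : forall x y, 0 <= x - y <= e -> `|V x - W y| <= K1)
  (HK2 : forall x y, 0 <= x - y <= e -> `|Vx x - Wx y| <= K2).
Local Notation rho := (moll e).
Local Notation rho' := ((moll e)^`())%classic.
Local Notation rh := (fun x : R => moll e (- x)).

(** [Ax] is the derivative of [A] in x, the variable of [a]: the later integration by parts then
    produces translates of [a]. *)
Let A (x y : R) : R := (V x - W y) * rho (x - y).
Let Ax (x y : R) : R := Vx x * rho (x - y) + (V x - W y) * rho' (x - y).

Let mkflux d (S : measurableType d) (p q : S -> R) : measurable_fun setT p -> measurable_fun setT q ->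
  measurable_fun setT (fun s => kflux (p s) (q s)).
Proof.
move=> mp mq; apply: measurable_funM.
  by apply: (measurableT_comp measurable_sg); exact: measurable_funB.
by have mf := mf_lip fL; apply: measurable_funB; exact: meas_comp.
Qed.

Let kflux_dom (a' : R -> R) x y : density a' -> `|kflux (a' x) (b y)| <= L * (a' x + b y).
Proof.
move=> [a01 _]; have [b01 _] := db; apply: le_trans (abs_kflux _ _) _; rewrite ler_wpM2l ?L_ge0//.
have /andP[? ?] := a01 x; have /andP[? ?] := b01 y.
by rewrite ler_norml; apply/andP; split; lra.
Qed.

Let ma1 (a' : R -> R) : density a' -> measurable_fun setT (fun w : mR * mR => a' w.1).
Proof. by move=> [_ /ig_meas ma']; apply: (meas_comp ma'); exact: meas_fst. Qed.

Let ma2 (a' : R -> R) : density a' -> measurable_fun setT (fun w : mR * mR => a' w.2).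
Proof. by move=> [_ /ig_meas ma']; apply: (meas_comp ma'); exact: meas_snd. Qed.

Let mfst (F : R -> R) : measurable_fun setT F -> measurable_fun setT (fun w : mR * mR => F w.1).
Proof. by move=> mF; apply: (meas_comp mF); exact: meas_fst. Qed.

Let msnd (F : R -> R) : measurable_fun setT F -> measurable_fun setT (fun w : mR * mR => F w.2).
Proof. by move=> mF; apply: (meas_comp mF); exact: meas_snd. Qed.

Let m12 : measurable_fun setT (fun w : mR * mR => w.1 - w.2 : R).
Proof. by apply: measurable_funB; [exact: meas_fst|exact: meas_snd]. Qed.

Let igK (a' k : R -> R) (B : R * R -> R) : density a' -> measurable_fun setT (B : mR * mR -> R) -> ig k ->
  (forall w, `|B w| <= k (w.1 - w.2)) -> ig2 (fun w => kflux (a' w.1) (b w.2) * B w) /\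
  \int[leb2]_w `|kflux (a' w.1) (b w.2) * B w| <= (\int[leb]_x a' x + \int[leb]_x b x) * (L * \int[leb]_x k x).
Proof.
move=> da' mB igk HB; rewrite -(intZ _ igk); apply: ig2_kernel_dom.
- by case: da'.
- by case: db.
- exact: igZ.
- by apply: measurable_funM => //; apply: mkflux; [exact: ma1|exact: ma2].
move=> w; rewrite normrM mulrCA mulrA; apply: ler_pM => //; exact: kflux_dom.
Qed.

Let mA : measurable_fun setT (fun w : mR * mR => A w.1 w.2).
Proof.
have [mV _] := C11_measurable HV; have [mW _] := C11_measurable HW.
apply: measurable_funM.
  by apply: measurable_funB; [exact: mfst|exact: msnd].
by apply: (meas_comp _ m12); exact: smooth_measurable (smooth_moll e).
Qed.

Let mAx : measurable_fun setT (fun w : mR * mR => Ax w.1 w.2).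
Proof.
have [mV mVx] := C11_measurable HV; have [mW _] := C11_measurable HW.
have mr := smooth_measurable (smooth_moll e).
have mr' := smooth_measurable (smooth_derive1 (smooth_moll e)).
apply: measurable_funD; apply: measurable_funM.
- exact: mfst.
- exact: (meas_comp mr m12).
- by apply: measurable_funB; [exact: mfst|exact: msnd].
- exact: (meas_comp mr' m12).
Qed.

Let C0 : 0 <= C. Proof. exact: (C11_ge0 HV). Qed.

Let VW x y : `|V x - W y| <= C + C.
Proof. by have [? _ _] := HV x; have [? _ _] := HW y; apply: le_trans (ler_normB _ _) _; exact: lerD. Qed.

Let A_le w : `|A w.1 w.2| <= (C + C) * rho (w.1 - w.2).
Proof. by rewrite normrM (ger0_norm (moll_ge0 _ e0)) ler_wpM2r ?moll_ge0. Qed.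

Let A_le1 x y : `|A x y| <= K1 * rho (x - y).
Proof.
rewrite normrM (ger0_norm (moll_ge0 _ e0)).
have [h|/(moll_supp e0) ->] := boolP (0 <= x - y <= e); last by rewrite !mulr0.
by rewrite ler_wpM2r ?moll_ge0// HK1.
Qed.

Let igrho' : ig rho' /\ (forall x : R, ~~ (0 <= x <= e) -> rho' x = 0).
Proof.
have supp x := moll_supp (x := x) e0.
by have [_ ?] := smooth_ig (smooth_moll e) (moll_compact_supp e0); split => //; exact: derive1_supp (smooth_moll e) supp.
Qed.

Let igAx : ig2 (fun w => kflux (a w.1) (b w.2) * Ax w.1 w.2).
Proof.
have [igr' _] := igrho'.
have igk : ig (fun x => C * `|rho x| + (C + C) * `|rho' x|).
  by apply: igD; apply: igZ; apply: ig_abs => //; exact: ig_moll.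
have [] // := @igK a _ (fun w => Ax w.1 w.2) da mAx igk.
move=> w; apply: le_trans (ler_normD _ _) _; rewrite !normrM; apply: lerD; apply: ler_pM => //.
by have [_ ? _] := HV w.1.
Qed.

(* [r A_x] is the difference quotient of [A] up to [O(r^2)]; moving the
   difference onto [kflux (a x) (b y)] costs the translation bound of [a]. *)
Let transport_le (D r : R) : (forall y, C11 D (A^~ y) (Ax^~ y)) -> 0 < r <= 1 ->
  \int[leb2]_w (kflux (a w.1) (b w.2) * Ax w.1 w.2) <=
  L * (M * K1) + (\int[leb]_x a x + \int[leb]_x b x) * (L * (D * (1 + e))) * r.
Proof.
move=> HD /andP[r0 r1]; have D0 := C11_ge0 (HD 0).
have [igr' supp'] := igrho'.
pose ar x := a (x - r); have dar : density ar := density_shift (- r) da.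
have igrho := ig_moll e0.
have igCr := igZ (C + C) igrho.
(* Since r <= 1, the remainder [rem] vanishes when x - y is outside [-1, e]; the length 1 + e of
   this interval enters the error. *)
pose J : R -> R := \1_`[-1, e]%classic.
have iJ : ig J /\ \int[leb]_x J x = 1 + e.
  have i1 : ig (fun x : R => \1_`[-1, e]%classic x * 1).
    apply: (@ig_itv _ `[-1, e] (cst 1) (-1) e); [exact: cst_continuous|exact: subset_refl].
  have JE x : J x = \1_`[-1, e]%classic x * 1 by rewrite mulr1.
  split; first by apply: eq_integrable i1 => // x _ /=; rewrite mulr1.
  rewrite (eq_int leb JE); have e1 : -1 < e by apply: lt_trans e0; rewrite oppr_lt0.
  rewrite (@int_FTC _ id (cst 1) (-1) e e1) ?opprK 1?addrC//; exact: cst_continuous.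
have [iJ1 iJ2] := iJ.
pose rem x y := A (x + r) y - A x y - r * Ax x y.
have mAr : measurable_fun setT (fun w : mR * mR => A (w.1 + r) w.2).
  have ms : measurable_fun setT (fun w : mR * mR => (w.1 + r : mR, w.2 : mR)).
    apply: measurable_fun_pair; last exact: meas_snd.
    by apply: measurable_funD; [exact: meas_fst|exact: measurable_cst].
  exact: (measurableT_comp mA ms).
have rem_le w : `|rem w.1 w.2| <= D * r ^+ 2 * J (w.1 - w.2).
  rewrite /J indicE mem_setE in_itv/=.
  have [h|h] := boolP (-1 <= w.1 - w.2 <= e).
    by rewrite mulr1; have [_ _ /(_ r) [_ _]] := HD w.2 w.1.
  rewrite mulr0 /rem /A /Ax.
  have h1 : ~~ (0 <= w.1 - w.2 <= e) by apply: contra h => /andP[? ?]; apply/andP; split; lra.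
  have h2 : ~~ (0 <= w.1 + r - w.2 <= e) by apply: contra h => /andP[? ?]; apply/andP; split; lra.
  by rewrite !(moll_supp e0)// supp'// !mulr0 addr0 mulr0 !subr0 normr0.
have mrem : measurable_fun setT (fun w : mR * mR => rem w.1 w.2).
  apply: measurable_funB; first exact: measurable_funB.
  by apply: measurable_funM => //; exact: measurable_cst.
have igJ := igZ (D * r ^+ 2) iJ1.
have [irem erem] := igK (a' := a) (B := fun w => rem w.1 w.2) da mrem igJ rem_le.
rewrite (intZ _ iJ1) iJ2 in erem.
have [iA _] := igK (a' := a) (B := fun w => A w.1 w.2) da mA igCr A_le.
have [iAr _] := igK (a' := ar) (B := fun w => A w.1 w.2) dar mA igCr A_le.
have igCs := ig_shift r igCr.
have [|iAs _] := igK (a' := a) (B := fun w => A (w.1 + r) w.2) da mAr igCs.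
  by move=> w; rewrite addrAC; exact: (A_le (w.1 + r, w.2)).
have shiftE : \int[leb2]_w (kflux (a w.1) (b w.2) * A (w.1 + r) w.2) =
    \int[leb2]_w (kflux (ar w.1) (b w.2) * A w.1 w.2).
  rewrite (Rfubini2 iAs) (Rfubini2 iAr); apply: eq_int => y /=.
  pose G x := kflux (ar x) (b y) * A x y.
  have igG : ig G.
    apply: (ig_le _ _ (igZ (L * 2 * (C + C)) (ig_shift (- y) igrho))).
      apply: measurable_funM.
        by apply: mkflux; [case: dar => _ /ig_meas|exact: measurable_cst].
      exact: continuous_measurable_fun (is_derive_continuous (C11_is_derive (HD y))).
    move=> x; rewrite /G normrM -[leRHS]mulrA; apply: ler_pM => //; last exact: (A_le (x, y)).
    apply: le_trans (kflux_dom x y dar) _; rewrite ler_wpM2l//; first exact: L_ge0.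
    have [/(_ x)/andP[_ ?] _] := dar; have [/(_ y)/andP[_ ?] _] := db; lra.
  by rewrite -(int_shift r igG); apply: eq_int => x; rewrite /G /ar addrK.
(* The shift acts on [a] alone: [kflux_lip] gives [L * |ar - a|], and [A] is at most [K1] times a
   kernel of mass one. *)
have main : \int[leb2]_w (kflux (ar w.1) (b w.2) * A w.1 w.2) -
    \int[leb2]_w (kflux (a w.1) (b w.2) * A w.1 w.2) <= L * (M * K1) * r.
  apply: le_trans (ler_norm _) _; apply: le_trans (abs_intB_le iAr iA) _.
  have igd : ig (fun x => `|ar x - a x|) by exact: ig_distB.
  have [ik ek] := ig_kernel1 igd (igZ (L * K1) igrho).
  rewrite (intZ _ igrho) (int_moll e0) mulr1 in ek.
  have K10 : 0 <= K1 by apply: le_trans (HK1 (x := 0) (y := 0) _); rewrite ?subrr ?lexx ?(ltW e0).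
  apply: (@le_trans _ _ (\int[leb]_x `|ar x - a x| * (L * K1))); last first.
    rewrite (_ : L * (M * K1) * r = M * r * (L * K1)); last by ring.
    apply: ler_wpM2r; first exact: (mulr_ge0 L_ge0 K10).
    by have := tb (- r); rewrite normrN (gtr0_norm r0).
  rewrite -ek; apply: le_int; [exact: (ig_abs (igB iAr iA))|exact: ik|].
  move=> w; rewrite -mulrBl normrM.
  rewrite [leRHS](_ : _ = L * `|ar w.1 - a w.1| * (K1 * rho (w.1 - w.2))); last by ring.
  by apply: ler_pM; [exact: normr_ge0|exact: normr_ge0|exact: kflux_lip|exact: A_le1].
have remB : - (\int[leb2]_w (kflux (a w.1) (b w.2) * rem w.1 w.2)) <=
    (\int[leb]_x a x + \int[leb]_x b x) * (L * (D * r ^+ 2 * (1 + e))).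
  apply: le_trans _ erem; rewrite -(intN irem).
  apply: le_int; [exact: (igN irem)|exact: (ig_abs irem)|].
  by move=> w; rewrite -normrN ler_norm.
have : r * \int[leb2]_w (kflux (a w.1) (b w.2) * Ax w.1 w.2) =
   \int[leb2]_w (kflux (a w.1) (b w.2) * A (w.1 + r) w.2)
   - \int[leb2]_w (kflux (a w.1) (b w.2) * A w.1 w.2)
   - \int[leb2]_w (kflux (a w.1) (b w.2) * rem w.1 w.2).
  rewrite -(intZ _ igAx) -(intB iAs iA) -(intB (igB iAs iA) irem).
  by apply: eq_int => w; rewrite /rem; ring.
rewrite shiftE => E; rewrite -(ler_pM2l r0) E.
have -> : r * (L * (M * K1) + (\int[leb]_x a x + \int[leb]_x b x) * (L * (D * (1 + e))) * r) =
  L * (M * K1) * r + (\int[leb]_x a x + \int[leb]_x b x) * (L * (D * r ^+ 2 * (1 + e))).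
  by move: (\int[leb]_x a x + _) => p; ring.
by apply: lerD.
Qed.

(** The second flux uses the reflected kernel because its variables are exchanged. The mass of [b]
    and the [C11] constant of [A] occur only in the remainder of [transport_le], which disappears as
    the step tends to 0 with [e] fixed. *)
Lemma spatial_estimate :
  \int[leb2]_w flux f V Vx rho rho' a b w +
  \int[leb2]_w flux f W Wx rh (rh^`())%classic b a w <= L * (M * K1 + ma * K2).
Proof.
have sr := smooth_moll e; have cr := moll_compact_supp e0.
have srh : smooth rh by exact: smooth_refl.
have crh : compact_supp rh by exact: compact_supp_refl.
have igrho := ig_moll e0.
have vel F F' : C11 C F F' -> velocity C (fun=> F) (fun=> F').
  move=> HF; have [mF mF'] := C11_measurable HF; split => //; exact: msnd.
have [i1 _] := ig2_flux fL f0 (vel _ _ HV) (bounded_field_cst da) 0 sr cr db.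
have [i2 _] := ig2_flux fL f0 (vel _ _ HW) (bounded_field_cst db) 0 srh crh da.
have [i2s <-] := ig2_swap i2.
rewrite -intD//.
pose Z (w : R * R) := L * K2 * (a w.1 * rho (w.1 - w.2)).
have [ia ea] := ig_kernel1 (da.2) igrho.
rewrite (int_moll e0) mulr1 in ea.
have iZ := igZ (L * K2) ia.
apply: (@le_trans _ _ (\int[leb2]_w (kflux (a w.1) (b w.2) * Ax w.1 w.2 + Z w))).
  apply: le_int; [exact: igD|exact: igD|] => w.
  rewrite /flux /= (derive1_refl _ sr) opprB /Z /Ax.
  set s := Num.sg (a w.1 - b w.2).
  have sE : Num.sg (b w.2 - a w.1) = - s by rewrite -opprB sgrN.
  rewrite sE.
  set p := rho (w.1 - w.2); set p' := rho' (w.1 - w.2).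
  have p0 : 0 <= p by exact: moll_ge0.
  have h : s * (f (a w.1) * (Wx w.2 - Vx w.1)) * p <= L * K2 * (a w.1 * p).
    have [hK|hK] := boolP (0 <= w.1 - w.2 <= e); last by rewrite /p (moll_supp e0 hK) !mulr0.
    rewrite mulrA ler_wpM2r//; apply: le_trans (ler_norm _) _.
    rewrite !normrM; apply: (@le_trans _ _ (1 * (L * a w.1 * K2))); last by rewrite mul1r mulrAC.
    apply: ler_pM => //; first by rewrite /s normr_sg; case: (_ != _).
    apply: ler_pM => //; last by rewrite distrC; exact: HK2.
    have := fL (a w.1) 0; rewrite f0 !subr0 (ger0_norm (density_ge0 _ da)).
    exact.
  (* The part of the two fluxes with f(a) - f(b) as a factor forms the entropy flux times [Ax]; what
     is left is f(a) times the difference of the velocity derivatives, of size [L * a * K2]. *)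
  have -> : s * (f (a w.1) - f (b w.2)) * V w.1 * p' - f (b w.2) * s * Vx w.1 * p +
    (- s * (f (b w.2) - f (a w.1)) * W w.2 * - p' - f (a w.1) * - s * Wx w.2 * p) =
    kflux (a w.1) (b w.2) * (Vx w.1 * p + (V w.1 - W w.2) * p') +
    s * (f (a w.1) * (Wx w.2 - Vx w.1)) * p by rewrite /kflux -/s; ring.
  by rewrite lerD2l.
rewrite intD// intZ// ea mulrDr; apply: lerD; last first.
  have K20 : 0 <= K2 by apply: le_trans (HK2 (x := 0) (y := 0) _); rewrite ?subrr ?lexx ?(ltW e0).
  rewrite -mulrA; apply: ler_wpM2l; first exact: L_ge0.
  by rewrite mulrC ler_wpM2r.
have supp x := moll_supp (x := x) e0.
have [Cr HCr] := smooth_C11 sr supp.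
have HD y : C11 (4 * (C + C) * Cr) (A^~ y) (Ax^~ y).
  have [Wy _ _] := HW y.
  exact: (C11M (C11_sub_cst HV Wy) (C11_shift y HCr)).
apply/ler_addgt0Pr => om om0.
set B := (\int[leb]_x a x + \int[leb]_x b x) * (L * (4 * (C + C) * Cr * (1 + e))).
have B0 : 0 <= B.
  rewrite mulr_ge0 ?addr_ge0 ?density_int_ge0// mulr_ge0 ?L_ge0// mulr_ge0 ?addr_ge0 ?(ltW e0)//.
  exact: (C11_ge0 (HD 0)).
(* The step of the difference quotient, chosen so that the remainder [B * r] stays below the
   arbitrary [om]. *)
pose r := Num.min 1 (om / (B + 1)).
have r0 : 0 < r by rewrite lt_min ltr01 divr_gt0// ltr_wpDl.
have r1 : r <= 1 by rewrite ge_min lexx.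
have r01 : 0 < r <= 1 by rewrite r0 r1.
apply: le_trans (transport_le HD r01) _.
rewrite -/B lerD2l; apply: (@le_trans _ _ (B * (om / (B + 1)))).
  by rewrite ler_wpM2l// ge_min lexx orbT.
rewrite mulrA ler_pdivrMr ?ltr_wpDl// mulrC ler_wpM2l ?(ltW om0)// lerDl//.
Qed.

End spatial_estimate.

(** * Doubling of the time variable *)

Section time_doubling.
Context {R : realType}.
Local Notation leb := (@lebesgue_measure R).
Local Notation leb2 := (leb \x leb)%E.
Local Notation mR := (measurableTypeR R).
Local Notation ig f := (integrable_real leb f).
Local Notation ig2 f := (integrable_real leb2 f).

Lemma ig2_tensor (K : R) (a b : R -> R) (X : R * R -> R) : ig a -> ig b ->
  measurable_fun setT (X : mR * mR -> R) -> (forall w, `|X w| <= K) ->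
  ig2 (fun w => a w.1 * (b w.2 * X w)).
Proof.
move=> iga igb mX XK; have K0 : 0 <= K by exact: le_trans (XK (0, 0)).
have igb' := ig_abs igb; have iga' := ig_abs iga.
have ma : measurable_fun setT (fun w : mR * mR => a w.1) by apply: (meas_comp (ig_meas iga)); exact: meas_fst.
have mb : measurable_fun setT (fun w : mR * mR => b w.2) by apply: (meas_comp (ig_meas igb)); exact: meas_snd.
have sec t : ig (fun s => b s * X (t, s)) /\ \int[leb]_s `|b s * X (t, s)| <= K * \int[leb]_s `|b s|.
  have mXt : measurable_fun setT (fun s : R => b s * X (t, s)).
    apply: measurable_funM; first exact: (ig_meas igb).
    exact: (measurableT_comp mX (pair1_measurable t)).
  have le s : `|b s * X (t, s)| <= K * `|b s| by rewrite normrM mulrC ler_wpM2r.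
  have i : ig (fun s => b s * X (t, s)).
    by apply: ig_le (igZ K igb'); [exact: mXt|exact: le].
  split => //; rewrite -(intZ _ igb'); apply: le_int; [exact: ig_abs|exact: igZ|exact: le].
apply: (@ig_prod1 _ _ mR mR R leb leb _ (fun t => K * \int[leb]_s `|b s| * `|a t|)).
- by apply: measurable_funM => //; exact: measurable_funM.
- exact: igZ.
- by move=> t /=; have [i _] := sec t; exact: (igZ (a t) i).
- move=> t /=; have [i le] := sec t; rewrite [leRHS]mulrC.
  rewrite (_ : \int[leb]_y _ = `|a t| * \int[leb]_s `|b s * X (t, s)|).
    by rewrite ler_wpM2l.
  rewrite -(intZ _ (ig_abs i)); apply: eq_int => s; exact: normrM.
Qed.

Lemma ig2_bounded_oo (T K : R) (X : R * R -> R) :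
  measurable_fun setT (X : mR * mR -> R) -> (forall w, `|X w| <= K) ->
  ig2 (fun w => \1_`]0, T[%classic w.1 * (\1_`]0, T[%classic w.2 * X w)).
Proof.
have i : ig (\1_`]0, T[%classic : R -> R) by exact: integrable_indic_itv.
exact: (ig2_tensor i i).
Qed.

(** In the inequality for [v] the space variables are exchanged; the reflected kernel restores the
    same mollified distance, so that both halves carry the same function [g]. *)
Lemma moll_dist_refl (r a b : R -> R) : density a -> density b -> ig r ->
  moll_dist (fun x => r (- x)) b a = moll_dist r a b.
Proof.
move=> da db igr; have [i _] := ig2_dist da db igr.
rewrite [RHS]/moll_dist; have [_ <-] := ig2_swap i; apply: eq_int => w /=.
by rewrite opprB distrC.
Qed.

Lemma abs_moll_dist (ma mb : R) (r a b : R -> R) : density a -> density b -> ig r ->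
  \int[leb]_x a x <= ma -> \int[leb]_x b x <= mb ->
  `|moll_dist r a b| <= (ma + mb) * \int[leb]_x `|r x|.
Proof.
move=> da db igr Ha Hb; have [i le] := ig2_dist da db igr.
apply: (@le_trans _ _ (\int[leb2]_w `| `|a w.1 - b w.2| * r (w.1 - w.2)|)).
  by apply: abs_int_le; [exact: ig_meas i|by []|exact: ig_abs].
apply: le_trans le _; rewrite ler_wpM2r ?lerD//; apply: int_ge0 => x; exact: normr_ge0.
Qed.

Lemma measurable_moll_dist d (S : measurableType d) (a b : S -> R) (u v : R -> R -> R) (mu mv : R)
  (r : R -> R) : bounded_field mu u -> bounded_field mv v ->
  measurable_fun setT a -> measurable_fun setT b -> ig r ->
  measurable_fun setT (fun s => moll_dist r (u (a s)) (v (b s))).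
Proof.
move=> [mu' du _] [mv' dv _] ma mb igr.
apply: (@meas_param_leb2 _ _ S (fun q => `|u (a q.1.1) q.1.2 - v (b q.1.1) q.2| * r (q.1.2 - q.2))); last first.
  by move=> s; have [] := ig2_dist (du (a s)) (dv (b s)) igr.
have m11 : measurable_fun setT (fun q : (S * mR) * mR => q.1.1 : S).
  exact: (measurableT_comp measurable_fst measurable_fst).
have m12 : measurable_fun setT (fun q : (S * mR) * mR => q.1.2 : R).
  exact: (measurableT_comp (@meas_snd _ _ S) measurable_fst).
have m2 : measurable_fun setT (fun q : (S * mR) * mR => q.2 : R) by exact: meas_snd.
have maq : measurable_fun setT (fun q : (S * mR) * mR => a q.1.1) by exact: (measurableT_comp ma m11).
have mbq : measurable_fun setT (fun q : (S * mR) * mR => b q.1.1) by exact: (measurableT_comp mb m11).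
apply: measurable_funM.
  apply: measurableT_comp => //; apply: measurable_funB.
    exact: (meas_comp2 mu').
  exact: (meas_comp2 mv').
by apply: (meas_comp (ig_meas igr)); exact: measurable_funB.
Qed.

Lemma L1_dist_continuous (u v : R -> R -> R) : (forall t, density (u t)) ->
  (forall t, density (v t)) -> uniformly_L1_continuous u -> uniformly_L1_continuous v ->
  continuous (fun s => \int[leb]_x `|u s x - v s x|).
Proof.
move=> du dv cu cv t; apply/cvgrPdist_le => om om0.
have om2 : 0 < om / 2 by rewrite divr_gt0.
have [d1 d10 H1] := cu _ om2; have [d2 d20 H2] := cv _ om2.
have i s t' := ig_distB (du s) (dv t').
near=> s.
have a1 : \int[leb]_x `|u t x - u s x| <= om / 2 by apply: H1; near: s; exact: cvgr_dist_le.
have a2 : \int[leb]_x `|v t x - v s x| <= om / 2 by apply: H2; near: s; exact: cvgr_dist_le.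
apply: le_trans (abs_intB_le (i t t) (i s s)) _.
have i1 := ig_distB (du t) (du s); have i2 := ig_distB (dv t) (dv s).
apply: (@le_trans _ _ (\int[leb]_x (`|u t x - u s x| + `|v t x - v s x|))); last first.
  by rewrite (intD i1 i2); move: a1 a2; move: (\int[leb]_x _) (\int[leb]_x _) => p q; lra.
apply: le_int; [exact: (ig_abs (igB (i t t) (i s s)))|exact: igD|].
move=> x; apply: le_trans (ler_dist_dist _ _) _.
rewrite (_ : _ - _ - _ = (u t x - u s x) - (v t x - v s x)); last by ring.
exact: ler_normB.
Unshelve. all: by end_near. Qed.

Variables (T L C m mv M : R) (f : R -> R).
Hypotheses (fL : forall a b, `|f a - f b| <= L * `|a - b|) (f0 : f 0 = 0) (T0 : 0 < T).
Variables (V Vx u : R -> R -> R) (u0 : R -> R).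
Hypotheses (HV : velocity C V Vx) (Hu : bounded_field m u) (Hu0 : density u0)
  (HKu : kruzkov T f V Vx u0 u) (cu : uniformly_L1_continuous u)
  (tbu : forall t, translation_bound M (u t)).
Variables (W Wx v : R -> R -> R) (v0 : R -> R).
Hypotheses (HW : velocity C W Wx) (Hv : bounded_field mv v) (Hv0 : density v0)
  (HKv : kruzkov T f W Wx v0 v) (cv : uniformly_L1_continuous v).
Hypothesis (cV : forall om : R, 0 < om -> exists2 d : R, 0 < d & forall s t x : R,
  `|s - t| <= d -> `|V t x - V s x| <= om /\ `|Vx t x - Vx s x| <= om).
Variables (c P : R -> R).
Hypotheses (cc : continuous c) (dP : forall x : R, is_derive x 1 P (c x)).
Hypotheses (Hc : forall s x : R, 0 < s < T -> `|V s x - W s x| <= c s)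
  (Hcx : forall s x : R, 0 < s < T -> `|Vx s x - Wx s x| <= c s).

Local Notation D := (\1_`]0, T[%classic : R -> R).

Section doubled_test.
Variables (chi : R -> R) (c0 d h e : R).
Hypotheses (schi : smooth chi) (chi0 : forall t, 0 <= chi t) (h0 : 0 < h) (hc : h < c0) (dT : d < T)
  (supp : forall t, ~~ (c0 <= t <= d) -> chi t = 0) (e0 : 0 < e).
Local Notation rho := (moll e).
Local Notation rh := (fun x : R => moll e (- x)).
Local Notation eta := (moll h).
Local Notation eta' := ((moll h)^`())%classic.
Local Notation chi' := (chi^`())%classic.

Let g (w : R * R) := moll_dist rho (u w.1) (v w.2).
Let A (w : R * R) := \int[leb2]_p flux f (V w.1) (Vx w.1) rho (rho^`())%classic (u w.1) (v w.2) p.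
Let B (w : R * R) := \int[leb2]_p flux f (W w.2) (Wx w.2) rh (rh^`())%classic (v w.2) (u w.1) p.

Let srho : smooth rho. Proof. exact: smooth_moll. Qed.
Let crho : compact_supp rho. Proof. exact: moll_compact_supp. Qed.
Let srh : smooth rh. Proof. exact: smooth_refl. Qed.
Let crh : compact_supp rh. Proof. exact: compact_supp_refl. Qed.

Let du t : density (u t). Proof. by have [] := Hu. Qed.
Let dv t : density (v t). Proof. by have [] := Hv. Qed.
Let um t : \int[leb]_x u t x <= m. Proof. by have [] := Hu. Qed.
Let vm t : \int[leb]_x v t x <= mv. Proof. by have [] := Hv. Qed.

Let mfst : measurable_fun setT (fun w : mR * mR => w.1 : R). Proof. exact: meas_fst. Qed.
Let msnd : measurable_fun setT (fun w : mR * mR => w.2 : R). Proof. exact: meas_snd. Qed.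

Let bounded_measurable (F : R * R -> R) :=
  measurable_fun setT (F : mR * mR -> R) /\ exists K : R, forall w, `|F w| <= K.

Let bmD F G : bounded_measurable F -> bounded_measurable G -> bounded_measurable (fun w => F w + G w).
Proof.
move=> [mF [K FK]] [mG [K' GK]]; split; first exact: measurable_funD.
by exists (K + K') => w; apply: le_trans (ler_normD _ _) _; exact: lerD.
Qed.

Let bmM F G : bounded_measurable F -> bounded_measurable G -> bounded_measurable (fun w => F w * G w).
Proof.
move=> [mF [K FK]] [mG [K' GK]]; split; first exact: measurable_funM.
by exists (K * K') => w; rewrite normrM; exact: ler_pM.
Qed.

Let bm_smooth (p : R * R -> R) (r : R -> R) a b : measurable_fun setT (p : mR * mR -> R) ->
  smooth r -> (forall t, ~~ (a <= t <= b) -> r t = 0) ->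
  bounded_measurable (fun w => r (p w)) /\ bounded_measurable (fun w => (r^`())%classic (p w)).
Proof.
move=> mp sr sup; have [K HK] := smooth_C11 sr sup; split; split.
- exact: (meas_comp (smooth_measurable sr) mp).
- by exists K => w; have [] := HK (p w).
- exact: (meas_comp (smooth_measurable (smooth_derive1 sr)) mp).
- by exists K => w; have [] := HK (p w).
Qed.

Let bmg : bounded_measurable g.
Proof.
split; first exact: (measurable_moll_dist Hu Hv mfst msnd (ig_moll e0)).
by exists ((m + mv) * \int[leb]_x `|rho x|) => w; apply: abs_moll_dist => //; exact: ig_moll.
Qed.

Let bmA : bounded_measurable A.
Proof.
split; first exact: (measurable_int_flux fL f0 HV Hu Hv mfst msnd srho crho).
exists ((m + mv) * \int[leb]_x (flux_kernel C L rho (rho^`())%classic x)) => w.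
apply: le_trans (abs_int_flux fL f0 HV Hu _ srho crho (dv _)) _.
rewrite ler_wpM2r ?lerD2l//; apply: int_ge0 => x.
by rewrite /flux_kernel mulr_ge0 ?addr_ge0 ?normr_ge0// mulr_ge0 ?(L_ge0 fL)//; have [_ _ /(_ 0) /C11_ge0] := HV.
Qed.

Let bmB : bounded_measurable B.
Proof.
split; first exact: (measurable_int_flux fL f0 HW Hv Hu msnd mfst srh crh).
exists ((mv + m) * \int[leb]_x (flux_kernel C L rh (rh^`())%classic x)) => w.
apply: le_trans (abs_int_flux fL f0 HW Hv _ srh crh (du _)) _.
rewrite ler_wpM2r ?lerD2l//; apply: int_ge0 => x.
by rewrite /flux_kernel mulr_ge0 ?addr_ge0 ?normr_ge0// mulr_ge0 ?(L_ge0 fL)//; have [_ _ /(_ 0) /C11_ge0] := HV.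
Qed.

Let bmeta : bounded_measurable (fun w => eta (w.2 - w.1)) /\ bounded_measurable (fun w => eta' (w.2 - w.1)).
Proof.
have suppe x := moll_supp (x := x) h0.
by apply: bm_smooth (smooth_moll h) suppe; apply: measurable_funB.
Qed.

Let bmchi : bounded_measurable (fun w => chi w.2) /\ bounded_measurable (fun w => chi' w.2).
Proof. exact: bm_smooth schi supp. Qed.

(** [Y1] comes from testing the inequality of [u] in t with eta(s - t), and [X2] from testing that
    of [v] in s with chi(s) eta(s - t). In [chi * Y1 + X2] the singular terms with [eta'] cancel. *)
Let Y1 (w : R * R) := - eta' (w.2 - w.1) * g w + eta (w.2 - w.1) * A w.
Let X2 (w : R * R) := (chi' w.2 * eta (w.2 - w.1) + chi w.2 * eta' (w.2 - w.1)) * g w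
  + chi w.2 * eta (w.2 - w.1) * B w.

Let bmY1 : bounded_measurable Y1.
Proof.
have [b1 b2] := bmeta; apply: bmD; apply: bmM => //.
have [mb [K bK]] := b2; split; first exact/measurable_funN.
by exists K => w; rewrite normrN.
Qed.

Let bmX2 : bounded_measurable X2.
Proof.
have [b1 b2] := bmeta; have [b3 b4] := bmchi.
apply: bmD; apply: bmM => //; last exact: bmM.
by apply: bmD; exact: bmM.
Qed.

Let half_u s : 0 <= \int[leb]_t (D t * (D s * (chi s * Y1 (t, s)))).
Proof.
have [hs|/supp ->] := boolP (c0 <= s <= d); last first.
  by apply: int_ge0 => t; rewrite mul0r !mulr0.
have /andP[s1 s2] := hs.
have seta := smooth_moll h.
(* Seen as a function of t, the test is supported in [s - h, s]. As h < c0 <= s and s <= d < T, it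
   vanishes at 0 and before T, and the initial term drops out. *)
pose zeta t := eta (- (t - s)).
have szeta : smooth zeta by exact: (smooth_shift s (smooth_refl seta)).
have dzeta t : (zeta^`())%classic t = - eta' (s - t).
  rewrite (derive1_is_derive (smooth_is_derive_shift s t (smooth_refl seta))).
  by rewrite (derive1_refl _ seta) opprB.
have suppz (t : R) : ~~ (s - h <= t <= s) -> zeta t = 0.
  by move=> H; apply: (moll_supp h0); apply: contra H => /andP[? ?]; apply/andP; split; lra.
have z0 : zeta 0 = 0.
  apply: suppz; rewrite negb_and -ltNge; apply/orP; left; rewrite subr_gt0; exact: lt_le_trans hc s1.
have zeta0 t : 0 <= zeta t by exact: moll_ge0.
have zsupp : exists c d : R, d < T /\ forall t, ~~ (c <= t <= d) -> zeta t = 0.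
  by exists (s - h), s; split => //; exact: le_lt_trans s2 dT.
have := kruzkov_half fL f0 HV Hu Hu0 HKu szeta srho zeta0 (fun x => moll_ge0 x e0) zsupp crho (dv s).
rewrite z0 mul0r addr0 => H.
have E : (fun t => D t * ((zeta^`())%classic t * moll_dist rho (u t) (v s) +
  zeta t * \int[leb2]_w flux f (V t) (Vx t) rho (rho^`())%classic (u t) (v s) w)) = 
  (fun t => D t * Y1 (t, s)).
  by apply/funext => t; rewrite dzeta /zeta opprB.
rewrite E in H.
have igX : ig (fun t => D t * Y1 (t, s)).
  have [mY [K YK]] := bmY1.
  apply: (@ig_bounded_oo _ _ _ K) => //.
  exact: (measurableT_comp mY (pair2_measurable s)).
rewrite (_ : \int[leb]_t _ = D s * chi s * \int[leb]_t (D t * Y1 (t, s))).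
  by rewrite !mulr_ge0// indicE.
by rewrite -(intZ _ igX); apply: eq_int => t; ring.
Qed.

Let half_v t : 0 <= \int[leb]_s (D t * (D s * X2 (t, s))).
Proof.
have seta := smooth_moll h.
pose zeta s := chi s * eta (s - t).
have szeta : smooth zeta by move=> n; apply: SmM; [exact: schi|exact: smooth_shift].
have dzeta s : (zeta^`())%classic s = chi' s * eta (s - t) + chi s * eta' (s - t).
  apply: derive1_is_derive.
  have := is_deriveM (smooth_is_derive schi s) (smooth_is_derive_shift t s seta).
  by rewrite /GRing.scale /= addrC (mulrC (eta _)).
have suppz (s : R) : ~~ (c0 <= s <= d) -> zeta s = 0.
  by move=> /supp H; rewrite /zeta H mul0r.
have z0 : zeta 0 = 0.
  apply: suppz; rewrite negb_and -ltNge; apply/orP; left; exact: lt_trans h0 hc.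
have zeta0 s : 0 <= zeta s by rewrite mulr_ge0// moll_ge0.
have zsupp : exists c d : R, d < T /\ forall t, ~~ (c <= t <= d) -> zeta t = 0.
  by exists c0, d.
have := kruzkov_half fL f0 HW Hv Hv0 HKv szeta srh zeta0 (fun x => moll_ge0 (- x) e0) zsupp crh (du t).
rewrite z0 mul0r addr0 => H.
have E : (fun s => D s * ((zeta^`())%classic s * moll_dist rh (v s) (u t) +
  zeta s * \int[leb2]_w flux f (W s) (Wx s) rh (rh^`())%classic (v s) (u t) w)) = 
  (fun s => D s * X2 (t, s)).
  by apply/funext => s; rewrite dzeta /zeta (moll_dist_refl (du t) (dv s) (ig_moll e0)).
rewrite E in H.
have igX : ig (fun s => D s * X2 (t, s)).
  have [mY [K YK]] := bmX2.
  apply: (@ig_bounded_oo _ _ _ K); last by move=> s; exact: YK.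
  exact: (measurableT_comp mY (pair1_measurable t)).
by rewrite (intZ _ igX) mulr_ge0// indicE.
Qed.


Variable om : R.
Hypothesis (om0 : 0 <= om).
Hypotheses (hu : forall s t : R, `|s - t| <= h -> \int[leb]_x `|u s x - u t x| <= om)
  (hV : forall s t x : R, `|s - t| <= h -> `|V t x - V s x| <= om /\ `|Vx t x - Vx s x| <= om).

Local Notation G s := (\int[leb]_x `|u s x - v s x|).
Local Notation L' := (L * (M + m)).
(** The error of the mollified distance is [om] for the time shift of [u] plus [M * e]; that of the
    velocities is [om] for the time shift of [V] plus [C * e] for the space shift of [W]. *)
Let err := om + M * e + L' * (om + C * e).

Let M0 : 0 <= M. Proof. exact: translation_bound_ge0 (tbu 0). Qed.
Let m0 : 0 <= m. Proof. by apply: le_trans (um 0); exact: density_int_ge0. Qed.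
Let L'0 : 0 <= L'. Proof. by rewrite mulr_ge0 ?(L_ge0 fL)// addr_ge0. Qed.

Let g_near t s : `|s - t| <= h -> `|g (t, s) - G s| <= om + M * e.
Proof.
move=> st; have supp_rho x := moll_supp (x := x) e0.
have r0 x := moll_ge0 x e0.
have h1 := moll_dist_lip (du t) (du s) (dv s) (ig_moll e0) r0.
have h2 := moll_dist_L1 (du s) (dv s) (tbu s) (ig_moll e0) r0 supp_rho (int_moll e0).
rewrite int_moll// mulr1 in h1.
have h3 : \int[leb]_x `|u t x - u s x| <= om by apply: hu; rewrite distrC.
rewrite -(subrKA (moll_dist rho (u s) (v s))); apply: le_trans (ler_normD _ _) _.
by apply: lerD => //; exact: le_trans h1 h3.
Qed.

(** The path from [V t x] to [W s y] passes through [V s x] and [W s x]: only [V] is moved in time,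
    and [W] is moved in space at the fixed time [s]. *)
Let AB_le (t s : R) : 0 < s < T -> `|s - t| <= h -> A (t, s) + B (t, s) <= L' * (c s + (om + C * e)).
Proof.
move=> sT st; have [_ _ HVt] := HV; have [_ _ HWs] := HW.
have K1 x y : 0 <= x - y <= e -> `|V t x - W s y| <= c s + (om + C * e).
  move=> /andP[xy1 xy2]; rewrite (_ : _ - _ = (V s x - W s x) + ((V t x - V s x) + (W s x - W s y))); last by ring.
  apply: le_trans (ler_normD _ _) _; apply: lerD; first exact: Hc.
  apply: le_trans (ler_normD _ _) _; apply: lerD; first by have [] := hV x st.
  apply: le_trans (C11_lip (HWs s) x y) _; rewrite ler_wpM2l ?(C11_ge0 (HWs s))// ger0_norm//.
have K2 x y : 0 <= x - y <= e -> `|Vx t x - Wx s y| <= c s + (om + C * e).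
  move=> /andP[xy1 xy2]; rewrite (_ : _ - _ = (Vx s x - Wx s x) + ((Vx t x - Vx s x) + (Wx s x - Wx s y))); last by ring.
  apply: le_trans (ler_normD _ _) _; apply: lerD; first exact: Hcx.
  apply: le_trans (ler_normD _ _) _; apply: lerD; first by have [] := hV x st.
  apply: le_trans (C11_lip' (HWs s) x y) _; rewrite ler_wpM2l ?(C11_ge0 (HWs s))// ger0_norm//.
have := spatial_estimate fL f0 (du t) (dv s) (HVt t) (HWs s) e0 (tbu t) (um t) K1 K2.
by rewrite -mulrDl mulrA.
Qed.

Let supp_D s : c0 <= s <= d -> 0 < s < T.
Proof.
move=> /andP[s1 s2]; rewrite (le_lt_trans s2 dT) andbT.
exact: lt_le_trans (lt_trans h0 hc) s1.
Qed.

Let Y s := chi' s * G s + chi s * (L' * c s) + err * (`|chi' s| + chi s).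

Let XY t s : D t * (D s * (chi s * Y1 (t, s))) + D t * (D s * X2 (t, s)) <=
  D t * (eta (s - t) * (D s * Y s)).
Proof.
have suppe x := moll_supp (x := x) h0.
have supp' := derive1_supp schi supp.
have D0 z : 0 <= D z by rewrite indicE.
rewrite (_ : _ + _ = D t * (eta (s - t) * (D s * (chi' s * g (t, s) + chi s * (A (t, s) + B (t, s)))))); last first.
  by rewrite /Y1 /X2 /=; ring.
have [hst|/suppe ->] := boolP (0 <= s - t <= h); last by rewrite !mul0r.
have st : `|s - t| <= h by have /andP[? ?] := hst; rewrite ger0_norm.
apply: ler_wpM2l => //; apply: ler_wpM2l; first exact: moll_ge0.
have [hs|hs] := boolP (c0 <= s <= d); last first.
  by rewrite /Y (supp hs) (supp' _ hs) !mul0r normr0 !addr0 !mulr0.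
apply: ler_wpM2l => //.
have hg := g_near st; have hAB := AB_le (supp_D hs) st.
have h1 : chi' s * g (t, s) <= chi' s * G s + `|chi' s| * (om + M * e).
  rewrite -lerBlDl -mulrBr; apply: le_trans (ler_norm _) _; rewrite normrM.
  by apply: ler_wpM2l.
have h2 : chi s * (A (t, s) + B (t, s)) <= chi s * (L' * (c s + (om + C * e))).
  by apply: ler_wpM2l.
apply: le_trans (lerD h1 h2) _.
have C0 : 0 <= C by have [_ _ /(_ 0) /C11_ge0] := HV.
have k1 : 0 <= `|chi' s| * (L' * (om + C * e)).
  by rewrite mulr_ge0// mulr_ge0// addr_ge0// mulr_ge0// ltW.
have k2 : 0 <= chi s * (om + M * e).
  by rewrite mulr_ge0// addr_ge0// mulr_ge0// ltW.
rewrite -subr_ge0 (_ : _ - _ = `|chi' s| * (L' * (om + C * e)) + chi s * (om + M * e)) ?addr_ge0//.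
rewrite /Y /err; ring.
Qed.

(** Each half is nonnegative after integration over the other time. Their sum is bounded pointwise
    by eta(s - t) times the function [Y] of s alone, from which t is integrated out. *)
Lemma doubled_ineq : 0 <= \int[leb]_s (D s * (chi' s * G s + chi s * (L' * c s))) +
  err * \int[leb]_s (D s * (`|chi' s| + chi s)).
Proof.
have [_ [Kc cK]] := bmchi.1; have [_ [Kc' cK']] := bmchi.2.
have supp' := derive1_supp schi supp.
have cchi := Sm_continuous (schi 0); have cchi' := Sm_continuous (smooth_derive1 schi 0).
have cnc' : continuous (fun s => `|chi' s|) by move=> x; exact: cvg_norm (cchi' x).
have c2 : continuous (fun s => chi' s * G s + chi s * (L' * c s)).
  move=> x; apply: cvgD; apply: cvgM; [exact: cchi'|exact: (L1_dist_continuous du dv cu cv)|exact: cchi|].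
  by apply: cvgM; [exact: cvg_cst|exact: cc].
have c3 : continuous (fun s => `|chi' s| + chi s) by move=> x; apply: cvgD; [exact: cnc'|exact: cchi].
have cY : continuous Y.
  move=> x; apply: cvgD; first exact: c2.
  by apply: cvgM; [exact: cvg_cst|exact: c3].
have sY s : ~~ (c0 <= s <= d) -> Y s = 0.
  by move=> hs; rewrite /Y (supp hs) (supp' _ hs) !mul0r normr0 !addr0 mulr0 addr0.
have [KY _ YK] := bounded_continuous_compact cY sY.
have mY : measurable_fun setT Y by exact: continuous_measurable_fun.
have [mX1 [K1 XK1]] := bmM bmchi.1 bmY1; have [mX2 [K2 XK2]] := bmX2.
have [meta [Ke Ke']] := bmeta.1.
have i1 := ig2_bounded_oo T mX1 XK1; have i2 := ig2_bounded_oo T mX2 XK2.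
have mYw : measurable_fun setT (fun w : mR * mR => Y w.2) by exact: (meas_comp mY msnd).
have mZ : measurable_fun setT (fun w : mR * mR => eta (w.2 - w.1) * Y w.2) by exact: measurable_funM.
have ZK w : `|eta (w.2 - w.1) * Y w.2| <= Ke * KY by rewrite normrM; apply: ler_pM.
have i3 := ig2_bounded_oo T mZ ZK.
have p1 : 0 <= \int[leb2]_w (D w.1 * (D w.2 * (chi w.2 * Y1 w))).
  by rewrite (Rfubini2 i1); apply: int_ge0 => s; exact: half_u.
have p2 : 0 <= \int[leb2]_w (D w.1 * (D w.2 * X2 w)).
  by rewrite (Rfubini1 i2); apply: int_ge0 => t; exact: half_v.
have p3 : \int[leb2]_w (D w.1 * (D w.2 * (eta (w.2 - w.1) * Y w.2))) = \int[leb]_s (D s * Y s).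
  rewrite (Rfubini2 i3); apply: eq_int => s /=.
  have [hs|/sY ->] := boolP (c0 <= s <= d); last first.
    by rewrite mulr0 -[RHS](@int0 _ _ _ leb); apply: eq_int => t; rewrite !mulr0.
  have igr := ig_refl s (ig_moll h0).
  rewrite -[RHS]mulr1 -(int_moll h0) -(int_refl s (ig_moll h0)) -(intZ _ igr).
  apply: eq_int => t.
  have [hst|/(moll_supp h0) ->] := boolP (0 <= s - t <= h); last by rewrite mul0r !mulr0.
  (* h < c0 places [s - h, s] inside ]0, T[, so the indicator in t does not cut the mollifier and
     its whole mass one is recovered. *)
  rewrite (_ : D t = 1); first by rewrite mul1r mulrCA mulrC -mulrA.
  rewrite indicE mem_setE in_itv /= (_ : 0 < t < T)//.
  have /andP[s0 sT] := supp_D hs; have /andP[a1 a2] := hst; have /andP[s1 s2] := hs.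
  have ts : t <= s by rewrite -subr_ge0.
  have sh : 0 < s - h by rewrite subr_gt0; exact: lt_le_trans hc s1.
  apply/andP; split; last exact: le_lt_trans ts sT.
  by apply: lt_le_trans sh _; rewrite lerBlDr -lerBlDl.
have p4 : \int[leb2]_w (D w.1 * (D w.2 * (chi w.2 * Y1 w))) + \int[leb2]_w (D w.1 * (D w.2 * X2 w)) <=
   \int[leb2]_w (D w.1 * (D w.2 * (eta (w.2 - w.1) * Y w.2))).
  rewrite -(intD i1 i2); apply: le_int; [exact: (igD i1 i2)|exact: i3|].
  by move=> [t s] /=; have := XY t s; rewrite (mulrCA (eta _)).
have s1 : (`]0, T[%classic : set R) `<=` `[0, T]%classic by apply: subset_itv; rewrite bnd_simp.
have i4 := ig_itv c2 s1; have i5 := ig_itv c3 s1.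
rewrite -(intZ _ i5) -(intD i4 (igZ err i5)).
rewrite (_ : \int[leb]_x _ = \int[leb]_s (D s * Y s)); last first.
  by apply: eq_int => s; rewrite /Y; ring.
by rewrite -p3; apply: le_trans p4; exact: addr_ge0.
Qed.

End doubled_test.

(** The doubled inequality with h and e tending to 0 says that G - L' P is weakly nonincreasing,
    after integrating by parts the term with c = P'. This is why c has to be continuous with a known
    primitive. *)
Lemma L1_stability t : 0 <= t <= T ->
  \int[leb]_x `|u t x - v t x| <= \int[leb]_x `|u 0 x - v 0 x| + L * (M + m) * (P t - P 0).
Proof.
move=> /andP[t0 tT]; have [_ _ HC] := HV.
have M0 : 0 <= M := translation_bound_ge0 (tbu 0).
have m0 : 0 <= m by have [_ du um] := Hu; apply: le_trans (um 0); exact: density_int_ge0.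
set L' := L * (M + m); have L'0 : 0 <= L' by rewrite mulr_ge0 ?(L_ge0 fL)// addr_ge0.
have C0 := C11_ge0 (HC 0).
pose G s := \int[leb]_x `|u s x - v s x|.
have [_ du _] := Hu; have [_ dv _] := Hv.
have cGG : continuous G by exact: L1_dist_continuous.
have cP := is_derive_continuous dP.
pose E s := G s - L' * P s.
have cE : continuous E.
  move=> x; apply: cvgB; first exact: cGG.
  by apply: cvgM; [exact: cvg_cst|exact: cP].
suff : E t <= E 0 by rewrite /E /G; move: (\int[leb]_x _) (\int[leb]_x _) => p q; lra.
apply: (weak_nonincreasing cE _ (lexx 0) t0 tT) => chi schi chi0 [c0 [d [c00 dT supp]]].
have cchi := Sm_continuous (schi 0); have cchi' := Sm_continuous (smooth_derive1 schi 0).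
have s1 : (`]0, T[%classic : set R) `<=` `[0, T]%classic by apply: subset_itv; rewrite bnd_simp.
set chi' := (chi^`())%classic.
have i1 : ig (fun s => D s * (chi' s * G s)).
  by apply: ig_itv s1 => x; exact: (cvgM (cchi' x) (cGG x)).
have i2 : ig (fun s => D s * (chi s * c s)).
  by apply: ig_itv s1 => x; exact: (cvgM (cchi x) (@cc x)).
have i3 : ig (fun s => D s * (chi' s * P s)).
  by apply: ig_itv s1 => x; exact: (cvgM (cchi' x) (cP x)).
have parts := int_test_parts T0 schi (ex_intro _ c0 (ex_intro _ d (conj dT supp))) dP cc.
rewrite (supp 0) ?mul0r ?oppr0 ?sub0r in parts; last by rewrite negb_and -ltNge c00.
have -> : \int[leb]_s (D s * (chi' s * E s)) = \int[leb]_s (D s * (chi' s * G s)) +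
    L' * \int[leb]_s (D s * (chi s * c s)).
  rewrite parts mulrN -(intZ _ i3) -(intB i1 (igZ _ i3)); apply: eq_int => s; rewrite /E; ring.
rewrite -(intZ _ i2) -(intD i1 (igZ _ i2)).
rewrite (_ : \int[leb]_x _ = \int[leb]_s (D s * (chi' s * G s + chi s * (L' * c s)))); last first.
  by apply: eq_int => s; ring.
set X := \int[leb]_s _.
pose I := \int[leb]_s (D s * (`|chi' s| + chi s)).
have I0 : 0 <= I by apply: int_ge0 => s; rewrite mulr_ge0 ?indicE ?addr_ge0.
apply/ler_addgt0Pr => /= err err0.
(* The coefficient of the error when the time modulus and the mollification scale are both [e],
   multiplied by I + 1 rather than I so that it cannot vanish; [e = err / Z] then keeps the total
   below [err]. *)
pose Z := (1 + M + L' * (1 + C)) * (I + 1).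
have I1 : 0 < I + 1 by rewrite ltr_wpDl.
have Q0 : 0 < 1 + M + L' * (1 + C).
  by rewrite -addrA ltr_pwDl// addr_ge0// mulr_ge0// addr_ge0.
have Z0 : 0 < Z by exact: mulr_gt0.
pose e := err / Z; have e0 : 0 < e by rewrite divr_gt0.
have [d1 d10 H1] := cu e0; have [d2 d20 H2] := cV e0.
pose h := Num.min (Num.min d1 d2) (c0 / 2).
have h0 : 0 < h by rewrite !lt_min d10 d20 divr_gt0.
have hc : h < c0.
  by rewrite /h gt_min; apply/orP; right; rewrite ltr_pdivrMr// ltr_pMr// ltr1n.
have hd1 : h <= d1 by rewrite /h !ge_min lexx.
have hd2 : h <= d2 by rewrite /h !ge_min lexx orbT.
have K1 s r : `|s - r| <= h -> \int[leb]_x `|u s x - u r x| <= e.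
  by move=> sr; apply: H1; exact: le_trans sr hd1.
have K2 s r x : `|s - r| <= h -> `|V r x - V s x| <= e /\ `|Vx r x - Vx s x| <= e.
  by move=> sr; apply: H2; exact: le_trans sr hd2.
have := @doubled_ineq chi c0 d h e schi chi0 h0 hc dT supp e0 e (ltW e0) K1 K2.
rewrite -/X -/I => /le_trans; apply; rewrite lerD2l.
have -> : (e + M * e + L' * (e + C * e)) * I = err * (I / (I + 1)).
  have aux (a q i : R) : 0 < q -> 0 < i + 1 -> a / (q * (i + 1)) * q * i = a * (i / (i + 1)).
    by move=> q0 i0; field; rewrite (gt_eqF q0) (gt_eqF i0).
  rewrite -(aux _ _ _ Q0 I1) -/Z -/e; congr (_ * _); ring.
by rewrite ler_piMr ?(ltW err0)// ler_pdivrMr ?ltr_wpDl// mul1r lerDl.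
Qed.

End time_doubling.

(** * Nonlocal velocities *)

Section finite_families.
Context {R : realType}.

Lemma bounded_setT (X : Type) (F : X -> R) : [bounded F x | x in setT] ->
  exists2 C : R, 0 <= C & forall x, `|F x| <= C.
Proof.
move=> [M [Mr HM]]; exists (`|M| + 1); first by rewrite addr_ge0.
by move=> x; apply: (HM (`|M| + 1)) => //; rewrite ltr_pwDr// ler_norm.
Qed.

(** The sum of finitely many nonnegative constants serves for every index, by monotonicity. All
    constants common to the components arise in this way. *)
Lemma uniform_bound n (P : 'I_n -> R -> Prop) :
  (forall j C D, C <= D -> P j C -> P j D) ->
  (forall j, exists2 C : R, 0 <= C & P j C) -> exists2 C : R, 0 <= C & forall j, P j C.
Proof.
move=> mono ex; have [F HF] := @choice _ _ (fun j C => 0 <= C /\ P j C) (fun j => let: ex_intro2 C a b := ex j in ex_intro _ C (conj a b)).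
exists (\sum_j F j); first by apply: sumr_ge0 => j _; have [] := HF j.
move=> j; have [_] := HF j; apply: mono; rewrite (bigD1 j)//= lerDl.
by apply: sumr_ge0 => i _; have [] := HF i.
Qed.

End finite_families.

(** * Uniform second-order bounds in several variables and the chain rule *)

Section vector_fields.
Context {R : realType} {n : nat}.
Implicit Types (a b h : 'rV[R]_n) (F : 'rV[R]_n -> R).
Local Notation "\D_ j F" := ('D_(delta_mx 0 j) F) (at level 0, j at level 0, F at level 0).

(** The l^1 norm is dual to a bound on each partial derivative, so no dimensional factor appears in
    [lip_norm1]. *)
Definition norm1 h : R := \sum_j `|h 0 j|.

Lemma norm1_ge0 h : 0 <= norm1 h.
Proof. by apply: sumr_ge0. Qed.

Lemma derive_sum F a h : differentiable F a -> 'D_h F a = \sum_j h 0 j * \D_j F a.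
Proof.
move=> dF; rewrite deriveE// {1}(row_sum_delta h) linear_sum; apply: eq_bigr => j _.
by rewrite linearZ /= -deriveE.
Qed.

Lemma is_derive_line F a h (r : R) : (forall x, differentiable F x) ->
  is_derive r 1 (fun r => F (a + r *: h)) (\sum_j h 0 j * \D_j F (a + r *: h)).
Proof.
move=> dF; rewrite -derive_sum//.
have E : (fun s : R => s^-1 *: (((fun r => F (a + r *: h)) \o shift r) (s *: 1) - F (a + r *: h))) =
   (fun s : R => s^-1 *: ((F \o shift (a + r *: h)) (s *: h) - F (a + r *: h))).
  apply/funext => s /=; congr (_ *: (F _ - _)).
  by rewrite -[s%:A]/(s * 1) mulr1 scalerDl addrCA.
apply: DeriveDef; last by rewrite /derive E.
by rewrite /derivable E; exact: diff_derivable.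
Qed.

Lemma directional_le F a h C : (forall j, `|\D_j F a| <= C) ->
  `|\sum_j h 0 j * \D_j F a| <= C * norm1 h.
Proof.
move=> HC; apply: le_trans (ler_norm_sum _ _ _) _; rewrite /norm1 mulr_sumr.
by apply: ler_sum => j _; rewrite normrM mulrC ler_wpM2r.
Qed.

Lemma lip_norm1 F C : (forall x, differentiable F x) -> (forall j a, `|\D_j F a| <= C) ->
  forall a b, `|F b - F a| <= C * norm1 (b - a).
Proof.
move=> dF HC a b.
have := lipschitz_of_derive (fun r => is_derive_line a (b - a) r dF)
  (fun r => directional_le (b - a) (HC^~ _)) 1 0.
by rewrite scale1r scale0r addr0 (addrC a) subrK subr0 normr1 mulr1.
Qed.

(** The analogue of [C11] for functions of a row vector, again with a quadratic Taylor remainder, so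
    that composition with [C11] functions yields a [C11] function. *)
Definition C2b (C : R) F := [/\ forall a, `|F a| <= C, forall j a, `|\D_j F a| <= C,
  forall a b, `|F b - F a| <= C * norm1 (b - a),
  forall j a b, `|\D_j F b - \D_j F a| <= C * norm1 (b - a) &
  forall a b, `|F b - F a - \sum_j (b - a) 0 j * \D_j F a| <= C * norm1 (b - a) ^+ 2].

Lemma W2oo_C2b F : Ck 2 F -> W2oo setT F -> exists2 C : R, 0 <= C & C2b C F.
Proof.
move=> [dF CF] [b0 b1 b2].
have [C0 C00 H0] := bounded_setT b0.
have [C1 C10 H1] : exists2 C : R, 0 <= C & forall j a, `|\D_j F a| <= C.
  apply: (@uniform_bound _ _ (fun j C => forall a, `|\D_j F a| <= C)) => [j C D CD H a|j].
    exact: le_trans (H a) CD.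
  exact: bounded_setT (b1 _).
have [C2 C20 H2] : exists2 C : R, 0 <= C & forall i j a, `|\D_i (\D_j F) a| <= C.
  apply: (@uniform_bound _ _ (fun i C => forall j a, `|\D_i (\D_j F) a| <= C)) => [i C D CD H j a|i].
    exact: le_trans (H j a) CD.
  apply: (@uniform_bound _ _ (fun j C => forall a, `|\D_i (\D_j F) a| <= C)) => [j C D CD H a|j].
    exact: le_trans (H a) CD.
  exact: bounded_setT (b2 _ _).
pose C := C0 + C1 + C2.
have le0 : C0 <= C by rewrite /C -addrA lerDl addr_ge0.
have le1 : C1 <= C by rewrite /C addrAC lerDr addr_ge0.
have le2 : C2 <= C by rewrite /C lerDr addr_ge0.
have dD j a : differentiable (\D_j F) a by have [+ _] := CF (delta_mx 0 j); apply.
have L1 a b : `|F b - F a| <= C1 * norm1 (b - a) by exact: lip_norm1.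
have L2 j a b : `|\D_j F b - \D_j F a| <= C2 * norm1 (b - a).
  exact: (lip_norm1 (dD j) (fun i c => H2 i j c)).
exists C; first by rewrite !addr_ge0.
split=> [a|j a|a b|j a b|a b].
- exact: le_trans (H0 a) le0.
- exact: le_trans (H1 j a) le1.
- by apply: le_trans (L1 a b) _; rewrite ler_wpM2r ?norm1_ge0.
- by apply: le_trans (L2 j a b) _; rewrite ler_wpM2r ?norm1_ge0.
set h := b - a.
have d1 (r : R) := is_derive_line a h r dF.
(* Along the segment the remainder equals the scalar product of [h] with the gradient at a + r h
   minus that at a, with 0 < r < 1. *)
have [r] := @MVT R _ _ 0 1 ltr01 (fun r _ => d1 r) (continuous_subspaceT (is_derive_continuous d1)).
rewrite in_itv/= => /andP[r0 r1].
rewrite scale1r scale0r addr0 subr0 mulr1 (addrC a) {1}/h subrK => ->.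
rewrite -sumrB; apply: le_trans (ler_norm_sum _ _ _) _.
apply: (@le_trans _ _ (\sum_j `|h 0 j| * (C * norm1 h))).
  apply: ler_sum => j _; rewrite -mulrBr normrM ler_wpM2l//.
  apply: le_trans (L2 _ _ _) _; rewrite addrAC subrr add0r.
  apply: ler_pM => //; first exact: norm1_ge0.
  rewrite /norm1; apply: ler_sum => i _; rewrite mxE normrM ler_piMl//.
  by rewrite ger0_norm ltW.
by rewrite -mulr_suml -/(norm1 h) mulrCA -expr2.
Qed.

Lemma C2b_ge0 C F : C2b C F -> 0 <= C.
Proof. by move=> [/(_ 0) H _ _ _ _]; exact: le_trans H. Qed.

Lemma C2b_le C D F : C <= D -> C2b C F -> C2b D F.
Proof.
move=> CD [h0 h1 h2 h3 h4].
have le x y : 0 <= y -> x <= C * y -> x <= D * y by move=> y0 /le_trans; apply; rewrite ler_wpM2r.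
split=> [a|j a|a b|j a b|a b]; [exact: le_trans (h0 a) CD|exact: le_trans (h1 j a) CD| | |].
- exact: le (norm1_ge0 _) (h2 a b).
- exact: le (norm1_ge0 _) (h3 j a b).
- exact: le (sqr_ge0 _) (h4 a b).
Qed.

Definition row_of (w : 'I_n -> R) : 'rV[R]_n := \row_j w j.

Definition chain_derive F (w w' : 'I_n -> R) : R := \sum_j w' j * \D_j F (row_of w).

Lemma norm1_row (q : R) (w z : 'I_n -> R) : (forall j, `|w j - z j| <= q) ->
  norm1 (row_of w - row_of z) <= n%:R * q.
Proof.
move=> H; apply: (@le_trans _ _ (\sum_(j < n) q)).
  by apply: ler_sum => j _; rewrite !mxE.
by rewrite sumr_const card_ord mulr_natl.
Qed.

Lemma chain_derive_near C F D q (w w' z z' : 'I_n -> R) : C2b C F ->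
  (forall j, `|w' j| <= D) -> (forall j, `|w j - z j| <= q) -> (forall j, `|w' j - z' j| <= q) ->
  `|chain_derive F w w' - chain_derive F z z'| <= C * (n%:R * q) * (1 + n%:R * D).
Proof.
move=> HF HD H0 H1; have C0 := C2b_ge0 HF; have [_ b1 _ b2 _] := HF.
rewrite -sumrB; apply: le_trans (ler_norm_sum _ _ _) _.
apply: (@le_trans _ _ (\sum_(j < n) (D * (C * (n%:R * q)) + q * C))).
  apply: ler_sum => j _.
  rewrite (_ : _ - _ = w' j * (\D_j F (row_of w) - \D_j F (row_of z)) + (w' j - z' j) * \D_j F (row_of z)); last by ring.
  apply: le_trans (ler_normD _ _) _; rewrite !normrM; apply: lerD.
    apply: ler_pM => //; apply: le_trans (b2 _ _ _) _.
    by apply: ler_wpM2l => //; exact: norm1_row.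
  by apply: ler_pM.
by rewrite sumr_const card_ord -mulr_natl le_eqVlt; apply/orP; left; apply/eqP; ring.
Qed.

(** The square dominates each of 1, n D and n D (1 + n D), the factors that appear in the bounds of
    the value, of the first derivative, and of the derivative increment and Taylor remainder. *)
Lemma C11_chain C F D (w w' : 'I_n -> R -> R) : C2b C F -> 0 <= D -> (forall j, C11 D (w j) (w' j)) ->
  C11 (C * (1 + n%:R * D) ^+ 2) (fun x => F (row_of (w^~ x))) (fun x => chain_derive F (w^~ x) (w'^~ x)).
Proof.
move=> HF D0 Hw x; have C0 := C2b_ge0 HF; have [b0 b1 b2 b3 b4] := HF.
have nD : 0 <= n%:R * D by exact: mulr_ge0.
have one : 1 <= 1 + n%:R * D by rewrite lerDl.
have sq1 : 1 <= (1 + n%:R * D) ^+ 2 by rewrite expr_ge1// addr_ge0.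
have sq2 : n%:R * D <= (1 + n%:R * D) ^+ 2.
  by rewrite -subr_ge0 (_ : _ - _ = 1 + n%:R * D + (n%:R * D) ^+ 2) ?addr_ge0 ?sqr_ge0//; ring.
have sq3 : n%:R * D * (1 + n%:R * D) <= (1 + n%:R * D) ^+ 2.
  by rewrite expr2 ler_wpM2r ?addr_ge0// lerDr.
have d1 (h : R) j : `|w j (x + h) - w j x| <= D * `|h| by have [_ _ /(_ h) []] := Hw j x.
have d2 (h : R) j : `|w' j (x + h) - w' j x| <= D * `|h| by have [_ _ /(_ h) []] := Hw j x.
have d3 j y : `|w' j y| <= D by have [] := Hw j y.
have nh (h : R) : norm1 (row_of (w^~ (x + h)) - row_of (w^~ x)) <= n%:R * D * `|h|.
  by rewrite -mulrA; apply: norm1_row => j; exact: d1.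
split.
- by apply: le_trans (b0 _) _; rewrite ler_peMr.
- apply: (@le_trans _ _ (C * (n%:R * D))); last by rewrite ler_wpM2l.
  apply: le_trans (ler_norm_sum _ _ _) _; apply: (@le_trans _ _ (\sum_(j < n) D * C)).
    by apply: ler_sum => j _; rewrite normrM; exact: ler_pM.
  by rewrite sumr_const card_ord -mulr_natl le_eqVlt; apply/orP; left; apply/eqP; ring.
move=> h; split.
- apply: le_trans (b2 _ _) _; rewrite -mulrA; apply: ler_wpM2l => //.
  by apply: le_trans (nh h) _; rewrite ler_wpM2r.
- have := chain_derive_near HF (d3^~ (x + h)) (d1 h) (d2 h).
  move=> /le_trans; apply.
  rewrite (_ : C * _ * _ = C * (n%:R * D * (1 + n%:R * D)) * `|h|); last by ring.
  by apply: ler_wpM2r => //; apply: ler_wpM2l.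
have E : F (row_of (w^~ (x + h))) - F (row_of (w^~ x)) - h * chain_derive F (w^~ x) (w'^~ x) =
  (F (row_of (w^~ (x + h))) - F (row_of (w^~ x)) -
    \sum_j (row_of (w^~ (x + h)) - row_of (w^~ x)) 0 j * \D_j F (row_of (w^~ x))) +
  \sum_j (w j (x + h) - w j x - h * w' j x) * \D_j F (row_of (w^~ x)).
  have -> : \sum_j (w j (x + h) - w j x - h * w' j x) * \D_j F (row_of (w^~ x)) =
      \sum_j (row_of (w^~ (x + h)) - row_of (w^~ x)) 0 j * \D_j F (row_of (w^~ x)) -
      h * chain_derive F (w^~ x) (w'^~ x).
    by rewrite /chain_derive mulr_sumr -sumrB; apply: eq_bigr => j _; rewrite !mxE; ring.
  by rewrite addrA subrK.
rewrite E; apply: le_trans (ler_normD _ _) _.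
apply: (@le_trans _ _ (C * (n%:R * D * `|h|) ^+ 2 + \sum_(j < n) (D * h ^+ 2 * C))).
  apply: lerD.
    apply: le_trans (b4 _ _) _; rewrite ler_wpM2l// ler_pXn2r// ?nnegrE ?norm1_ge0// mulr_ge0//.
  apply: le_trans (ler_norm_sum _ _ _) _; apply: ler_sum => j _.
  by rewrite normrM; apply: ler_pM => //; have [_ _ /(_ h) []] := Hw j x.
rewrite sumr_const card_ord exprMn real_normK ?num_real// -[X in _ + X <= _]mulr_natl.
rewrite (_ : _ + _ = C * (n%:R * D * (1 + n%:R * D)) * h ^+ 2); last by ring.
by rewrite ler_wpM2r ?sqr_ge0// ler_wpM2l.
Qed.

(* [F o g < y] is the union over rational [q] of [C |g - q|_1 < y - F q]. *)
Lemma measurable_lip_row d (S : measurableType d) F C (g : 'I_n -> S -> R) : 0 < C ->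
  (forall a b, `|F b - F a| <= C * norm1 (b - a)) -> (forall j, measurable_fun setT (g j)) ->
  measurable_fun setT (fun s => F (row_of (g^~ s))).
Proof.
move=> C0 HF mg.
pose Q (q : {ffun 'I_n -> rat}) : 'rV[R]_n := row_of (fun j => ratr (q j)).
have mN q : measurable_fun setT (fun s => norm1 (row_of (g^~ s) - Q q)).
  rewrite /norm1; apply: measurable_sum => j; apply: measurableT_comp => //.
  under eq_fun do rewrite !mxE.
  by apply: measurable_funB => //; exact: mg.
apply: (measurability _ (RGenInftyO.measurableE R)) => _ [_ [y ->] <-].
rewrite setTI (_ : _ @^-1` _ =
    \bigcup_q [set s | norm1 (row_of (g^~ s) - Q q) < (y - F (Q q)) / C]); last first.
  apply/seteqP; split=> s /=; rewrite in_itv/=.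
    (* With every coordinate of [q] within [e] of [g], both C |g - q|_1 and |F g - F q| are at most
       C n e. The choice makes 2 C n e smaller than y - F g by 2 C e, the [+ 1] also covering n =
       0. *)
    move=> Fy; pose e := (y - F (row_of (g^~ s))) / (C * (2 * (n%:R + 1))).
    have n0 : 0 < n%:R + 1 :> R by rewrite ltr_wpDl.
    have e0 : 0 < e by rewrite divr_gt0 ?subr_gt0// !mulr_gt0.
    have ex j : exists q : rat, `|g j s - ratr q| <= e.
      have [|q] := @rat_in_itvoo R (g j s - e) (g j s + e); first by rewrite ltrD2l gt0_cp.
      rewrite in_itv/= => /andP[q1 q2]; exists q.
      by rewrite ler_norml; apply/andP; split; lra.
    have [q Hq] := choice ex.
    exists [ffun j => q j] => //=; rewrite ltr_pdivlMr//.
    have h1 : norm1 (row_of (g^~ s) - Q [ffun j => q j]) <= n%:R * e.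
      by apply: norm1_row => j; rewrite ffunE.
    have := HF (Q [ffun j => q j]) (row_of (g^~ s)); rewrite ler_norml => /andP[h2 _].
    have h3 : C * norm1 (row_of (g^~ s) - Q [ffun j => q j]) <= C * (n%:R * e) by exact: ler_wpM2l (ltW C0) _ _ h1.
    have h4 : 2 * (C * (n%:R * e)) + 2 * (C * e) = y - F (row_of (g^~ s)).
      by rewrite /e; field; rewrite (gt_eqF n0) (gt_eqF C0).
    have h5 : 0 < C * e by exact: mulr_gt0.
    rewrite (mulrC _ C); move: h2 h3 h4 h5; move: (C * norm1 _) (C * (n%:R * e)) (C * e) (F _) (F _) => *; lra.
  move=> [q _ /=]; rewrite ltr_pdivlMr// => H.
  have := HF (Q q) (row_of (g^~ s)); rewrite ler_norml => /andP[_ h].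
  by rewrite -(subrK (F (Q q)) (F _)) -ltrBrDr; apply: le_lt_trans h _; rewrite mulrC.
apply: countable_bigcupT_measurable; first exact: countableP.
move=> q; rewrite (_ : [set s | _] = setT `&` (fun s => norm1 (row_of (g^~ s) - Q q)) @^-1` `]-oo, ((y - F (Q q)) / C)[).
  exact: mN q measurableT _ (measurable_itv _).
by rewrite setTI; apply/seteqP; split=> s /=; rewrite in_itv.
Qed.

End vector_fields.

(** * Velocities averaged in space and in time *)

Section averaged_velocities.
Context {R : realType}.
Local Notation leb := (@lebesgue_measure R).
Local Notation mR := (measurableTypeR R).
Local Notation ig f := (integrable_real leb f).

Lemma ig_weight (D : R) (k a : R -> R) : ig k -> measurable_fun setT a -> (forall x, `|a x| <= D) ->
  ig (fun x => k x * a x).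
Proof.
move=> igk ma aD; apply: ig_le (igZ D (ig_abs igk)).
  by apply: measurable_funM => //; exact: (ig_meas igk).
by move=> x; rewrite normrM mulrC ler_wpM2r.
Qed.

Lemma weight_le (m D : R) (k a : R -> R) : ig k -> (forall x, 0 <= k x) -> \int[leb]_x k x <= m ->
  measurable_fun setT a -> (forall x, `|a x| <= D) -> `|\int[leb]_x (k x * a x)| <= D * m.
Proof.
move=> igk k0 km ma aD; have i := ig_weight igk ma aD; have D0 : 0 <= D by exact: le_trans (aD 0).
apply: (@le_trans _ _ (\int[leb]_x (D * k x))); last by rewrite intZ// ler_wpM2l.
apply: abs_int_le; [exact: ig_meas i| |exact: igZ].
by move=> x; rewrite normrM (ger0_norm (k0 x)) mulrC ler_wpM2r.
Qed.

(** Each defining inequality of [C11] is linear in the pair and uniform in [s], so it survives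
    integration against a nonnegative weight. Used with the density as weight in space and the
    memory kernel as weight in time. *)
Lemma C11_average (m D : R) (k : R -> R) (w w' : R -> R -> R) : ig k -> (forall x, 0 <= k x) ->
  \int[leb]_x k x <= m -> (forall s, C11 D (w s) (w' s)) ->
  (forall x, measurable_fun setT (w^~ x)) -> (forall x, measurable_fun setT (w'^~ x)) ->
  C11 (D * m) (fun x => \int[leb]_s (k s * w s x)) (fun x => \int[leb]_s (k s * w' s x)).
Proof.
move=> igk k0 km Hw mw mw' x.
have wD y s : `|w s y| <= D by have [] := Hw s y.
have w'D y s : `|w' s y| <= D by have [] := Hw s y.
have i y := ig_weight igk (mw y) (wD y); have i' y := ig_weight igk (mw' y) (w'D y).
have lem (p q a : R -> R) (B : R) : ig (fun s => k s * p s) -> ig (fun s => k s * q s) -> measurable_fun setT a ->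
    (forall s, p s - q s = a s) -> (forall s, `|a s| <= B) ->
    `|\int[leb]_s (k s * p s) - \int[leb]_s (k s * q s)| <= B * m.
  move=> ip iq ma E aB; rewrite -(intB ip iq).
  have -> : \int[leb]_s (k s * p s - k s * q s) = \int[leb]_s (k s * a s).
    by apply: eq_int => s; rewrite -E mulrBr.
  exact: weight_le.
split; [exact: weight_le|exact: weight_le|] => h.
have [h1 h2] : (forall s, `|w s (x + h) - w s x| <= D * `|h|) /\ (forall s, `|w' s (x + h) - w' s x| <= D * `|h|).
  by split=> s; have [_ _ /(_ h) []] := Hw s x.
have h3 s : `|w s (x + h) - w s x - h * w' s x| <= D * h ^+ 2 by have [_ _ /(_ h) []] := Hw s x.
have mB : measurable_fun setT (fun s => w s (x + h) - w s x) by apply: measurable_funB; exact: mw.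
split.
- by rewrite mulrAC; apply: (lem _ _ (fun s => w s (x + h) - w s x)).
- rewrite mulrAC; apply: (lem _ _ (fun s => w' s (x + h) - w' s x)) => //.
  by apply: measurable_funB; exact: mw'.
have mh : measurable_fun setT (fun s => h * w' s x) by apply: measurable_funM => //; exact: mw'.
have ih : ig (fun s => k s * (h * w' s x)).
  by have := igZ h (i' x); apply: eq_integrable => // s _ /=; rewrite mulrCA.
have iB : ig (fun s => k s * (w s (x + h) - w s x)).
  by have := igB (i (x + h)) (i x); apply: eq_integrable => // s _ /=; rewrite mulrBr.
rewrite -(intB (i _) (i _)) -(intZ _ (i' x)) mulrAC.
rewrite (_ : \int[leb]_s (k s * w s (x + h) - k s * w s x) = \int[leb]_s (k s * (w s (x + h) - w s x))); last first.
  by apply: eq_int => s; rewrite mulrBr.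
rewrite (_ : \int[leb]_s (h * (k s * w' s x)) = \int[leb]_s (k s * (h * w' s x))); last first.
  by apply: eq_int => s; rewrite mulrCA.
apply: (lem _ _ (fun s => w s (x + h) - w s x - h * w' s x)) => //.
exact: measurable_funB.
Qed.

Definition convol (mu z : R -> R) (x : R) := \int[leb]_xi (z xi * mu (x - xi)).

Lemma measurable_sub_r (F : R -> R) (x : R) : measurable_fun setT F -> measurable_fun setT (fun y : R => F (x - y)).
Proof. by move=> mF; apply: (meas_comp mF); exact: measurable_funB. Qed.

Lemma C11_conv (m C : R) (mu mu' z : R -> R) : C11 C mu mu' -> density z -> \int[leb]_x z x <= m ->
  C11 (C * m) (convol mu z) (convol mu' z).
Proof.
move=> Hmu dz zm; have [mmu mmu'] := C11_measurable Hmu.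
apply: (C11_average (w := fun xi x => mu (x - xi)) (w' := fun xi x => mu' (x - xi))) => //.
- by case: dz.
- by move=> x; exact: density_ge0.
- by move=> xi; exact: C11_shift.
- by move=> x; exact: measurable_sub_r.
- by move=> x; exact: measurable_sub_r.
Qed.

Lemma conv_dist (C : R) (k z z' : R -> R) (x : R) : measurable_fun setT k -> (forall y, `|k y| <= C) ->
  density z -> density z' -> `|convol k z x - convol k z' x| <= C * \int[leb]_y `|z y - z' y|.
Proof.
move=> mk kC [z01 igz] [z01' igz']; have mks := measurable_sub_r x mk.
have i := ig_weight igz mks (fun y => kC _); have i' := ig_weight igz' mks (fun y => kC _).
have igd := ig_abs (igB igz igz').
apply: le_trans (abs_intB_le i i') _; rewrite -intZ//.
apply: le_int; [exact: ig_abs (igB i i')|exact: igZ|].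
by move=> y; rewrite -mulrBl normrM mulrC ler_wpM2r.
Qed.

Lemma measurable_conv (m : R) (k : R -> R) (u : R -> R -> R) : bounded_field m u -> measurable_fun setT k ->
  measurable_fun setT (fun p : mR * mR => convol k (u p.1) p.2).
Proof.
move=> [mu _ _] mk.
apply: (@meas_param1 _ _ (mR * mR)%type mR R leb (fun q => u q.1.1 q.2 * k (q.1.2 - q.2))).
have m11 : measurable_fun setT (fun q : (mR * mR) * mR => q.1.1 : R) by exact: (measurableT_comp (@meas_fst _ _ _) measurable_fst).
have m12 : measurable_fun setT (fun q : (mR * mR) * mR => q.1.2 : R) by exact: (measurableT_comp (@meas_snd _ _ _) measurable_fst).
have m2 : measurable_fun setT (fun q : (mR * mR) * mR => q.2 : R) by exact: meas_snd.
apply: measurable_funM; first exact: (meas_comp2 mu).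
by apply: (meas_comp mk); exact: measurable_funB.
Qed.

Lemma velocity_conv (m C : R) (mu mu' : R -> R) (u : R -> R -> R) : C11 C mu mu' -> bounded_field m u ->
  velocity (C * m) (fun t => convol mu (u t)) (fun t => convol mu' (u t)).
Proof.
move=> Hmu Hu; have [mmu mmu'] := C11_measurable Hmu.
split; [exact: measurable_conv Hu mmu|exact: measurable_conv Hu mmu'|].
by move=> t; have [_ du um] := Hu; exact: C11_conv.
Qed.

(** The mass is at most one, not one: before time [delta] the memory kernel is truncated at the
    initial time. *)
Definition subkernel (kappa : R -> R -> R) :=
  [/\ measurable_fun setT (fun p : mR * mR => kappa p.1 p.2), forall t, ig (kappa t),
      forall t s, 0 <= kappa t s & forall t, \int[leb]_s kappa t s <= 1].

Lemma velocity_memory (D : R) (kappa w w' : R -> R -> R) : subkernel kappa -> velocity D w w' ->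
  velocity D (fun t x => \int[leb]_s (kappa t s * w s x)) (fun t x => \int[leb]_s (kappa t s * w' s x)).
Proof.
move=> [mk ik k0 k1] [mw mw' Hw].
have mem (a : R -> R -> R) : measurable_fun setT (fun p : mR * mR => a p.1 p.2) ->
    measurable_fun setT (fun p : mR * mR => \int[leb]_s (kappa p.1 s * a s p.2)).
  move=> ma; apply: (@meas_param1 _ _ (mR * mR)%type mR R leb (fun q => kappa q.1.1 q.2 * a q.2 q.1.2)).
  have m11 : measurable_fun setT (fun q : (mR * mR) * mR => q.1.1 : R) by exact: (measurableT_comp (@meas_fst _ _ _) measurable_fst).
  have m12 : measurable_fun setT (fun q : (mR * mR) * mR => q.1.2 : R) by exact: (measurableT_comp (@meas_snd _ _ _) measurable_fst).
  have m2 : measurable_fun setT (fun q : (mR * mR) * mR => q.2 : R) by exact: meas_snd.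
  by apply: measurable_funM; [exact: (meas_comp2 mk)|exact: (meas_comp2 ma)].
split; [exact: mem|exact: mem|] => t.
rewrite -[D]mulr1; apply: C11_average => //.
- by move=> x; exact: (meas_comp2 mw).
- by move=> x; exact: (meas_comp2 mw').
Qed.

Lemma velocity_chain n (C D : R) (F : 'rV[R]_n -> R) (w w' : 'I_n -> R -> R -> R) : C2b C F -> 0 <= D ->
  (forall j, velocity D (w j) (w' j)) ->
  velocity (C * (1 + n%:R * D) ^+ 2) (fun t x => F (row_of (fun j => w j t x)))
    (fun t x => chain_derive F (fun j => w j t x) (fun j => w' j t x)).
Proof.
move=> HF D0 Hw; have C0 := C2b_ge0 HF; have [_ _ b2 b3 _] := HF.
have C1 : 0 < C + 1 by rewrite ltr_wpDl.
have mw j : measurable_fun setT (fun p : mR * mR => w j p.1 p.2) by have [] := Hw j.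
have mw' j : measurable_fun setT (fun p : mR * mR => w' j p.1 p.2) by have [] := Hw j.
split.
- apply: (measurable_lip_row C1 (g := fun j (p : mR * mR) => w j p.1 p.2)) => // a b.
  by apply: le_trans (b2 a b) _; rewrite ler_wpM2r ?norm1_ge0// lerDl.
- apply: measurable_sum => j; apply: measurable_funM => //.
  have L3 a b : `|'D_(delta_mx 0 j) F b - 'D_(delta_mx 0 j) F a| <= (C + 1) * norm1 (b - a).
    by apply: le_trans (b3 j a b) _; rewrite ler_wpM2r ?norm1_ge0// lerDl.
  exact: (measurable_lip_row C1 (g := fun j (p : mR * mR) => w j p.1 p.2) L3 mw).
by move=> t; apply: C11_chain => // j; have [_ _ ] := Hw j.
Qed.

Lemma C11_of_W2oo (mu : R -> R) : Ck 2 mu -> W2oo setT mu -> exists2 C : R, 0 <= C & C11 C mu ('D_1 mu).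
Proof.
move=> [dmu Cmu] [b0 b1 b2].
have [C0 C00 H0] := bounded_setT b0; have [C1 C10 H1] := bounded_setT (b1 1).
have [C2 C20 H2] := bounded_setT (b2 1 1).
have [dmu' _] := Cmu 1.
have der (F : R -> R) : (forall x, differentiable F x) -> forall x : R, is_derive x 1 F ('D_1 F x).
  by move=> dF x; apply: DeriveDef => //; exact: diff_derivable.
exists (C0 + C1 + C2); first by rewrite !addr_ge0.
apply: (C11_of_derive (der _ dmu) (der _ dmu')) => x.
- by apply: le_trans (H0 x) _; rewrite -addrA lerDl addr_ge0.
- by apply: le_trans (H1 x) _; rewrite addrAC lerDr addr_ge0.
- by apply: le_trans (H2 x) _; rewrite lerDr addr_ge0.
Qed.

End averaged_velocities.

(** * From entropy solutions to Kruzhkov inequalities *)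

Section clamped_representative.
Context {R : realType}.
Local Notation leb := (@lebesgue_measure R).
Local Notation leb2 := (leb \x leb)%E.
Local Notation mR := (measurableTypeR R).
Local Notation ig f := (integrable_real leb f).

Lemma ae_imply (P Q : R -> Prop) : {ae leb, forall x, P x} -> (forall x, P x -> Q x) ->
  {ae leb, forall x, Q x}.
Proof. by move=> aeP PQ; apply: negligibleS aeP => x /=; apply: contra_not; exact: PQ. Qed.

Lemma ae_imply2 (P P' Q : R -> Prop) : {ae leb, forall x, P x} -> {ae leb, forall x, P' x} ->
  (forall x, P x -> P' x -> Q x) -> {ae leb, forall x, Q x}.
Proof.
move=> aeP aeP' PQ; apply: negligibleS (negligibleU aeP aeP') => x /= nQ.
by have [p|] := pselect (P x); [right=> p'; exact: nQ (PQ _ p p')|left].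
Qed.

Lemma L1_01_ig (z : R -> R) : L1_01 z -> ig z.
Proof. by case. Qed.

Definition clip01 (z : R -> R) (x : R) := clip 0 1 (z x).

Lemma clip01_density z : ig z -> density (clip01 z).
Proof.
move=> igz; split=> [x|]; first by apply: clip_itv; exact: ler01.
apply: ig_le (ig_abs igz).
  by apply: (meas_comp _ (ig_meas igz)); apply: continuous_measurable_fun; apply: clip_continuous; exact: ler01.
move=> x; have := @clip_lip R 0 1 (z x) 0 ler01.
by rewrite (@clip_id R 0 1 0) ?lexx ?ler01// !subr0.
Qed.

Lemma clip01_ae z : L1_01 z -> {ae leb, forall x, z x = clip01 z x}.
Proof. by move=> [_ h]; apply: ae_imply h _ => x h; rewrite /clip01 clip_id. Qed.

Lemma TV_ae (z z' : R -> R) : measurable_fun setT z -> measurable_fun setT z' ->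
  {ae leb, forall x, z x = z' x} -> TV z = TV z'.
Proof.
move=> mz mz' E; rewrite /TV; congr ereal_sup; apply: eq_imagel => phi /= [[dphi cphi'] _ _].
congr (_%:E); have mphi' : measurable_fun setT (phi^`())%classic.
  apply: continuous_measurable_fun; rewrite (_ : _^`()%classic = 'D_1 phi); first exact: cphi'.
  by apply/funext => x; rewrite derive1E.
apply: ae_eq_int; [exact: measurable_funM..|].
by apply: ae_imply E _ => x ->.
Qed.

Lemma Lnorm1_int (z : R -> R) : ig z -> 'N[leb]_1[EFin \o z]%E = (\int[leb]_x `|z x|)%:E.
Proof. by move=> igz; rewrite Lnorm1 -(int_EFin (ig_abs igz)). Qed.

Lemma ae_int_dist (a b a' b' : R -> R) : ig a -> ig b -> ig a' -> ig b' ->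
  {ae leb, forall x, a x = a' x} -> {ae leb, forall x, b x = b' x} ->
  \int[leb]_x `|a x - b x| = \int[leb]_x `|a' x - b' x|.
Proof.
move=> ia ib ia' ib' ea eb; apply: ae_eq_int.
- exact: (ig_meas (ig_abs (igB ia ib))).
- exact: (ig_meas (ig_abs (igB ia' ib'))).
by apply: ae_imply2 ea eb _ => x -> ->.
Qed.

Lemma L1_triangle (a b c : R -> R) : ig a -> ig b -> ig c ->
  \int[leb]_x `|a x - c x| <= \int[leb]_x `|a x - b x| + \int[leb]_x `|b x - c x|.
Proof.
move=> ia ib ic; have i1 := ig_abs (igB ia ib); have i2 := ig_abs (igB ib ic).
rewrite -(intD i1 i2); apply: le_int; [exact: (ig_abs (igB ia ic))|exact: igD|].
by move=> x; exact: ler_distD.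
Qed.

Lemma L1_distC (a b : R -> R) : \int[leb]_x `|a x - b x| = \int[leb]_x `|b x - a x|.
Proof. by apply: eq_int => x; rewrite distrC. Qed.

(** A nondegenerate interval is not negligible. It locates, close to any time, one at which the
    total variation bound really holds. *)
Lemma ae_near (P : R -> Prop) (a b : R) : {ae leb, forall t : R, P t} -> a < b ->
  exists2 s : R, a <= s <= b & P s.
Proof.
move=> aeP ab; apply: contrapT => H.
have neg : leb.-negligible (`[a, b]%classic : set R).
  apply: negligibleS aeP => s; rewrite /= in_itv /= => sab /= Ps; apply: H; exists s => //.
have := @measure_negligible _ _ _ leb _ (measurable_itv _) neg.
move=> E0; have := @lebesgue_measure_itv R `[a, b]; rewrite /= lte_fin ab -EFinD => E.
by have [/eqP] := etrans (esym E) E0; rewrite subr_eq0 gt_eqF.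
Qed.

Variables (T : R) (U : R -> R -> R).
Hypotheses (T0 : 0 < T) (HU : solution_space T U).

(* A jointly measurable representative with values in [0, 1] everywhere, frozen
   in time outside [0, T]. *)
Definition clamp (t x : R) := clip01 (U (clip 0 T t)) x.

Let T0' : 0 <= T. Proof. exact: ltW. Qed.

Lemma clip_in t : clip 0 T t \in `[0, T].
Proof. by rewrite in_itv/=; exact: clip_itv. Qed.

Lemma clamp_clip t : clamp (clip 0 T t) = clamp t.
Proof. by rewrite /clamp [clip 0 T (clip 0 T t)]clip_id//; exact: clip_itv. Qed.

Let L101 t : L1_01 (U (clip 0 T t)).
Proof. by have [_ h _ _] := HU; apply: h; exact: clip_in. Qed.

Lemma clamp_density t : density (clamp t).
Proof. exact: clip01_density (L1_01_ig (L101 t)). Qed.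

Lemma clamp_ae t : 0 <= t <= T -> {ae leb, forall x, U t x = clamp t x}.
Proof. by move=> h; have := clip01_ae (L101 t); rewrite /clamp clip_id. Qed.

Lemma solution_ig t : 0 <= t <= T -> ig (U t).
Proof. by move=> h; have := L1_01_ig (L101 t); rewrite clip_id. Qed.

Lemma measurable_unclamped : measurable_fun setT (fun p : mR * mR => U (clip 0 T p.1) p.2).
Proof.
have [mU _ _ _] := HU.
have mc : measurable_fun setT (clip 0 T) by apply: continuous_measurable_fun; exact: clip_continuous.
have mp : measurable_fun setT (fun p : mR * mR => (clip 0 T p.1 : mR, p.2 : mR)).
  apply: measurable_fun_pair; last exact: meas_snd.
  by apply: (meas_comp mc); exact: meas_fst.
apply: (measurable_comp _ _ mU mp).
- by apply: measurableX => //; exact: measurable_itv.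
- by move=> _ [p _ <-]; split => //=; exact: clip_in.
Qed.

Lemma measurable_clamp : measurable_fun setT (fun p : mR * mR => clamp p.1 p.2).
Proof.
have mc : measurable_fun setT (@clip R 0 1).
  by apply: continuous_measurable_fun; apply: clip_continuous; exact: ler01.
exact: (meas_comp mc measurable_unclamped).
Qed.

Lemma clamp_continuous_at t (e : R) : 0 <= t <= T -> 0 < e -> exists2 d : R, 0 < d &
  forall s, 0 <= s <= T -> `|s - t| < d -> \int[leb]_x `|clamp s x - clamp t x| < e.
Proof.
move=> t0T e0; have [_ _ cU _] := HU.
have tin : t \in `[0, T] by rewrite in_itv.
have := cU t tin [set y | (y < e%:E)%E].
have nb : nbhs (0 : \bar R) [set y | (y < e%:E)%E].
  by apply: open_nbhs_nbhs; split; [exact: open_ereal_lt_ereal|rewrite /= lte_fin].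
move=> /(_ nb) /nbhs_ballP [d d0 H]; exists d => // s s0T sd.
have sin : s \in `[0, T] by rewrite in_itv.
have := H s _ sin; rewrite /= Lnorm1_int; last first.
  by apply: igB; exact: solution_ig.
move=> /(_ _); rewrite lte_fin (ae_int_dist (a' := clamp s) (b' := clamp t)).
- by apply; rewrite /ball /= distrC.
- exact: solution_ig.
- exact: solution_ig.
- by have [] := clamp_density s.
- by have [] := clamp_density t.
- exact: clamp_ae.
- exact: clamp_ae.
Qed.

(** Heine's argument: [solution_space] gives continuity at each time of [0, T], compactness makes it
    uniform, and freezing in time extends it to all real times because [clip] is 1-Lipschitz. *)
Lemma clamp_L1_continuous : uniformly_L1_continuous clamp.
Proof.
have igc t : ig (clamp t) by have [] := clamp_density t.
suff H e : 0 < e -> exists2 d : R, 0 < d & forall s t, 0 <= s <= T -> 0 <= t <= T -> `|s - t| <= d ->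
    \int[leb]_x `|clamp s x - clamp t x| <= e.
  move=> e /H[d d0 Hd]; exists d => // s t st.
  rewrite -(clamp_clip s) -(clamp_clip t); apply: Hd; [exact: clip_itv|exact: clip_itv|].
  exact: le_trans (clip_lip _ _ T0') st.
move=> e0; have e2 : 0 < e / 2 by rewrite divr_gt0.
pose P (d t : R) := forall s, 0 <= s <= T -> 0 <= t <= T -> `|s - t| <= d ->
   \int[leb]_x `|clamp s x - clamp t x| <= e.
have /compact_near_coveringP := @segment_compact R 0 T.
move=> /(_ R 0^'+ P _)[].
  move=> t; rewrite /= in_itv/= => tT; have [d d0 Hd] := clamp_continuous_at tT e2.
  have d2 : 0 < d / 2 by rewrite divr_gt0.
  exists (ball t (d / 2), [set r : R | r < d / 2]).
    split => /=; first exact: nbhsx_ballx.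
    exact: nbhs_right_lt.
  move=> [t' r] [/= tt' rd] s sT t'T st'.
  apply: le_trans (L1_triangle (igc s) (igc t) (igc t')) _.
  rewrite (splitr e); apply: lerD; last rewrite L1_distC; apply: ltW; apply: Hd => //.
    move: tt'; rewrite /ball /= distrC => tt'.
    rewrite (splitr d) -(subrKA t'); apply: le_lt_trans (ler_normD _ _) _.
    by apply: ltrD => //; exact: le_lt_trans st' rd.
  move: tt'; rewrite /ball /= distrC => /lt_le_trans; apply.
  by rewrite ler_pdivrMr// ler_pMr// ler1n.
move=> d /= d0 H; exists (d / 2); first by rewrite divr_gt0.
have dd : 0 < d / 2 by rewrite divr_gt0.
move=> s t sT tT st; apply: (H (d / 2)) => //=.
by rewrite sub0r normrN gtr0_norm// ltr_pdivrMr// ltr_pMr// ltr1n.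
Qed.

(** The mass is the L^1 distance to the zero field, a continuous function of time, which has a
    maximum on [0, T]. *)
Lemma clamp_mass : exists m : R, bounded_field m clamp.
Proof.
have cG := @L1_dist_continuous R clamp (fun _ _ => 0) clamp_density.
have d0 (t : R) : density ((fun _ _ => 0) t : R -> R).
  by split=> [x|]; [rewrite lexx ler01|exact: ig0].
have u0 : uniformly_L1_continuous (fun _ _ => 0 : R).
  by move=> e e0; exists 1 => // s t _; rewrite (@eq_int _ _ _ leb _ (fun=> 0)) ?int0 ?ltW// => x; rewrite subrr normr0.
have {}cG := cG d0 clamp_L1_continuous u0.
have [c _ Hc] := EVT_max T0' (continuous_subspaceT cG).
exists (\int[leb]_x `|clamp c x - 0|); split=> [|t|t].
- exact: measurable_clamp.
- exact: clamp_density.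
rewrite -clamp_clip; apply: le_trans _ (Hc _ (clip_in t)); rewrite le_eqVlt; apply/orP; left; apply/eqP.
by apply: eq_int => x; rewrite subr0 ger0_norm//; have [/(_ x)/andP[]] := clamp_density (clip 0 T t).
Qed.

(** The total variation is bounded only at almost every time, but the translation bound it implies
    passes to L^1 limits, hence to every time. *)
Lemma clamp_translation : exists M : R, forall t, translation_bound M (clamp t).
Proof.
have [_ _ _ [M HM]] := HU; exists M => t r.
have igc t' : ig (clamp t') by have [] := clamp_density t'.
rewrite -clamp_clip; set t' := clip 0 T t.
have /andP[t1 t2] : 0 <= t' <= T by exact: clip_itv.
apply/ler_addgt0Pr => /= e e0; have e2 : 0 < e / 2 by rewrite divr_gt0.
have [d d0 Hd] := clamp_L1_continuous e2.
(* A nondegenerate interval of times of [0, T] within [d] of [t'], on its right unless t' = T. *)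
have [a [b [ab H]]] : exists a b : R, a < b /\ forall s, a <= s <= b -> 0 <= s <= T /\ `|s - t'| <= d.
  have [tT|Tt] := ltP t' T.
    exists t', (Num.min T (t' + d)); split; first by rewrite lt_min tT ltrDl.
    move=> s; rewrite le_min => /andP[s1 /andP[s2 s3]]; split; first by rewrite (le_trans t1 s1).
    by rewrite ger0_norm ?subr_ge0// lerBlDl.
  have {}Tt : t' = T by apply/eqP; rewrite eq_le t2.
  exists (Num.max 0 (T - d)), T; split; first by rewrite gt_max T0 ltrBlDr ltrDl.
  move=> s; rewrite ge_max => /andP[/andP[s1 s2] s3]; split; first by rewrite s1.
  by rewrite Tt ler0_norm ?subr_le0// opprB lerBlDr -lerBlDl.
have [s sab Ps] := ae_near HM ab; have [sT st] := H s sab.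
have sin : s \in `[0, T] by rewrite in_itv.
have tv : (TV (clamp s) <= M%:E)%E.
  rewrite -(@TV_ae (U s)); [exact: Ps| | |exact: clamp_ae].
  - exact: (ig_meas (solution_ig sT)).
  - exact: (ig_meas (igc s)).
have key := TV_translate_abs (igc s) (clamp_density s).1 tv r.
have near := Hd _ _ st.
have i1 := ig_shift r (igc s); have i2 := ig_shift r (igc t').
have near' : \int[leb]_x `|clamp t' (x + r) - clamp s (x + r)| <= e / 2.
  rewrite (int_shift r (ig_abs (igB (igc t') (igc s)))).
  by rewrite L1_distC.
apply: le_trans (L1_triangle i2 i1 (igc t')) _.
apply: le_trans (lerD near' (L1_triangle i1 (igc s) (igc t'))) _.
move: key near; move: (\int[leb]_x _) (\int[leb]_x _) => p q; lra.
Qed.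

End clamped_representative.

(** * The entropy inequality in terms of the clamped representative *)

Section entropy_to_kruzkov.
Context {R : realType}.
Local Notation leb := (@lebesgue_measure R).
Local Notation leb2 := (leb \x leb)%E.
Local Notation mR := (measurableTypeR R).
Local Notation ig f := (integrable_real leb f).
Local Notation ig2 f := (integrable_real leb2 f).
Variables (T : R) (U : R -> R -> R) (U0 : R -> R) (f : R -> R).
Hypotheses (T0 : 0 < T) (HU : solution_space T U) (HU0 : L1_01 U0).
Local Notation D := (\1_`]0, T[%classic : R -> R).
Local Notation QT := (`]0, T[%classic `*` setT : set (R * R)).
Local Notation u := (clamp T U).

(** At every time the section is null, so Tonelli's theorem makes the exceptional set null in the
    plane; joint measurability makes the set measurable in the first place. *)
Lemma clamp_ae2 : leb2.-negligible [set p : mR * mR | U (clip 0 T p.1) p.2 != u p.1 p.2].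
Proof.
set N := [set p | _]; have mU := measurable_unclamped T0 HU; have mu := measurable_clamp T0 HU.
have mb := measurable_fun_eqr mU mu.
have E : N = setT `&` (fun p : mR * mR => U (clip 0 T p.1) p.2 == u p.1 p.2) @^-1` [set false].
  by rewrite setTI; apply/seteqP; split=> p /=; rewrite /N /=; case: (_ == _).
have mN : measurable N by rewrite E; apply: mb.
exists N; split; [exact: mN| |by []].
rewrite (_ : leb2 N = (\int[leb]_x (leb \o xsection N) x)%E)//.
apply: integral0_eq => t _ /=.
have ae : {ae leb, forall x, U (clip 0 T t) x = u t x}.
  by rewrite -(clamp_clip U T0); apply: clamp_ae => //; apply: clip_itv; exact: ltW.
apply: (@measure_negligible _ _ _ leb); first exact: measurable_xsection.
by apply: negligibleS ae => x /xsectionP /= /eqP.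
Qed.

(** [Psi] is the integrand as it stands in the entropy inequality and [Phi] its computed form,
    measurable everywhere; they need to agree on the strip only. The first argument holds the value
    of the solution, so that [U] can be exchanged for [u]. *)
Lemma int_QT (Phi Psi : R -> R * R -> R) :
  (forall t x y, 0 < t < T -> Psi y (t, x) = Phi y (t, x)) ->
  (forall y : mR * mR -> R, measurable_fun setT y -> measurable_fun setT (fun p : mR * mR => Phi (y p) p)) ->
  \int[leb2]_(p in QT) Psi (U p.1 p.2) p = \int[leb2]_p (D p.1 * Phi (u p.1 p.2) p).
Proof.
move=> PP mPhi; have mU := measurable_unclamped T0 HU; have mu := measurable_clamp T0 HU.
have mD : measurable_fun setT (fun p : mR * mR => D p.1).
  by apply: (meas_comp _ (@meas_fst _ _ _)); apply: measurable_indic; exact: measurable_itv.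
rewrite int_indic.
transitivity (\int[leb2]_p (D p.1 * Phi (U (clip 0 T p.1) p.2) p)).
  apply: eq_int => -[t x] /=; rewrite !indicE.
  have -> : ((t, x) \in QT) = (t \in `]0, T[%classic).
    by rewrite in_setX/= in_setT andbT.
  have [|_] := boolP (t \in _); last by rewrite !mul0r.
  rewrite mem_setE in_itv/= => tT; rewrite PP// clip_id//.
  by have /andP[t1 t2] := tT; rewrite !ltW.
apply: (@ae_eq_int _ _ _ leb2).
- by apply: measurable_funM => //; exact: mPhi.
- by apply: measurable_funM => //; exact: mPhi.
apply: negligibleS clamp_ae2 => p /= H; apply/negP => /eqP E; apply: H.
by rewrite E.
Qed.

Variables (C L : R) (V0 V Vx : R -> R -> R).
Hypotheses (fL : forall a b, `|f a - f b| <= L * `|a - b|) (HV : velocity C V Vx).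
Hypothesis (V0E : forall t, 0 < t < T -> V0 t = V t).

(** On a tensor test function the directional derivatives become explicit and the derivative of the
    velocity is [Vx]. The three integrals over the strip then merge into one, which Fubini's theorem
    iterates. *)
Lemma entropy_kruzkov : (forall (alpha : R) (phi : R * R -> R), nonneg_test_function T phi ->
    0 <= \int[leb2]_(p in QT) (`|U p.1 p.2 - alpha| * 'D_(1, 0) phi p)
       + \int[leb]_x (`|U0 x - alpha| * phi (0, x))
       + \int[leb2]_(p in QT) (Num.sg (U p.1 p.2 - alpha) * V0 p.1 p.2
            * (f (U p.1 p.2) - f alpha) * 'D_(0, 1) phi p)
       - \int[leb2]_(p in QT) (f alpha * Num.sg (U p.1 p.2 - alpha)
            * ((V0 p.1)^`())%classic p.2 * phi p)) ->
  kruzkov T f V Vx (clip01 U0) u.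
Proof.
move=> H chi r alpha schi sr chi0 r0 [c [d [dT supp]]] cr.
have tst := nonneg_test_tensor schi sr chi0 r0 (ex_intro _ c (ex_intro _ d (conj dT supp))) cr.
have {H tst} := H alpha _ tst.
have [mV mVx HC] := HV; have mf := mf_lip fL.
have [Kc HKc] := smooth_C11 schi supp.
have [igr igr'] := smooth_ig sr cr.
have cK t : `|chi t| <= Kc by have [] := HKc t.
have cK' t : `|(chi^`())%classic t| <= Kc by have [] := HKc t.
have mchi := smooth_measurable schi; have mchi' := smooth_measurable (smooth_derive1 schi).
have mr := smooth_measurable sr; have mr' := smooth_measurable (smooth_derive1 sr).
have m1 : measurable_fun setT (fun p : mR * mR => p.1 : R) by exact: meas_fst.
have m2 : measurable_fun setT (fun p : mR * mR => p.2 : R) by exact: meas_snd.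
pose P1 (y : R) (p : R * R) := (chi^`())%classic p.1 * `|y - alpha| .
pose P2 (y : R) (p : R * R) := chi p.1 * (Num.sg (y - alpha) * (f y - f alpha) * V p.1 p.2).
pose P3 (y : R) (p : R * R) := chi p.1 * (f alpha * Num.sg (y - alpha) * Vx p.1 p.2).
have mP1 (y : mR * mR -> R) : measurable_fun setT y -> measurable_fun setT (fun p : mR * mR => P1 (y p) p).
  move=> my; apply: measurable_funM; first exact: (meas_comp mchi' m1).
  by apply: measurableT_comp => //; exact: measurable_funB.
have msg (y : mR * mR -> R) : measurable_fun setT y -> measurable_fun setT (fun p : mR * mR => Num.sg (y p - alpha)).
  by move=> my; apply: (meas_comp measurable_sg); exact: measurable_funB.
have mP2 (y : mR * mR -> R) : measurable_fun setT y -> measurable_fun setT (fun p : mR * mR => P2 (y p) p).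
  move=> my; apply: measurable_funM; first exact: (meas_comp mchi m1).
  apply: measurable_funM => //; apply: measurable_funM; first exact: msg.
  by apply: measurable_funB => //; exact: (meas_comp mf my).
have mP3 (y : mR * mR -> R) : measurable_fun setT y -> measurable_fun setT (fun p : mR * mR => P3 (y p) p).
  move=> my; apply: measurable_funM; first exact: (meas_comp mchi m1).
  apply: measurable_funM => //; apply: measurable_funM => //; exact: msg.
have mrP (k : R -> R) (P : R -> R * R -> R) : measurable_fun setT k ->
   (forall y : mR * mR -> R, measurable_fun setT y -> measurable_fun setT (fun p : mR * mR => P (y p) p)) ->
   forall y : mR * mR -> R, measurable_fun setT y -> measurable_fun setT (fun p : mR * mR => k p.2 * P (y p) p).
  by move=> mk mP y my; apply: measurable_funM; [exact: (meas_comp mk m2)|exact: mP].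
rewrite (@int_QT (fun y p => r p.2 * P1 y p) (fun y p => `|y - alpha| * 'D_(1, 0) (fun p => chi p.1 * r p.2) p)); first last.
- exact: mrP.
- by move=> t x y _; rewrite derive_tensor//= mul1r mul0r addr0 /P1 /=; ring.
rewrite (@int_QT (fun y p => (r^`())%classic p.2 * P2 y p)
   (fun y p => Num.sg (y - alpha) * V0 p.1 p.2 * (f y - f alpha) * 'D_(0, 1) (fun p => chi p.1 * r p.2) p)); first last.
- exact: mrP.
- by move=> t x y tT; rewrite derive_tensor//= mul1r mul0r add0r /P2 /= V0E//; ring.
rewrite (@int_QT (fun y p => r p.2 * P3 y p)
   (fun y p => f alpha * Num.sg (y - alpha) * ((V0 p.1)^`())%classic p.2 * (chi p.1 * r p.2))); first last.
- exact: mrP.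
- move=> t x y tT; rewrite /P3 /= V0E// (derive1_is_derive (C11_is_derive (HC t) x)); ring.
have mu := measurable_clamp T0 HU.
have u01 t x : `|u t x| <= 1.
  by have [/(_ x)/andP[? ?] _] := clamp_density T0 HU t; rewrite ger0_norm.
have ua t x : `|u t x - alpha| <= 1 + `|alpha| by apply: le_trans (ler_normB _ _) _; rewrite lerD2r.
have L0 := L_ge0 fL.
have sg1 y : `|Num.sg y : R| <= 1 by rewrite normr_sg; case: (_ != _).
have VC t x : `|V t x| <= C by have [] := HC t x.
have VxC t x : `|Vx t x| <= C by have [] := HC t x.
have igD1 : ig D by exact: integrable_indic_itv.
have i1 : ig2 (fun p => D p.1 * (r p.2 * P1 (u p.1 p.2) p)).
  apply: (ig2_tensor (K := Kc * (1 + `|alpha|)) igD1 igr (mP1 _ mu)) => p.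
  by rewrite normrM normr_id; exact: ler_pM.
have i2 : ig2 (fun p => D p.1 * ((r^`())%classic p.2 * P2 (u p.1 p.2) p)).
  apply: (ig2_tensor (K := Kc * (1 * (L * (1 + `|alpha|)) * C)) igD1 igr' (mP2 _ mu)) => p.
  rewrite !normrM; apply: ler_pM => //; apply: ler_pM => //; apply: ler_pM => //.
  by apply: le_trans (fL _ _) _; rewrite ler_wpM2l.
have i3 : ig2 (fun p => D p.1 * (r p.2 * P3 (u p.1 p.2) p)).
  apply: (ig2_tensor (K := Kc * (`|f alpha| * 1 * C)) igD1 igr (mP3 _ mu)) => p.
  rewrite !normrM; apply: ler_pM => //; apply: ler_pM => //; apply: ler_pM => //.
have igU0 := L1_01_ig HU0.
(* The initial term sees [U0] only up to null sets, so it may be evaluated on its clipped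
   representative. *)
have -> : \int[leb]_x (`|U0 x - alpha| * (chi (0 : R, x).1 * r (0 : R, x).2)) =
    chi 0 * \int[leb]_x (`|clip01 U0 x - alpha| * r x).
  have mk (z : R -> R) : measurable_fun setT z -> measurable_fun setT (fun x => `|z x - alpha| * r x).
    by move=> mz; apply: measurable_funM => //; apply: measurableT_comp => //; exact: measurable_funB.
  have mc : measurable_fun setT (clip01 U0) by have [_ /ig_meas] := clip01_density igU0.
  have ik : ig (fun x => `|clip01 U0 x - alpha| * r x).
    apply: ig_le (igZ (1 + `|alpha|) (ig_abs igr)); first exact: mk.
    move=> x; rewrite normrM normr_id ler_wpM2r//.
    have [/(_ x)/andP[c1 c2] _] := clip01_density igU0.
    by apply: le_trans (ler_normB _ _) _; rewrite lerD2r ger0_norm.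
  rewrite -(intZ (chi 0) ik); apply: (@ae_eq_int _ _ _ leb).
  - rewrite (_ : (fun x => _) = (fun x => chi 0 * (`|U0 x - alpha| * r x))); last by apply/funext => x /=; ring.
    by apply: measurable_funM => //; apply: mk; exact: (ig_meas igU0).
  - by apply: measurable_funM => //; exact: mk.
  by apply: ae_imply (clip01_ae HU0) _ => x <- /=; ring.
rewrite (addrAC _ (chi 0 * _)) (addrAC _ (chi 0 * _)).
rewrite -(intD i1 i2) -(intB (igD i1 i2) i3).
rewrite (Rfubini1 (igB (igD i1 i2) i3)).
move=> /le_trans; apply; rewrite lerD2r le_eqVlt; apply/orP; left; apply/eqP.
apply: eq_int => t; rewrite indicE; case: (t \in _); last first.
  rewrite mul0r -[RHS](@int0 _ _ _ leb); apply: eq_int => x /=; ring.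
rewrite mul1r; apply: eq_int => x; rewrite /P1 /P2 /P3 /=; ring.
Qed.

End entropy_to_kruzkov.

(** * Memory kernels *)

Section memory_kernels.
Context {R : realType}.
Local Notation leb := (@lebesgue_measure R).
Local Notation mR := (measurableTypeR R).
Local Notation ig f := (integrable_real leb f).

(** The time weight of [conv_memory] with the restriction to [0, t] absorbed, so that the history
    integral runs over the whole line. *)
Definition memory (delta : R) (Gamma : R -> R) (t s : R) : R :=
  \1_`[0, t]%classic s * scaled_kernel delta Gamma (t - s).

Variables (delta : R) (Gamma : R -> R).
Hypotheses (d0 : 0 < delta) (Gamma_ge0 : forall t, 0 <= t -> 0 <= Gamma t)
  (Gamma_C2 : C2_halfline Gamma)
  (Gamma_supp : closure [set t : R | 0 <= t /\ Gamma t != 0] `<=` `[0, 1])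
  (Gamma_int : \int[leb]_(t in `[0, +oo[) Gamma t = 1).

(** The values of [Gamma] at negative arguments are unconstrained; extending by 0 gives a density on
    the whole line. *)
Let g (r : R) : R := if 0 <= r then Gamma r else 0.

Let g_supp r : g r != 0 -> 0 <= r <= 1.
Proof.
rewrite /g; case: ifPn => [r0 Gr|]; last by rewrite eqxx.
have : (`[0, 1]%classic : set R) r by apply: Gamma_supp; apply: subset_closure.
by rewrite /= in_itv/= r0.
Qed.

Let g_ge0 r : 0 <= g r.
Proof. by rewrite /g; case: ifP => // r0; exact: Gamma_ge0. Qed.

Let igg : ig g /\ \int[leb]_x g x = 1.
Proof.
have [G [dG _] GE] := Gamma_C2; split.
  have cG : continuous G by move=> x; apply: differentiable_continuous; exact: dG.
  have := ig_itv (i := `[0, 1]) cG (@subset_refl _ _).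
  apply: eq_integrable => // x _ /=; rewrite indicE mem_setE in_itv/=.
  have [/andP[x0 _]|h] := boolP (0 <= x <= 1); first by rewrite mul1r /g x0 GE.
  rewrite mul0r; congr (_%:E); apply/esym/eqP; apply: contraNT h; exact: g_supp.
rewrite -[RHS]Gamma_int [RHS]int_indic.
apply: (@eq_int _ _ _ leb) => x; rewrite indicE mem_setE in_itv/= andbT /g.
by case: ifP; rewrite ?mul1r ?mul0r.
Qed.

Let gd (r : R) : R := delta^-1 * g (delta^-1 * r).

Let iggd : ig gd /\ \int[leb]_x gd x = 1.
Proof.
have [ig0g int1] := igg; have di0 : 0 < delta^-1 by rewrite invr_gt0.
have [i E] := ig_int_affine 0 di0 ig0g; have i' := igZ delta^-1 i.
have F : (fun x => delta^-1 * g (delta^-1 * x + 0)) = gd by apply/funext => x; rewrite addr0.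
by rewrite F in i'; split=> //; rewrite -F (intZ _ i) E.
Qed.

(** The condition s <= t is already encoded in [g]; what remains is the truncation at s = 0, the
    only source of lost mass. *)
Let memoryE t s : memory delta Gamma t s = \1_`[0, +oo[%classic s * gd (t - s).
Proof.
rewrite /memory !indicE !mem_setE !in_itv/= andbT /gd /g /scaled_kernel.
have [s0|] := boolP (0 <= s); last by rewrite !mul0r.
have -> : (0 <= delta^-1 * (t - s)) = (s <= t) by rewrite pmulr_rge0 ?invr_gt0// subr_ge0.
by case: ifP; rewrite ?mul1r ?mul0r ?mulr0// (mulrC _ (t - s)).
Qed.

Let gd_ge0 r : 0 <= gd r.
Proof. by rewrite mulr_ge0// invr_ge0 ltW. Qed.

Lemma memory_supp t s : memory delta Gamma t s != 0 -> 0 <= s <= t /\ t - s <= delta.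
Proof.
rewrite memoryE indicE mem_setE in_itv/= andbT; have [s0|] := boolP (0 <= s); last by rewrite mul0r eqxx.
rewrite mul1r /gd mulf_eq0 negb_or => /andP[_ /g_supp /andP[]].
rewrite pmulr_rge0 ?invr_gt0// subr_ge0 => st.
by rewrite mulrC ler_pdivrMr// mul1r; split.
Qed.

Lemma memory_ge0 t s : 0 <= memory delta Gamma t s.
Proof. by rewrite memoryE mulr_ge0// indicE. Qed.

Lemma memory_subkernel : subkernel (memory delta Gamma).
Proof.
have [i int1] := iggd; have mg := ig_meas i.
have mI : measurable_fun setT (\1_`[0, +oo[%classic : R -> R) by apply: measurable_indic; exact: measurable_itv.
have le t s : memory delta Gamma t s <= gd (t - s).
  by rewrite memoryE indicE; case: (_ \in _); rewrite ?mul1r ?mul0r.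
have igm t : ig (memory delta Gamma t).
  apply: ig_le (ig_refl t i).
    rewrite (_ : memory _ _ t = (fun s => \1_`[0, +oo[%classic s * gd (t - s))); last exact/funext.
    by apply: measurable_funM => //; exact: measurable_sub_r.
  by move=> s; rewrite ger0_norm ?memory_ge0.
split=> // [|t s|t]; last 2 first.
- exact: memory_ge0.
- by rewrite -[leRHS]int1 -(int_refl t i); apply: le_int => //; exact: ig_refl.
rewrite (_ : (fun p => _) = (fun p : mR * mR => \1_`[0, +oo[%classic p.2 * gd (p.1 - p.2))); last exact/funext.
apply: measurable_funM; first exact: (meas_comp mI (@meas_snd _ _ _)).
by apply: (meas_comp mg); apply: measurable_funB; [exact: meas_fst|exact: meas_snd].
Qed.

(** The shifted kernel lives on [t - delta, t], which for t >= delta lies in s >= 0: the truncation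
    removes nothing. *)
Lemma int_memory t : delta <= t -> \int[leb]_s memory delta Gamma t s = 1.
Proof.
have [i int1] := iggd; move=> dt; rewrite -[RHS]int1 -(int_refl t i); apply: eq_int => s.
rewrite memoryE indicE mem_setE in_itv/= andbT.
have [s0|s0] := boolP (0 <= s); first by rewrite mul1r.
rewrite mul0r /gd; apply/esym/eqP; rewrite mulf_eq0; apply/orP; right.
apply: contraNT s0 => /g_supp /andP[_]; rewrite mulrC ler_pdivrMr// mul1r => h.
by rewrite -(lerD2l (t - s)) addr0 subrK (le_trans h).
Qed.

(** The missing mass of the kernel multiplies a convolution of size [C * m], and it is nonzero only
    for t < delta; the remaining mass averages the distances from [u t] to the past states of
    [v]. *)
Lemma conv_memory_near (m mv C q t x : R) (k : R -> R) (u v : R -> R -> R) : measurable_fun setT k ->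
  (forall y, `|k y| <= C) -> bounded_field m u -> bounded_field mv v ->
  (forall s, 0 <= s <= t -> t - s <= delta -> \int[leb]_y `|u t y - v s y| <= q) ->
  0 <= q ->
  `|convol k (u t) x - \int[leb]_s (memory delta Gamma t s * convol k (v s) x)| <=
  C * (m * (t < delta)%R%:R + q).
Proof.
move=> mk kC Hu Hv Hq q0; have C0 : 0 <= C by exact: le_trans (kC 0).
have [mmem imem mem0 mem1] := memory_subkernel.
have [_ du um] := Hu; have [_ dv vm] := Hv.
have m0 : 0 <= m by apply: le_trans (um t); exact: density_int_ge0.
have cb (z : R -> R) mz : density z -> \int[leb]_y z y <= mz -> `|convol k z x| <= C * mz.
  move=> dz zm; apply: weight_le => //; first by case: dz.
    by move=> y; exact: density_ge0.
  exact: measurable_sub_r.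
have mcv : measurable_fun setT (fun s => convol k (v s) x) by exact: (@meas_comp2 R _ mR (fun s x => convol k (v s) x) id (fun=> x) (measurable_conv Hv mk)).
have i1 := ig_weight (imem t) mcv (fun s => cb _ _ (dv s) (vm s)).
have i2 : ig (fun s => memory delta Gamma t s * convol k (u t) x).
  by have := igZ (convol k (u t) x) (imem t); apply: eq_integrable => // s _ /=; rewrite mulrC.
have E : convol k (u t) x - \int[leb]_s (memory delta Gamma t s * convol k (v s) x) =
    (1 - \int[leb]_s memory delta Gamma t s) * convol k (u t) x +
    (\int[leb]_s (memory delta Gamma t s * convol k (u t) x) - \int[leb]_s (memory delta Gamma t s * convol k (v s) x)).
  rewrite [X in _ + (X - _)](_ : _ = convol k (u t) x * \int[leb]_s memory delta Gamma t s); last first.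
    by rewrite -(intZ _ (imem t)); apply: eq_int => s; rewrite mulrC.
  by move: (\int[leb]_s memory delta Gamma t s) => p; ring.
rewrite E mulrDr; apply: le_trans (ler_normD _ _) _; apply: lerD.
  rewrite normrM mulrA mulrC; apply: ler_pM => //; first exact: cb.
  have [td|dt] := ltP t delta; last by rewrite int_memory// subrr normr0.
  by rewrite ger0_norm ?subr_ge0// gerBl; exact: int_ge0.
apply: le_trans (abs_intB_le i2 i1) _.
apply: (@le_trans _ _ (\int[leb]_s (C * q * memory delta Gamma t s))); last first.
  by rewrite (intZ _ (imem t)) ler_piMr// mulr_ge0.
apply: le_int; [exact: ig_abs (igB i2 i1)|exact: igZ|] => s.
rewrite -mulrBr normrM (ger0_norm (mem0 _ _)) mulrC.
have [->|/memory_supp [st td]] := eqVneq (memory delta Gamma t s) 0; first by rewrite !mulr0.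
rewrite ler_wpM2r//; apply: le_trans (conv_dist x mk kC (du t) (dv s)) _.
by rewrite ler_wpM2l// Hq.
Qed.

End memory_kernels.

(** * Error of the memory system *)

Section nonlocal_velocities.
Context {R : realType} {N : nat}.
Local Notation leb := (@lebesgue_measure R).
Local Notation mR := (measurableTypeR R).
Local Notation ig f := (integrable_real leb f).
Local Notation field := ('I_N -> R -> R -> R).

Lemma velocity_le (C D : R) (V Vx : R -> R -> R) : C <= D -> velocity C V Vx -> velocity D V Vx.
Proof. by move=> CD [mV mVx HV]; split=> // t; exact: C11_le CD (HV t). Qed.

Definition space_velocity (nu : 'rV[R]_N -> R) (mu : 'I_N -> R -> R) (u : field) (t x : R) : R :=
  nu (row_of (fun j => convol (mu j) (u j t) x)).

Definition space_velocity' (nu : 'rV[R]_N -> R) (mu mu' : 'I_N -> R -> R) (u : field) (t x : R) : R :=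
  chain_derive nu (fun j => convol (mu j) (u j t) x) (fun j => convol (mu' j) (u j t) x).

Definition convol_memory (kappa : R -> R -> R) (k : R -> R) (u : R -> R -> R) (t x : R) : R :=
  \int[leb]_s (kappa t s * convol k (u s) x).

Definition memory_velocity (nu : 'rV[R]_N -> R) (kappa : 'I_N -> R -> R -> R) (mu : 'I_N -> R -> R)
    (u : field) (t x : R) : R :=
  nu (row_of (fun j => convol_memory (kappa j) (mu j) (u j) t x)).

Definition memory_velocity' (nu : 'rV[R]_N -> R) (kappa : 'I_N -> R -> R -> R) (mu mu' : 'I_N -> R -> R)
    (u : field) (t x : R) : R :=
  chain_derive nu (fun j => convol_memory (kappa j) (mu j) (u j) t x)
    (fun j => convol_memory (kappa j) (mu' j) (u j) t x).

Variables (Cn Cm m : R) (nu : 'rV[R]_N -> R) (mu mu' : 'I_N -> R -> R) (u : field).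
Hypotheses (Hnu : C2b Cn nu) (Cm0 : 0 <= Cm) (Hmu : forall j, C11 Cm (mu j) (mu' j)) (m0 : 0 <= m)
  (Hu : forall j, bounded_field m (u j)).

Lemma velocity_space : velocity (Cn * (1 + N%:R * (Cm * m)) ^+ 2)
  (space_velocity nu mu u) (space_velocity' nu mu mu' u).
Proof.
apply: (velocity_chain (w := fun j t x => convol (mu j) (u j t) x)
  (w' := fun j t x => convol (mu' j) (u j t) x)) => //; first exact: mulr_ge0.
by move=> j; exact: velocity_conv (Hmu j) (Hu j).
Qed.

Lemma velocity_memory_system (kappa : 'I_N -> R -> R -> R) : (forall j, subkernel (kappa j)) ->
  velocity (Cn * (1 + N%:R * (Cm * m)) ^+ 2)
  (memory_velocity nu kappa mu u) (memory_velocity' nu kappa mu mu' u).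
Proof.
move=> Hk; apply: (velocity_chain (w := fun j => convol_memory (kappa j) (mu j) (u j))
  (w' := fun j => convol_memory (kappa j) (mu' j) (u j))) => //; first exact: mulr_ge0.
move=> j; apply: (velocity_memory (Hk j) (w := fun s x => convol (mu j) (u j s) x)
  (w' := fun s x => convol (mu' j) (u j s) x)).
exact: velocity_conv (Hmu j) (Hu j).
Qed.

Lemma mu'_le j x : `|mu' j x| <= Cm. Proof. by have [] := Hmu j x. Qed.
Lemma mu_le j x : `|mu j x| <= Cm. Proof. by have [] := Hmu j x. Qed.

(** One estimate serves two comparisons: of the memoryless velocity with the memory velocity, and
    with itself at another time. *)
Lemma chain_near (q : R) (t x : R) (z z' : 'I_N -> R) : 
  (forall j, `|convol (mu j) (u j t) x - z j| <= q) ->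
  (forall j, `|convol (mu' j) (u j t) x - z' j| <= q) ->
  `|space_velocity nu mu u t x - nu (row_of z)| <= Cn * (N%:R * q) * (1 + N%:R * (Cm * m)) /\
  `|space_velocity' nu mu mu' u t x - chain_derive nu z z'| <= Cn * (N%:R * q) * (1 + N%:R * (Cm * m)).
Proof.
move=> Hz Hz'; have Cn0 := C2b_ge0 Hnu; have [_ _ b2 _ _] := Hnu; split.
  apply: le_trans (b2 _ _) _.
  apply: (@le_trans _ _ (Cn * (N%:R * q))); first by apply: ler_wpM2l => //; exact: norm1_row.
  have [->|N0] := posnP N; first by rewrite !mul0r mulr0 mul0r.
  have q0 : 0 <= q by exact: le_trans (Hz (Ordinal N0)).
  by rewrite ler_peMr ?lerDl// !mulr_ge0.
apply: chain_derive_near => // j.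
have [_ _ HC] := velocity_conv (Hmu j) (Hu j).
by have [] := HC t x.
Qed.

Lemma space_velocity_time : (forall j, uniformly_L1_continuous (u j)) ->
  forall om : R, 0 < om -> exists2 d : R, 0 < d & forall s t x : R, `|s - t| <= d ->
   `|space_velocity nu mu u t x - space_velocity nu mu u s x| <= om /\
   `|space_velocity' nu mu mu' u t x - space_velocity' nu mu mu' u s x| <= om.
Proof.
move=> cu om om0; have Cn0 := C2b_ge0 Hnu.
pose Z := Cn * N%:R * (1 + N%:R * (Cm * m)) * Cm + 1.
have one : 0 <= 1 + N%:R * (Cm * m) by rewrite addr_ge0// !mulr_ge0.
have Z0 : 0 < Z by rewrite ltr_wpDl// !mulr_ge0.
pose e := om / Z; have e0 : 0 < e by rewrite divr_gt0.
have [F HF] := @choice _ _ (fun (j : 'I_N) (d : R) => 0 < d /\ forall s t, `|s - t| <= d -> \int[leb]_x `|u j s x - u j t x| <= e)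
  (fun j => let: ex_intro2 d a b := cu j e e0 in ex_intro _ d (conj a b)).
exists (\big[Num.min/1]_j F j).
  by apply: (big_ind (fun y : R => 0 < y)) => [|x y x0 y0|j _] //; [rewrite lt_min x0 y0|have [] := HF j].
move=> s t x st.
have near j (k : R -> R) : measurable_fun setT k -> (forall y, `|k y| <= Cm) ->
    `|convol k (u j t) x - convol k (u j s) x| <= Cm * e.
  move=> mk kC; have [_ du _] := Hu j.
  apply: le_trans (conv_dist x mk kC (du t) (du s)) _; rewrite ler_wpM2l//.
  have [_ H] := HF j; apply: H; rewrite distrC; apply: le_trans st _.
  by rewrite (bigD1 j)//= ge_min lexx.
have mm j := C11_measurable (Hmu j).
have le : Cn * (N%:R * (Cm * e)) * (1 + N%:R * (Cm * m)) <= om.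
  rewrite (_ : _ * _ = e * (Z - 1)); last by rewrite /Z; ring.
  by rewrite /e mulrAC ler_pdivrMr// ler_wpM2l ?(ltW om0)// gerBl.
have [] := @chain_near (Cm * e) t x (fun j => convol (mu j) (u j s) x) (fun j => convol (mu' j) (u j s) x).
- by move=> j; apply: near; [exact: (mm j).1|exact: mu_le].
- by move=> j; apply: near; [exact: (mm j).2|exact: mu'_le].
by move=> h1 h2; split; [exact: le_trans h1 le|exact: le_trans h2 le].
Qed.

End nonlocal_velocities.

(** * Gronwall's argument for the memory error *)

Section memory_error.
Context {R : realType} {N : nat}.
Local Notation leb := (@lebesgue_measure R).
Local Notation ig f := (integrable_real leb f).
Local Notation field := ('I_N -> R -> R -> R).
Variables (T L Cn Cm m M K : R) (f : 'I_N -> R -> R) (nu : 'I_N -> 'rV[R]_N -> R)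
  (mu mu' : 'I_N -> 'I_N -> R -> R) (u : field) (u0 : 'I_N -> R -> R).
Hypotheses (T0 : 0 < T) (fL : forall k a b, `|f k a - f k b| <= L * `|a - b|) (f0 : forall k, f k 0 = 0)
  (Hnu : forall k, C2b Cn (nu k)) (Cm0 : 0 <= Cm)
  (Hmu : forall j k, C11 Cm (mu j k) (mu' j k)) (Hu : forall j, bounded_field m (u j))
  (cu : forall j, uniformly_L1_continuous (u j)) (tbu : forall j t, translation_bound M (u j t))
  (hol : forall j s t, 0 <= s <= T -> 0 <= t <= T ->
     \int[leb]_x `|u j t x - u j s x| <= K * Num.sqrt `|t - s|) (K0 : 0 <= K)
  (Hu0 : forall k, density (u0 k)).
Hypothesis HKu : forall k, kruzkov T (f k) (space_velocity (nu k) (mu^~ k) u)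
  (space_velocity' (nu k) (mu^~ k) (mu'^~ k) u) (u0 k) (u k).

(** The stability factor [L * (M + m)] of one component times the sensitivity of the velocities to
    the L^1 error, summed over the N components. All constants are those of the memoryless
    solution. *)
Definition error_rate : R := N%:R * (L * (M + m) * (Cn * N%:R * (1 + N%:R * (Cm * m)) * Cm)).
(** The factor before the last exponential, times sqrt delta, bounds the weighted maximum of the
    error; the exponential removes the weight. [m * expR 1] stems from the initial layer and [K * T]
    from the Hoelder regularity. *)
Definition error_bound : R :=
  2 * error_rate * (m * expR 1 + K * T) * expR ((2 * error_rate + 1) * T).

Variables (delta mv : R) (Gamma : 'I_N -> 'I_N -> R -> R) (v : field).
Hypotheses (d0 : 0 < delta) (d1 : delta <= 1)
  (Gamma_ge0 : forall j k t, 0 <= t -> 0 <= Gamma j k t)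
  (Gamma_C2 : forall j k, C2_halfline (Gamma j k))
  (Gamma_supp : forall j k, closure [set t : R | 0 <= t /\ Gamma j k t != 0] `<=` `[0, 1])
  (Gamma_int : forall j k, \int[leb]_(t in `[0, +oo[) Gamma j k t = 1)
  (Hv : forall j, bounded_field mv (v j)) (cv : forall j, uniformly_L1_continuous (v j)).
Local Notation kappa k := (fun j => memory delta (Gamma j k)).
Hypothesis HKv : forall k, kruzkov T (f k) (memory_velocity (nu k) (kappa k) (mu^~ k) v)
  (memory_velocity' (nu k) (kappa k) (mu^~ k) (mu'^~ k) v) (u0 k) (v k).
Hypothesis start : forall k, \int[leb]_x `|u k 0 x - v k 0 x| = 0.

Let G t : R := \sum_k \int[leb]_x `|u k t x - v k t x|.
Let A := error_rate.
Let lambda := 2 * A + 1.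
Let sd := Num.sqrt delta.

Lemma memory_error (N0 : (0 < N)%N) t : 0 <= t <= T -> G t <= error_bound * sd.
Proof.
pose k0 := Ordinal N0.
have [_ du0 um0] := Hu k0.
have m0 : 0 <= m by apply: le_trans (um0 0); exact: density_int_ge0.
have mv0 : 0 <= mv by have [_ dv vm] := Hv k0; apply: le_trans (vm 0); exact: density_int_ge0.
have Cn0 := C2b_ge0 (Hnu k0); have L0 := L_ge0 (fL k0).
have M0 : 0 <= M := translation_bound_ge0 (tbu k0 0).
pose Kn := Cn * N%:R * (1 + N%:R * (Cm * m)).
have Kn0 : 0 <= Kn by rewrite !mulr_ge0// addr_ge0// !mulr_ge0.
have A0 : 0 <= A by rewrite /A /error_rate !mulr_ge0 ?addr_ge0// !mulr_ge0.
have l0 : 0 < lambda by rewrite /lambda ltr_wpDl// mulr_ge0.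
have du j t' : density (u j t') by have [] := Hu j.
have dv j t' : density (v j t') by have [] := Hv j.
have cG : continuous G.
  apply: (@continuous_big _ _ +%R) => [|j _]; first exact: add_continuous.
  exact: (L1_dist_continuous (du j) (dv j) (@cu j) (@cv j)).
pose E t := G t * expR (- (lambda * t)).
have cE : continuous E.
  move=> x; apply: cvgM; first exact: cG.
  apply: (@continuous_comp _ _ _ (fun t => - (lambda * t)) expR); last exact: continuous_expR.
  by apply: cvgN; apply: cvgM; [exact: cvg_cst|exact: cvg_id].
(* [S] is the norm of the error weighted by [exp (- lambda t)]: with [lambda] large
   the stability estimate gives [S <= S / 2 + O(sqrt delta)]. *)
have [c cT Hc] := EVT_max (ltW T0) (continuous_subspaceT cE).
pose S := E c.
have GE t' : G t' = E t' * expR (lambda * t').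
  by rewrite /E -mulrA -expRD addNr expR0 mulr1.
have GS t' : 0 <= t' <= T -> G t' <= S * expR (lambda * t').
  by move=> tT; rewrite GE ler_wpM2r ?expR_ge0//; apply: Hc; rewrite in_itv.
have G0 t' : 0 <= G t' by apply: sumr_ge0 => j _; exact: int_ge0.
have S0 : 0 <= S by rewrite /S /E mulr_ge0 ?expR_ge0.
have sd0 : 0 <= sd by exact: sqrtr_ge0.
(* The initial layer contributes order [delta]; for delta <= 1 this is absorbed in sqrt delta. *)
have dsd : delta <= sd.
  by rewrite -{1}(sqr_sqrtr (ltW d0)) expr2 ler_piMr// -[leRHS]sqrtr1 ler_sqrt.
(* exp(1 - s / delta) is a smooth majorant of the indicator of s < delta, with integral at most
   delta times e; [S * expR (lambda * s)] majorises the error over the past of s. Both have the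
   explicit primitives collected in [P]. *)
pose q s := m * expR (1 - s / delta) + (K * sd + S * expR (lambda * s)).
pose cc s := Kn * Cm * q s.
pose P s := Kn * Cm * (- (m * delta * expR (1 - s / delta)) + (K * sd * s + S / lambda * expR (lambda * s))).
have near j k (kk : R -> R) s x : measurable_fun setT kk -> (forall y, `|kk y| <= Cm) -> 0 < s < T ->
    `|convol kk (u j s) x - convol_memory (memory delta (Gamma j k)) kk (v j) s x| <= Cm * q s.
  move=> mk kC /andP[s0 sT].
  have q0 : 0 <= K * sd + S * expR (lambda * s) by rewrite addr_ge0 ?mulr_ge0 ?expR_ge0.
  (* The path goes through [u s']: Hoelder continuity over a lapse of at most [delta] gives
     [K * sd], and the error at [s'] is bounded by its weighted maximum. *)
  have H s' : 0 <= s' <= s -> s - s' <= delta -> \int[leb]_y `|u j s y - v j s' y| <= K * sd + S * expR (lambda * s).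
    move=> /andP[s'0 s's] sd'.
    have s'T : 0 <= s' <= T by rewrite s'0 (le_trans s's)// ltW.
    have [_ iu] := du j s; have [_ iu'] := du j s'; have [_ iv'] := dv j s'.
    apply: le_trans (L1_triangle iu iu' iv') _; apply: lerD.
      apply: le_trans (hol j s'T _) _; first by rewrite !ltW.
      by rewrite ger0_norm ?subr_ge0//; apply: ler_wpM2l => //; exact: ler_wsqrtr.
    apply: (@le_trans _ _ (G s')).
      by rewrite /G (bigD1 j)//= lerDl; apply: sumr_ge0 => i _; exact: int_ge0.
    apply: le_trans (GS _ s'T) _; rewrite ler_wpM2l// ler_expR ler_wpM2l// ltW//.
  have := @conv_memory_near R delta (Gamma j k) d0 (@Gamma_ge0 j k) (@Gamma_C2 j k) (@Gamma_supp j k) (@Gamma_int j k) m mv Cm _ s x kk (u j) (v j) mk kC (Hu j) (Hv j) H q0.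
  move=> /le_trans; apply; rewrite ler_wpM2l// lerD2r ler_wpM2l//.
  have [sd'|_] := ltP s delta; last exact: expR_ge0.
  by rewrite -[leLHS]expR0 ler_expR subr_ge0 ler_pdivrMr// mul1r ltW.
have dE (a b s : R) : is_derive s 1 (fun s : R => expR (a * s + b)) (a * expR (a * s + b)).
  by apply: is_derive_comp_affine; exact: is_derive_expR.
have Pe s : - delta^-1 * s + 1 = 1 - s / delta by ring.
have cP (s : R) : is_derive s 1 P (cc s).
  have := is_deriveD (is_deriveZ (- (Kn * Cm * m * delta)) (dE (- delta^-1) 1 s))
    (is_deriveD (is_deriveZ (Kn * Cm * K * sd) (is_derive_id s 1))
       (is_deriveZ (Kn * Cm * (S / lambda)) (dE lambda 0 s))).
  set F := (X in is_derive _ _ X _); set d := (X in is_derive _ _ _ X).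
  have -> : F = P.
    apply/funext => y; have -> : F y = - (Kn * Cm * m * delta) * expR (- delta^-1 * y + 1) +
      (Kn * Cm * K * sd * y + Kn * Cm * (S / lambda) * expR (lambda * y + 0)) by [].
    by rewrite Pe addr0 /P; ring.
  have -> // : d = cc s.
  have -> : d = - (Kn * Cm * m * delta) * (- delta^-1 * expR (- delta^-1 * s + 1)) +
    (Kn * Cm * K * sd * 1 + Kn * Cm * (S / lambda) * (lambda * expR (lambda * s + 0))) by [].
  rewrite Pe addr0 /cc /q; move: (expR _) (expR _) => a1 a2; field.
  by rewrite (gt_eqF l0) (gt_eqF d0).
have ccc : continuous cc.
  have cE' a b : continuous (fun s : R => expR (a * s + b)) := is_derive_continuous (dE a b).
  have E1 : cc = (fun s => Kn * Cm * (m * expR (- delta^-1 * s + 1) + (K * sd + S * expR (lambda * s + 0)))).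
    by apply/funext => s; rewrite /cc /q Pe addr0.
  rewrite E1 => s; apply: cvgM; first exact: cvg_cst.
  apply: cvgD; first by apply: cvgM; [exact: cvg_cst|exact: cE'].
  by apply: cvgD; [exact: cvg_cst|apply: cvgM; [exact: cvg_cst|exact: cE']].
have PP s : 0 <= s -> P s - P 0 <= Kn * Cm * (m * delta * expR 1 + K * sd * s + S / lambda * expR (lambda * s)).
  move=> s0; rewrite /P -mulrBr; apply: ler_wpM2l; first exact: mulr_ge0.
  rewrite (mul0r delta^-1) subr0 (mulr0 lambda) expR0 mulr1 (mulr0 (K * sd)).
  have h1 : 0 <= m * delta * expR (1 - s / delta) by rewrite !mulr_ge0 ?expR_ge0// ltW.
  have h2 : 0 <= S / lambda by rewrite divr_ge0// ltW.
  move: h1 h2; move: (m * delta * _) (m * delta * _) (S / lambda) (S / lambda * _) (K * sd * s) => *; lra.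
have Gt s : 0 <= s <= T -> G s <= A * (m * delta * expR 1 + K * sd * s + S / lambda * expR (lambda * s)).
  move=> sT; have s0 : 0 <= s by case/andP: sT.
  apply: (@le_trans _ _ (\sum_(k < N) (L * (M + m) * (Kn * Cm) * (m * delta * expR 1 + K * sd * s + S / lambda * expR (lambda * s))))); last first.
    by rewrite sumr_const card_ord /A /error_rate -/Kn -[_ *+ N]mulr_natl mulrA.
  apply: ler_sum => k _.
  have HVk := velocity_space (Hnu k) Cm0 (fun j => Hmu j k) m0 Hu.
  have HWk := velocity_memory_system (Hnu k) Cm0 (fun j => Hmu j k) mv0 Hv
    (fun j => memory_subkernel d0 (@Gamma_ge0 j k) (@Gamma_C2 j k) (@Gamma_supp j k) (@Gamma_int j k)).
  have mono (a b : R) : 0 <= a -> a <= b -> Cn * (1 + N%:R * (Cm * a)) ^+ 2 <= Cn * (1 + N%:R * (Cm * b)) ^+ 2.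
    move=> a0 ab; rewrite ler_wpM2l// ler_pXn2r ?nnegrE ?addr_ge0 ?mulr_ge0 ?(le_trans a0 ab)//.
    by rewrite lerD2l !ler_wpM2l.
  (* Both velocities must share one [C11] constant. It involves [mv], hence [delta], which is
     harmless because the conclusion of [L1_stability] does not contain it. *)
  have le1 : m <= m + mv by rewrite lerDl.
  have le2 : mv <= m + mv by rewrite lerDr.
  have HV1 := velocity_le (mono m (m + mv) m0 le1) HVk.
  have HW1 := velocity_le (mono mv (m + mv) mv0 le2) HWk.
  have Hc' s' x : 0 < s' < T -> `|space_velocity (nu k) (mu^~ k) u s' x - memory_velocity (nu k) (kappa k) (mu^~ k) v s' x| <= cc s' /\
     `|space_velocity' (nu k) (mu^~ k) (mu'^~ k) u s' x - memory_velocity' (nu k) (kappa k) (mu^~ k) (mu'^~ k) v s' x| <= cc s'.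
    move=> s'T; have -> : cc s' = Cn * (N%:R * (Cm * q s')) * (1 + N%:R * (Cm * m)).
      by rewrite /cc /Kn; ring.
    have mm j := C11_measurable (Hmu j k).
    apply: (chain_near (Hnu k) Cm0 (fun j => Hmu j k) m0 Hu) => j.
    - by apply: near => //; [exact: (mm j).1|move=> y; have [] := Hmu j k y].
    - by apply: near => //; [exact: (mm j).2|move=> y; have [] := Hmu j k y].
  have := @L1_stability R T L _ m mv M (f k) (fL k) (f0 k) T0 _ _ (u k) (u0 k) HV1 (Hu k) (Hu0 k) (HKu k) (@cu k) (tbu k)
    _ _ (v k) (u0 k) HW1 (Hv k) (Hu0 k) (HKv k) (@cv k)
    (space_velocity_time (Hnu k) Cm0 (fun j => Hmu j k) m0 Hu cu) cc P ccc cP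
    (fun s' x h => (Hc' s' x h).1) (fun s' x h => (Hc' s' x h).2) s sT.
  rewrite start add0r => /le_trans; apply.
  rewrite -[leRHS]mulrA; apply: ler_wpM2l; last exact: PP.
  by rewrite mulr_ge0// addr_ge0.
have cin : 0 <= c <= T by move: cT; rewrite in_itv.
have c0 : 0 <= c by case/andP: cin.
have e1 : expR (- (lambda * c)) <= 1 by rewrite -expR0 ler_expR oppr_le0 mulr_ge0// ltW.
have SA : S <= A * (m * delta * expR 1 + K * sd * c) * expR (- (lambda * c)) + A * (S / lambda).
  rewrite {1}/S /E; apply: (@le_trans _ _ (A * (m * delta * expR 1 + K * sd * c + S / lambda * expR (lambda * c)) * expR (- (lambda * c)))).
    by rewrite ler_wpM2r ?expR_ge0// Gt.
  have EE : expR (lambda * c) * expR (- (lambda * c)) = 1 by rewrite -expRD subrr expR0.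
  rewrite le_eqVlt; apply/orP; left; apply/eqP; rewrite -[S / lambda in RHS]mulr1 -EE.
  by move: (S / lambda) (expR _) (expR _) (expR _) => ? ? ? ?; ring.
(* [lambda = 2 * A + 1] is chosen for this: A / lambda <= 1/2, so the term with [S] is absorbed on
   the left. *)
have half : A * (S / lambda) <= S / 2.
  rewrite mulrA ler_pdivrMr// (_ : S / 2 * lambda = A * S + S / 2) ?lerDl ?divr_ge0//.
  by rewrite /lambda; field.
have B1 : A * (m * delta * expR 1 + K * sd * c) * expR (- (lambda * c)) <= A * (m * expR 1 + K * T) * sd.
  apply: (@le_trans _ _ (A * (m * delta * expR 1 + K * sd * c))).
    by rewrite ler_piMr// mulr_ge0// addr_ge0// !mulr_ge0 ?expR_ge0// ltW.
  rewrite -[leRHS]mulrA ler_wpM2l// mulrDl; apply: lerD.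
    by rewrite mulrAC ler_wpM2l ?mulr_ge0 ?expR_ge0.
  by rewrite mulrAC -!mulrA ler_wpM2l// ler_wpM2r//; case/andP: cin.
have SB : S <= 2 * A * (m * expR 1 + K * T) * sd.
  have {}SA := le_trans SA (lerD B1 half).
  rewrite (_ : 2 * A * _ * sd = 2 * (A * (m * expR 1 + K * T) * sd)); last by ring.
  by move: SA; move: (A * _ * sd) => a; lra.
move=> /andP[t0 tT]; apply: le_trans (GS t _) _; first by rewrite t0.
have -> : error_bound * sd = 2 * A * (m * expR 1 + K * T) * sd * expR (lambda * T).
  by rewrite /error_bound -/A -/lambda; ring.
apply: (ler_pM S0 _ SB); first exact: expR_ge0.
by rewrite ler_expR ler_wpM2l// ltW.
Qed.

End memory_error.

(** * Nonlocal terms and entropy systems on representatives *)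

Section entropy_systems.
Context {R : realType} {N : nat}.
Local Notation leb := (@lebesgue_measure R).
Local Notation mR := (measurableTypeR R).
Local Notation ig f := (integrable_real leb f).
Local Notation field := ('I_N -> R -> R -> R).
Variables (T : R) (U : field).
Hypotheses (T0 : 0 < T) (HU : forall k, solution_space T (U k)).

Lemma ig_convol (C : R) (k z : R -> R) (x : R) : measurable_fun setT k -> (forall y, `|k y| <= C) ->
  ig z -> ig (fun y => z y * k (x - y)).
Proof. by move=> mk kC igz; apply: (ig_weight igz (measurable_sub_r x mk) (fun y => kC _)). Qed.

(** The factor [c] stands for the time kernel, which does not depend on the space variable: 1
    without memory, a value of [scaled_kernel] with memory. *)
Lemma int_clamp (C c : R) j (k : R -> R) t x : measurable_fun setT k -> (forall y, `|k y| <= C) ->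
  0 <= t <= T -> \int[leb]_y (U j t y * (k (x - y) * c)) = c * convol k (clamp T (U j) t) x.
Proof.
move=> mk kC tT; have [_ igc] := clamp_density T0 (HU j) t.
have i1 := ig_convol x mk kC (solution_ig T0 (HU j) tT); have i2 := ig_convol x mk kC igc.
transitivity (c * \int[leb]_y (U j t y * k (x - y))).
  by rewrite -(intZ _ i1); apply: eq_int => y; ring.
congr (_ * _); apply: (@ae_eq_int _ _ _ leb); [exact: ig_meas i1|exact: ig_meas i2|].
by apply: ae_imply (clamp_ae T0 (HU j) tT) _ => y ->.
Qed.

Lemma conv_space_clamp (mu : 'I_N -> 'I_N -> R -> R) (C : R) k t x :
  (forall j, measurable_fun setT (mu j k)) -> (forall j y, `|mu j k y| <= C) -> 0 <= t <= T ->
  conv_space mu U k t x = row_of (fun j => convol (mu j k) (clamp T (U j) t) x).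
Proof.
move=> mm mC tT; apply/rowP => j; rewrite !mxE -[RHS]mul1r -(int_clamp 1 j x (mm j) (mC j) tT).
by apply: eq_int => y; rewrite mulr1.
Qed.

Lemma conv_memory_clamp (mu Gamma : 'I_N -> 'I_N -> R -> R) (C delta : R) k t x :
  (forall j, measurable_fun setT (mu j k)) -> (forall j y, `|mu j k y| <= C) -> 0 <= t <= T ->
  conv_memory (Theta mu Gamma delta) U k t x =
  row_of (fun j => convol_memory (memory delta (Gamma j k)) (mu j k) (clamp T (U j)) t x).
Proof.
move=> mm mC /andP[t0 tT]; apply/rowP => j; rewrite !mxE int_indic.
apply: eq_int => s; rewrite /memory indicE mem_setE in_itv/=.
have [/andP[s0 st]|_] := boolP (0 <= s <= t); last by rewrite !mul0r.
rewrite !mul1r; apply: int_clamp (mm j) (mC j) _.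
by rewrite s0 (le_trans st tT).
Qed.

Lemma system_kruzkov (L C : R) (f : 'I_N -> R -> R) (nu : 'I_N -> 'rV[R]_N -> R) W U0 k (V Vx : R -> R -> R) :
  (forall a b, `|f k a - f k b| <= L * `|a - b|) -> L1_01 (U0 k) -> velocity C V Vx ->
  (forall t x, 0 < t < T -> nu k (W U k t x) = V t x) ->
  entropy_solution T f nu W U0 U -> kruzkov T (f k) V Vx (clip01 (U0 k)) (clamp T (U k)).
Proof.
move=> fL HU0 HV VE [_ sol].
have V0E t : 0 < t < T -> (fun x => nu k (W U k t x)) = V t by move=> tT; apply/funext => x; exact: VE.
by apply: (entropy_kruzkov T0 (HU k) HU0 fL HV V0E) => alpha phi Hphi; exact: sol.
Qed.

End entropy_systems.

(** * Constants common to all components *)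

Section theorem_data.
Context {R : realType}.
Local Notation leb := (@lebesgue_measure R).

Lemma lipschitz_setT (f : R -> R) : [lipschitz f x | x in setT] ->
  exists2 L : R, 0 <= L & forall a b, `|f a - f b| <= L * `|a - b|.
Proof.
move=> [M [Mr HM]]; exists (`|M| + 1); first by rewrite addr_ge0.
by move=> a b; apply: (HM (`|M| + 1) _ (a, b)) => //; rewrite ltr_pwDr// ler_norm.
Qed.

Lemma bounded_field_le (m m' : R) (u : R -> R -> R) : m <= m' -> bounded_field m u -> bounded_field m' u.
Proof. by move=> mm [mu du um]; split=> // t; exact: le_trans (um t) mm. Qed.

Lemma translation_bound_le (M M' : R) (a : R -> R) : M <= M' -> translation_bound M a -> translation_bound M' a.
Proof. by move=> MM tb r; apply: le_trans (tb r) _; rewrite ler_wpM2r. Qed.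

Lemma clip01_translation (z : R -> R) : L1_01 z -> (TV z < +oo)%E ->
  exists M : R, translation_bound M (clip01 z).
Proof.
move=> Hz Tz; have igz := L1_01_ig Hz; have [c01 igc] := clip01_density igz.
have [M HM] : exists M : R, (TV z <= M%:E)%E.
  by move: Tz; case: (TV z) => [r| |] // _; [exists r|exists 0; rewrite leNye].
exists M => r; apply: TV_translate_abs => //.
by rewrite -(TV_ae (ig_meas igz) (ig_meas igc) (clip01_ae Hz)).
Qed.

Variables (N : nat) (T : R) (U : 'I_N -> R -> R -> R).
Hypotheses (T0 : 0 < T) (HU : forall k, solution_space T (U k)).

Lemma clamps_mass : exists2 m : R, 0 <= m & forall k, bounded_field m (clamp T (U k)).
Proof.
apply: (@uniform_bound R N (fun k m => bounded_field m (clamp T (U k)))) => [k C D|k].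
  exact: bounded_field_le.
have [m Hm] := clamp_mass T0 (HU k); exists m => //.
by have [_ du um] := Hm; apply: le_trans (um 0); exact: density_int_ge0.
Qed.

Lemma clamps_translation : exists2 M : R, 0 <= M & forall k t, translation_bound M (clamp T (U k) t).
Proof.
apply: (@uniform_bound R N (fun k M => forall t, translation_bound M (clamp T (U k) t))) => [k C D CD H t|k].
  exact: translation_bound_le CD (H t).
by have [M HM] := clamp_translation T0 (HU k); exists M => //; exact: translation_bound_ge0 (HM 0).
Qed.

Lemma normL1N_clamp (U' : 'I_N -> R -> R -> R) (HU' : forall k, solution_space T (U' k)) (t : R) :
  0 <= t <= T -> normL1N (fun k => U' k t \- U k t) =
  (\sum_k \int[leb]_x `|clamp T (U k) t x - clamp T (U' k) t x|)%:E.
Proof.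
move=> tT; rewrite /normL1N -sumEFin; apply: eq_bigr => k _.
have i := solution_ig T0 (HU k) tT; have i' := solution_ig T0 (HU' k) tT.
rewrite Lnorm1_int; last exact: igB.
congr (_%:E); rewrite L1_distC.
have [_ ic] := clamp_density T0 (HU k) t; have [_ ic'] := clamp_density T0 (HU' k) t.
exact: ae_int_dist i' i ic' ic (clamp_ae T0 (HU' k) tT) (clamp_ae T0 (HU k) tT).
Qed.

End theorem_data.

Theorem theorem6 (R : realType) (N : nat) (T : R)
    (f : 'I_N -> R -> R) (nu : 'I_N -> 'rV[R]_N -> R)
    (mu Gamma : 'I_N -> 'I_N -> R -> R)
    (U0 : 'I_N -> R -> R)
    (U : 'I_N -> R -> R -> R) (Udelta : R -> 'I_N -> R -> R -> R)
    (N_gt0 : (0 < N)%N) (T_gt0 : 0 < T)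
    (f_lip : forall k, [lipschitz f k x | x in setT])
    (f_01 : forall k, f k 0 = 0 /\ f k 1 = 0)
    (nu_C2 : forall k, Ck 2 (nu k))
    (nu_BV : forall k, (TV_rV (nu k) < +oo)%E)
    (nu_W2oo : forall k, W2oo setT (nu k))
    (mu_C2 : forall j k, Ck 2 (mu j k))
    (mu_W2oo : forall j k, W2oo setT (mu j k))
    (Gamma_ge0 : forall j k (t : R), 0 <= t -> 0 <= Gamma j k t)
    (Gamma_C2 : forall j k, C2_halfline (Gamma j k))
    (Gamma_W2oo : forall j k, W2oo [set t : R | 0 < t] (Gamma j k))
    (Gamma_supp : forall j k,
      closure [set t : R | 0 <= t /\ Gamma j k t != 0] `<=` `[0, 1])
    (Gamma_int : forall j k,
      \int[@lebesgue_measure R]_(t in `[0, +oo[) Gamma j k t = 1)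
    (U0_L1 : forall k, L1_01 (U0 k))
    (U0_BV : forall k, (TV (U0 k) < +oo)%E)
    (U_sol : entropy_solution T f nu (conv_space mu) U0 U)
    (Udelta_sol : forall delta : R, 0 < delta ->
      entropy_solution T f nu (conv_memory (Theta mu Gamma delta)) U0
        (Udelta delta)) :
  ereal_sup [set normL1N (fun k => Udelta delta k t \- U k t) | t in `[0, T]]
    @[delta --> 0^'+] --> 0%E
  /\
  exists C : R, \forall delta \near 0^'+,
    (normL1N (fun k => Udelta delta k T \- U k T)%R <= (C * Num.sqrt delta)%:E)%E.
Proof.
have HU k : solution_space T (U k) := U_sol.1 k.
have [L L0 fL] : exists2 L : R, 0 <= L & forall k a b, `|f k a - f k b| <= L * `|a - b|.
  apply: (@uniform_bound R N (fun k L => forall a b, `|f k a - f k b| <= L * `|a - b|)) => [k C D CD H a b|k].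
    by apply: le_trans (H a b) _; rewrite ler_wpM2r.
  exact: lipschitz_setT.
have f0 k : f k 0 = 0 := (f_01 k).1.
have [Cn Cn0 Hnu] : exists2 C : R, 0 <= C & forall k, C2b C (nu k).
  apply: (@uniform_bound R N (fun k C => C2b C (nu k))) => [k C D|k]; first exact: C2b_le.
  exact: W2oo_C2b.
pose mu' j k := 'D_1 (mu j k).
have [Cm Cm0 Hmu] : exists2 C : R, 0 <= C & forall j k, C11 C (mu j k) (mu' j k).
  apply: (@uniform_bound R N (fun j C => forall k, C11 C (mu j k) (mu' j k))) => [j C D CD H k|j].
    exact: C11_le CD (H k).
  apply: (@uniform_bound R N (fun k C => C11 C (mu j k) (mu' j k))) => [k C D|k]; first exact: C11_le.
  exact: C11_of_W2oo.
have mmu j k : measurable_fun setT (mu j k) := (C11_measurable (Hmu j k)).1.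
have muC j k y : `|mu j k y| <= Cm by have [] := Hmu j k y.
have [m m0 Hu] := clamps_mass T_gt0 HU.
have [M M0 tbu] := clamps_translation T_gt0 HU.
have cu k := clamp_L1_continuous T_gt0 (HU k).
pose u k := clamp T (U k); pose u0 k := clip01 (U0 k).
have du0 k : density (u0 k) by exact: clip01_density (L1_01_ig (U0_L1 k)).
have HVu k := velocity_space (Hnu k) Cm0 (fun j => Hmu j k) m0 Hu.
have HKu k : kruzkov T (f k) (space_velocity (nu k) (mu^~ k) u) (space_velocity' (nu k) (mu^~ k) (mu'^~ k) u) (u0 k) (u k).
  apply: (system_kruzkov T_gt0 HU (fL k) (U0_L1 k) (HVu k) _ U_sol) => t x /andP[t0 tT].
  by rewrite (conv_space_clamp T_gt0 HU (C := Cm))// (ltW t0) ltW.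
have [K K0 hol] : exists2 K : R, 0 <= K & forall j s t, 0 <= s <= T -> 0 <= t <= T ->
     \int[lebesgue_measure]_x `|u j t x - u j s x| <= K * Num.sqrt `|t - s|.
  apply: (@uniform_bound R N (fun j K => forall s t, 0 <= s <= T -> 0 <= t <= T ->
     \int[lebesgue_measure]_x `|u j t x - u j s x| <= K * Num.sqrt `|t - s|)) => [j C D CD H s t sT tT|j].
    by apply: le_trans (H s t sT tT) _; rewrite ler_wpM2r ?sqrtr_ge0.
  exact: (holder_time (fL j) (f0 j) (HVu j) (Hu j) T_gt0 (du0 j) (HKu j) (@cu j) (tbu j)).
(* Fixed before [delta] is introduced, from the data and the memoryless solution alone; this is the
   uniformity claimed for the final constant. *)
pose B := error_bound (N := N) T L Cn Cm m M K.
have main (delta : R) : 0 < delta -> delta <= 1 -> forall t, 0 <= t <= T ->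
    (normL1N (fun k => Udelta delta k t \- U k t)%R <= (B * Num.sqrt delta)%:E)%E.
  move=> d0 d1 t tT; have sol := Udelta_sol _ d0.
  have HUd k : solution_space T (Udelta delta k) := sol.1 k.
  rewrite (normL1N_clamp T_gt0 HU HUd tT) lee_fin.
  have [mv mv0 Hv] := clamps_mass T_gt0 HUd.
  have [Mv Mv0 tbv] := clamps_translation T_gt0 HUd.
  have cv k := clamp_L1_continuous T_gt0 (HUd k).
  pose v k := clamp T (Udelta delta k).
  pose kappa k := fun j => memory delta (Gamma j k).
  have HVv k := velocity_memory_system (Hnu k) Cm0 (fun j => Hmu j k) mv0 Hv
    (fun j => memory_subkernel d0 (@Gamma_ge0 j k) (@Gamma_C2 j k) (@Gamma_supp j k) (@Gamma_int j k)).
  have HKv k : kruzkov T (f k) (memory_velocity (nu k) (kappa k) (mu^~ k) v)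
      (memory_velocity' (nu k) (kappa k) (mu^~ k) (mu'^~ k) v) (u0 k) (v k).
    apply: (system_kruzkov T_gt0 HUd (fL k) (U0_L1 k) (HVv k) _ sol) => s x /andP[s0 sT].
    by rewrite (@conv_memory_clamp R N T _ T_gt0 HUd mu Gamma Cm)// (ltW s0) ltW.
  (* Both solutions attain the same clipped datum at time 0, each by its own initial trace, so the
     stability estimate starts from 0. *)
  have start k : \int[lebesgue_measure]_x `|u k 0 x - v k 0 x| = 0.
    have [Mi tbi] := clip01_translation (U0_L1 k) (U0_BV k).
    have h1 := initial_trace (fL k) (f0 k) (HVu k) (Hu k) T_gt0 (du0 k) (HKu k) (@cu k) (tbu k) tbi.
    have h2 := initial_trace (fL k) (f0 k) (HVv k) (Hv k) T_gt0 (du0 k) (HKv k) (@cv k) (tbv k) tbi.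
    apply/eqP; rewrite eq_le int_ge0// andbT.
    have [_ iu] := clamp_density T_gt0 (HU k) 0; have [_ iv] := clamp_density T_gt0 (HUd k) 0.
    have [_ i0] := du0 k.
    by apply: le_trans (L1_triangle iu i0 iv) _; rewrite h1 add0r L1_distC h2.
  exact: (memory_error T_gt0 fL f0 Hnu Cm0 Hmu Hu (@cu) tbu hol K0 du0 HKu d0 d1 Gamma_ge0 Gamma_C2
    Gamma_supp Gamma_int Hv (@cv) HKv start N_gt0 tT).
have near1 : \forall delta \near (0 : R)^'+, 0 < delta <= 1.
  near=> d; apply/andP; split; [by near: d; exact: nbhs_right_gt|by near: d; exact: nbhs_right_le].
split; last first.
  exists B; near=> delta; have /andP[d0 d1] : 0 < delta <= 1 by near: delta.
  by apply: main => //; rewrite lexx ltW.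
(* The bound of [main] is uniform in t, so it also bounds the supremum over [0, T], squeezed between
   0 and B sqrt delta. *)
apply: (@squeeze_cvge _ _ _ _ (fun=> 0%E) _ (fun delta => (B * Num.sqrt delta)%:E)).
- near=> delta; have /andP[d0 d1] : 0 < delta <= 1 by near: delta.
  apply/andP; split.
    apply: ereal_sup_ge; exists (normL1N (fun k => Udelta delta k 0 \- U k 0)%R).
      by exists 0 => //=; rewrite in_itv/= lexx ltW.
    by apply: sume_ge0 => k _; exact: Lnorm_ge0.
  apply: ub_ereal_sup => _ [t /= + <-]; rewrite in_itv/= => tT.
  exact: main.
- exact: cvg_cst.
- have : B * Num.sqrt delta @[delta --> 0^'+] --> (B * Num.sqrt 0 : R).
    apply: cvgM; first exact: cvg_cst.
    apply: cvg_at_right_filter; exact: sqrt_continuous.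
  by rewrite sqrtr0 mulr0 => h; apply: cvg_EFin => //; near=> x.
Unshelve. all: by end_near. Qed.
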